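(* Let $k$, $\varphi$, $b$, $a_1,\dots,a_d$ and $\mathbf V(s)$ be as in the context, and let $(T,D_t)$ be the trivial differential module of rank $1$ with direct image $(T_\varphi,D_s)$. Let $0<r_1<\dots<r_n\le1$ be the branching radii of the branching points of $\mathbb T_{\varphi,b}$. For each $i=1,\dots,n$ and each $\eta\in\mathcal B_{\varphi,b}(r_i)$ let $\mathscr U_\eta$ be any set of $\delta(\eta)-1$ branches at $\eta$, and put $\Pi_i=\{\mathbf V(s)\,v_{\mathcal U}:\ \mathcal U\in\mathscr U_\eta,\ \eta\in\mathcal B_{\varphi,b}(r_i)\}$. Then: (1) every element of $\Pi_i$ is a horizontal element of $(T_\varphi,D_s)$ at $b$ with radius of convergence $r_i$ at $b$; (2) $\bigcup_{i=1}^n\Pi_i\cup\{E_1\}$, where $E_1=[1,0,\dots,0]^T=\mathbf V(s)[1,\dots,1]^T$, is an optimal basis of the space of horizontal elements of $(T_\varphi,D_s)$ at $b$.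
   Context: $k$ is an algebraically closed field complete for a non-archimedean absolute value extending the $p$-adic one. ${\mathscr D}_t(a,r^-)$ and ${\mathscr D}_t(a,r)$ are open/closed Berkovich discs; ${\mathscr D}_t^\pm$ is the unit disc (open or closed) with ring $\mathcal O_t^\pm$; $\mathcal O_t(a,r^-)$ is the ring of power series in $t-a$ converging on $|t-a|<r$; $\eta_{a,r}$ is the maximal point of ${\mathscr D}_t(a,r)$, $\eta_{a,0}=a$. For $f\in k[[t-a]]$, $\mathcal R_a(f)=\sup\{r\in[0,1):f\in\mathcal O_t(a,r^-)\}$; for vectors, the minimum over components. $\varphi:{\mathscr D}_t^\pm\to{\mathscr D}_s^\pm$ is a finite étale morphism of degree $d$ of unit discs, $s=f(t)$; $P(s,X)$ the unique monic degree-$d$ polynomial over $\mathcal O_s^\pm$ with $P(f(t),t)=0$. Fix $b\in{\mathscr D}_s^\pm(k)$, $\varphi^{-1}(b)=\{a_1,\dots,a_d\}$; $u_{a_i}(s)\in k[[s-b]]$ the root of $P(s,X)$ with constant term $a_i$; $\mathbf V(s)$ the inverse of the Vandermonde matrix $(u_{a_i}(s)^{j-1})_{i,j}$. Trivial module: $T=\mathcal O_t^\pm e$, $D_t(ge)=\frac{dg}{dt}e$. Direct image $(T_\varphi,D_s)$: $T$ as $\mathcal O_s^\pm$-module via $s=f(t)$, $D_s=\frac1{f'(t)}D_t$, basis $e,te,\dots,t^{d-1}e$. Horizontal elements at $b$: elements of $\ker D_s$ on $T_\varphi\otimes\mathcal O_s(b,r^-)$ for some $r>0$, identified with coordinate vectors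 in $k[[s-b]]^d$, radius $\mathcal R_b$ of that vector. Multiradius at $b$: $(\mathcal R_1,\dots,\mathcal R_d)$, $\mathcal R_i=\sup\{r\in(0,1]:\dim_k\ker(D_s)\ge d-i+1\text{ on }T_\varphi\otimes\mathcal O_s(b,r^-)\}$; a basis of horizontal elements at $b$ is optimal if its radii rearrange to the multiradius. Tree: $l_{t,a}=\{\eta_{a,r}\}$, $r\in[0,1)$ (open case) or $[0,1]$ (closed case); $\mathbb T_{\varphi,b}=\bigcup_il_{t,a_i}$. A branching point is $\eta\in\mathbb T_{\varphi,b}$ with $\mathbb T_{\varphi,b}\setminus\{\eta\}$ having more than two connected components; a branch at $\eta$ is an open disc that is a connected component of ${\mathscr D}_t^\pm\setminus\{\eta\}$ meeting $\mathbb T_{\varphi,b}$; $\delta(\eta)$ is the number of branches. The branching radius of a branching point $\eta$ is $r$ with $\varphi(\eta)=\eta_{b,r}$ (equivalently the radius of $\varphi(\mathcal D)$ for any branch $\mathcal D$ at $\eta$); $\mathcal B_{\varphi,b}(r)$ is the set of branching points with branching radius $r$. For an open disc $\mathcal U\subseteq{\mathscr D}_t^\pm$, $v_{\mathcal U}\in k^d$ is the column vector whose $i$-th entry is $1$ if $a_i\in\mathcal U$ and $0$ otherwise.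
   Formalization: A branching point is taken to be a tree point with δ(η) ≥ 2; this differs from ''more than two connected components'' only at the top point of the closed disc when δ = 2, where the literal definition makes (2) false (p = 2, f = t + t², b = 0). *)

(* Defs.v *)
From HB Require Import structures.
From mathcomp Require Import all_boot all_order all_algebra.
From mathcomp Require Import all_classical all_reals.
From mathcomp Require Import topology normedtype sequences.
Set Implicit Arguments. Unset Strict Implicit. Unset Printing Implicit Defensive.
Import Order.TTheory GRing.Theory Num.Theory.
Import numFieldNormedType.Exports.
Local Open Scope classical_set_scope.
Local Open Scope ring_scope.

Section NonArch.
Variables (R : realType) (k : closedFieldType) (abs : k -> R).

Definition kcvg (u : nat -> k) (L : k) : Prop :=
  (fun n => abs (u n - L)) @ \oo --> (0 : R).

Definition is_nonarch_pabs (p : nat) : Prop :=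
  [/\ prime p,
      ((forall x, 0 <= abs x) /\ (forall x, abs x = 0 <-> x = 0)),
      (forall x y, abs (x * y) = abs x * abs y /\
                   abs (x + y) <= Num.max (abs x) (abs y)),
      abs (p%:R) = (p%:R)^-1 &
      (forall u : nat -> k,
        (forall eps : R, 0 < eps -> exists N, forall m n, (N <= m)%N -> (N <= n)%N ->
            abs (u m - u n) < eps) ->
        exists L, kcvg u L)].

(** limit (junk value 0 if no limit) *)
Definition klim (u : nat -> k) : k := xget 0 [set L | kcvg u L].

(** formal power series (in a variable t - a, the centre being implicit) *)
Definition ps := nat -> k.
Definition psconst (c : k) : ps := fun n => if n == 0%N then c else 0.
Definition psmul (f g : ps) : ps := fun n => \sum_(i < n.+1) f i * g (n - i)%N.
Definition pspow (f : ps) (j : nat) : ps := iter j (psmul f) (psconst 1).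
Definition psderiv (f : ps) : ps := fun n => (n.+1)%:R * f n.+1.

Definition peval (c : ps) (x : k) : k := klim (fun N => \sum_(n < N) c n * x ^+ n).

Definition recenter (c : ps) (b : k) : ps :=
  fun m => klim (fun N => \sum_(n < N) c n * 'C(n, m)%:R * b ^+ (n - m)).

Definition conv_open (c : ps) (r : R) : Prop :=
  forall rho : R, 0 <= rho < r -> (fun n => abs (c n) * rho ^+ n) @ \oo --> (0 : R).

Definition indisc (cl : bool) (x : k) : Prop := if cl then abs x <= 1 else abs x < 1.
Definition inO (cl : bool) (c : ps) : Prop :=
  if cl then (fun n => abs (c n)) @ \oo --> (0 : R) else conv_open c 1.

Definition rad_ps (c : ps) : R := sup [set r : R | 0 <= r < 1 /\ conv_open c r].

Section Module.
Variable d : nat.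
(** coordinate vectors in k[[s-b]]^d w.r.t. the basis e, te, ..., t^{d-1}e *)
Definition vec := 'I_d -> ps.

Definition rad_vec (g : vec) : R := \big[Num.min/1]_(j < d) rad_ps (g j).

Variables (b : k) (G : 'I_d -> 'I_d -> ps).
(** G i j (in O_s^{+-}) = coordinates of D_s(t^j e) = j t^{j-1}/f'(t) e on t^i e.
   D_s (sum_j g_j t^j e) = sum_i (g_i' + sum_j G_ij g_j) t^i e, with G_ij
   re-expanded at b. *)
Definition Ds_ker (g : vec) : Prop :=
  forall i n, psderiv (g i) n + \sum_(j < d) psmul (recenter (G i j) b) (g j) n = 0.

Definition horizontal_on (r : R) (g : vec) : Prop :=
  (forall j, conv_open (g j) r) /\ Ds_ker g.
Definition horizontal (g : vec) : Prop := exists r : R, 0 < r /\ horizontal_on r g.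

Definition lin_indep q (e : 'I_q -> vec) : Prop :=
  forall c : 'I_q -> k, (forall j n, \sum_(l < q) c l * e l j n = 0) -> forall l, c l = 0.
Definition spans q (e : 'I_q -> vec) (H : set vec) : Prop :=
  forall h, H h -> exists c : 'I_q -> k, forall j n, h j n = \sum_(l < q) c l * e l j n.

(** multiradius: R_(m+1) = sup {r in (0,1] : dim ker D_s on T_phi (x) O_s(b,r^-) >= d - m} *)
Definition multirad (m : 'I_d) : R :=
  sup [set r : R | 0 < r <= 1 /\
        exists e : 'I_(d - m) -> vec, (forall l, horizontal_on r (e l)) /\ lin_indep e].

Definition optimal_basis (B : set vec) : Prop :=
  exists e : 'I_d -> vec,
    [/\ injective e, B = range e, (forall l, horizontal (e l)),
        lin_indep e /\ spans e horizontal & forall l, rad_vec (e l) = multirad l].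

Variable u : 'I_d -> ps.
(** w = V(s) v, where V(s) is the inverse of the Vandermonde matrix (u_i^{j-1})_{i,j}:
    w is the solution of (u_i^{j-1}) w = v in k[[s-b]]^d *)
Definition Vsol (v : 'I_d -> k) (w : vec) : Prop :=
  forall i n, \sum_(j < d) psmul (pspow (u i) j) (w j) n = psconst (v i) n.

Definition E1 : vec := fun j => if (val j == 0)%N then psconst 1 else psconst 0.

Variable a : 'I_d -> k.
(** Tree points eta_{a_c, rho}.  A branch at eta_{a_c,rho} meeting the tree is an
    open disc D(a_j, rho^-) with |a_j - a_c| <= rho; it is recorded by the set of
    indices i with a_i in it, {i : |a_i - a_j| < rho} (which determines it). *)
Definition branches (c : 'I_d) (rho : R) : {set {set 'I_d}} :=
  ([set [set i | abs (a i - a j) < rho] | j in [set j | abs (a j - a c) <= rho]])%SET.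
Definition delta (c : 'I_d) (rho : R) : nat := #|branches c rho|.
Definition vU (U : {set 'I_d}) : 'I_d -> k := fun i => if i \in U then 1 else 0.

Variable cl : bool.
Definition in_tree_range (rho : R) : Prop := 0 <= rho /\ (if cl then rho <= 1 else rho < 1).
Definition branching (c : 'I_d) (rho : R) : Prop := in_tree_range rho /\ (2 <= delta c rho)%N.

Variable f : ps.
(** branching radius: phi(eta_{a_c,rho}) = eta_{b, r} *)
Definition brad (c : 'I_d) (rho : R) : R :=
  sup [set abs (peval f x - b) | x in [set x | abs (x - a c) <= rho]].
End Module.
End NonArch.

(* Main.v *)
(** Near [a_i] one has [t = u_i(f(t))], so the columns of [G] express the derivatives of the
    powers of [u_i], and a vector [w] of formal series is horizontal iff the Vandermonde
    system turns it into a constant vector [v].  Its radius is then read off from [v].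

    If [w] converges on a disc of radius greater than the branching radius of [eta], then
    [sum_j w_j(f(t)) t^j] is analytic on the closed disc of [eta] and equals [v_i] near
    [a_i]; hence [v] is constant on the [a_i] in that disc.

    Conversely let [U] be a branch at [eta], containing [a_j], with branching radius [r].
    Since [|f(x) - b| = prod_i |x - a_i|], the polynomial
    [L = prod_(a_i not in U) (t - a_i) / (a_j - a_i)] is bounded by [1] on the inverse image
    of any disc around [b] of radius [rho < r], while [|L - v_U| < 1] at each [a_i].
    Iterating [e |-> 3 e^2 - 2 e^3] gives polynomials with the same bound whose germs at
    the [a_i] tend to the indicator of [U].  Their coordinates in the basis [t^j] are
    bounded on the disc of radius [rho] by Lagrange interpolation, the derivative of
    [P(s, X)] at its roots being bounded below because [f'] is invertible; and they tend
    coefficientwise to [V v_U], which therefore converges on the disc of radius [r].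

    It remains to see that the chosen [v_U], together with the constant vector, form a
    basis of [k^d] in which the vectors that are constant on all discs of branching radius
    less than [r] are spanned by the [v_U] of branching radius at least [r]. *)

Require Import Defs.
From HB Require Import structures.
From mathcomp Require Import all_boot all_order all_algebra.
From mathcomp Require Import all_classical all_reals.
From mathcomp Require Import topology normedtype sequences.
From mathcomp Require Import cyclic separable cyclotomic.
From mathcomp Require Import ring lra zify.
Set Implicit Arguments. Unset Strict Implicit. Unset Printing Implicit Defensive.
Import Order.TTheory GRing.Theory Num.Theory.
Import numFieldNormedType.Exports.
Local Open Scope classical_set_scope.
Local Open Scope ring_scope.

(** * Formal power series *)

(** The indicator of a branch is analytic on the inverse image of a small disc around [b], but that
    set falls apart into several discs on which no single power series in [t] represents it. Hence
    the detour through polynomials: they only have to stay bounded by 1 on the whole inverse image,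
    while their convergence is examined near the [a_i] alone. A bound on the coordinates at one
    radius survives the coefficientwise limit, and it gives convergence at every smaller radius.

    The polynomial [3 e^2 - 2 e^3] fixes 0 and 1 and has derivative 0 at both, so it squares the
    distance to them; its coefficients are integers, so it preserves the bound 1 whatever [p] is.

    Bounds on coefficients are deduced from bounds on values at points of [k]. This works at radii
    that are absolute values of elements of [k]; other real radii are approached by such ones. *)

Section PowerSeriesRing.
Variable k : closedFieldType.
Implicit Types (c e g F z : ps k).

(** With a ring structure on [ps k], polynomials and matrices over formal power series become
    available. *)
HB.instance Definition _ := gen_eqMixin (ps k).
HB.instance Definition _ := gen_choiceMixin (ps k).

Definition psadd c e : ps k := fun n => c n + e n.
Definition psopp c : ps k := fun n => - c n.

Fact psaddA : associative psadd.
Proof. by move=> c e g; apply/funext => n; rewrite /psadd addrA. Qed.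
Fact psaddC : commutative psadd.
Proof. by move=> c e; apply/funext => n; rewrite /psadd addrC. Qed.
Fact psadd0 : left_id (fun=> 0 : k) psadd.
Proof. by move=> c; apply/funext => n; rewrite /psadd add0r. Qed.
Fact psaddN : left_inverse (fun=> 0 : k) psopp psadd.
Proof. by move=> c; apply/funext => n; rewrite /psadd addNr. Qed.

HB.instance Definition _ := GRing.isZmodule.Build (ps k) psaddA psaddC psadd0 psaddN.

Definition pstrunc N c : {poly k} := \poly_(i < N) c i.

(** Low coefficients of a product depend only on truncations, so the ring laws and the Leibniz rule
    are inherited from [{poly k}]. *)
Lemma psmulE N c e n : (n < N)%N -> psmul c e n = (pstrunc N c * pstrunc N e)`_n.
Proof.
move=> ltnN; rewrite coefM /psmul; apply: eq_bigr => i _.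
rewrite !coef_poly (leq_ltn_trans _ ltnN); last by rewrite -ltnS.
by rewrite (leq_ltn_trans _ ltnN) ?leq_subr.
Qed.

Fact psmulC : commutative (@psmul k).
Proof. by move=> c e; apply/funext => n; rewrite !(@psmulE n.+1) // mulrC. Qed.

Fact psmulA : associative (@psmul k).
Proof.
have aux c e g n : psmul (psmul c e) g n =
    ((pstrunc n.+1 c * pstrunc n.+1 e) * pstrunc n.+1 g)`_n.
  rewrite coefM; apply: eq_bigr => i _.
  by rewrite (@psmulE n.+1) // coef_poly ltnS leq_subr.
move=> c e g; apply/funext => n.
by rewrite aux psmulC aux; congr (_`_n); rewrite mulrC mulrA.
Qed.

Fact psmul1 : left_id (psconst (1 : k)) (@psmul k).
Proof.
move=> c; apply/funext => n; rewrite /psmul big_ord_recl /= /psconst /= mul1r subn0.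
by rewrite big1 ?addr0 // => i _; rewrite mul0r.
Qed.

Fact psmulDl : left_distributive (@psmul k) psadd.
Proof.
move=> c e g; apply/funext => n; rewrite /psadd /psmul -big_split /=.
by apply: eq_bigr => i _; rewrite mulrDl.
Qed.

Fact psone_neq0 : psconst (1 : k) != 0 :> ps k.
Proof. by apply/eqP => /(congr1 (fun c => c 0%N)) /eqP; rewrite /psconst /= oner_eq0. Qed.

HB.instance Definition _ := GRing.Zmodule_isComNzRing.Build (ps k)
  psmulA psmulC psmul1 psmulDl psone_neq0.

Lemma psD c e n : (c + e) n = c n + e n. Proof. by []. Qed.
Lemma psN c n : (- c) n = - c n. Proof. by []. Qed.
Lemma psB c e n : (c - e) n = c n - e n. Proof. by []. Qed.
Lemma ps0 n : (0 : ps k) n = 0. Proof. by []. Qed.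
Lemma psMn c j n : (c *+ j) n = c n *+ j.
Proof. by elim: j => //= j IH; rewrite !mulrS psD IH. Qed.
Lemma ps1 n : (1 : ps k) n = (n == 0%N)%:R. Proof. by rewrite /GRing.one /= /psconst; case: eqP. Qed.
Lemma psmulMul c e : psmul c e = c * e. Proof. by []. Qed.
Lemma psM c e n : (c * e) n = \sum_(i < n.+1) c i * e (n - i)%N. Proof. by []. Qed.
Lemma psM0 c e : (c * e) 0%N = c 0%N * e 0%N.
Proof. by rewrite psM big_ord_recl big_ord0 addr0 subn0. Qed.
Lemma ps_sum (I : Type) (r : seq I) (Q : pred I) (F : I -> ps k) n :
  (\sum_(i <- r | Q i) F i) n = \sum_(i <- r | Q i) F i n.
Proof. by apply: (big_morph (fun c : ps k => c n)). Qed.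
Lemma pspowE c j : pspow c j = c ^+ j.
Proof. by elim: j => //= j IH; rewrite exprS -IH. Qed.

Fact psC_zmod : zmod_morphism (@psconst k : k -> ps k).
Proof. by move=> x y; apply/funext => n; rewrite psB /psconst; case: eqP; rewrite ?subr0. Qed.
Fact psC_mon : monoid_morphism (@psconst k : k -> ps k).
Proof.
split=> // x y; apply/funext => n; rewrite psM big_ord_recl /= /psconst /= subn0.
rewrite big1 ?addr0; first by case: eqP; rewrite ?mulr0.
by move=> i _; rewrite mul0r.
Qed.
HB.instance Definition _ := GRing.isZmodMorphism.Build k (ps k) (@psconst k) psC_zmod.
HB.instance Definition _ := GRing.isMonoidMorphism.Build k (ps k) (@psconst k) psC_mon.

Lemma psC0 : psconst 0 = 0 :> ps k. Proof. exact: rmorph0. Qed.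
Lemma psC1 : psconst 1 = 1 :> ps k. Proof. by []. Qed.
Lemma psCM x c n : (psconst x * c) n = x * c n.
Proof.
rewrite psM big_ord_recl /= subn0 big1 ?addr0 // => i _.
by rewrite /psconst /= mul0r.
Qed.

Fact pscoef0_zmod : zmod_morphism ((fun c => c 0%N) : ps k -> k).
Proof. by []. Qed.
Fact pscoef0_mon : monoid_morphism ((fun c => c 0%N) : ps k -> k).
Proof. by split=> // c e; rewrite psM0. Qed.
(** Reduction modulo the maximal ideal, as a ring morphism: it carries the Vandermonde matrix of the
    [u_i] to that of the [a_i]. *)
Definition pscoef0 (c : ps k) : k := c 0%N.
HB.instance Definition _ := GRing.isZmodMorphism.Build (ps k) k pscoef0 pscoef0_zmod.
HB.instance Definition _ := GRing.isMonoidMorphism.Build (ps k) k pscoef0 pscoef0_mon.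

Lemma psX0 c j : (c ^+ j) 0%N = c 0%N ^+ j.
Proof. exact: (rmorphXn pscoef0). Qed.

(** Serves to cancel the cofactor of a simple root in [comp_u] and the derivative of [f] in
    [u_deriv]. *)
Lemma ps_regular c e : c 0%N != 0 -> c * e = 0 -> e = 0.
Proof.
move=> c0 ce; apply/funext => n; elim/ltn_ind: n => n IH.
have := congr1 (fun h : ps k => h n) ce; rewrite /= psM big_ord_recl big1.
  by rewrite addr0 subn0 => /eqP; rewrite mulf_eq0 (negPf c0) => /eqP.
by move=> i _; rewrite IH ?mulr0 //= /bump /=; have := ltn_ord i; lia.
Qed.

Definition poly2ps (q : {poly k}) : ps k := fun n => q`_n.
Fact poly2ps_zmod : zmod_morphism poly2ps.
Proof. by move=> q h; apply/funext => n; rewrite psB /poly2ps coefB. Qed.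
Fact poly2ps_mon : monoid_morphism poly2ps.
Proof.
split; first by apply/funext => n; rewrite /poly2ps coef1 ps1.
by move=> q h; apply/funext => n; rewrite psM /poly2ps coefM.
Qed.
HB.instance Definition _ := GRing.isZmodMorphism.Build {poly k} (ps k) poly2ps poly2ps_zmod.
HB.instance Definition _ := GRing.isMonoidMorphism.Build {poly k} (ps k) poly2ps poly2ps_mon.
Lemma poly2psC x : poly2ps x%:P = psconst x.
Proof. by apply/funext => n; rewrite /poly2ps coefC /psconst. Qed.

Lemma psderivM c e : psderiv (c * e) = psderiv c * e + c * psderiv e.
Proof.
apply/funext => n; rewrite psD.
have D h N m : (m < N)%N -> (pstrunc N.+1 h)^`()`_m = psderiv h m.
  by move=> ltmN; rewrite coef_deriv coef_poly !ltnS ltmN /psderiv mulr_natl.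
have -> : psderiv (c * e) n = ((pstrunc n.+2 c * pstrunc n.+2 e)^`())`_n.
  by rewrite coef_deriv /psderiv mulr_natl -psmulE.
rewrite derivM coefD; congr (_ + _); rewrite coefM psM; apply: eq_bigr => i _.
  rewrite D // coef_poly.
  by case: ltnP => //; lia.
rewrite D ?coef_poly; last by rewrite ltnS leq_subr.
by case: ltnP => //; have := ltn_ord i; lia.
Qed.

Lemma psderivD c e : psderiv (c + e) = psderiv c + psderiv e.
Proof. by apply/funext => n; rewrite psD /psderiv psD mulrDr. Qed.
Lemma psderiv_sum (I : Type) (r : seq I) (F : I -> ps k) :
  psderiv (\sum_(i <- r) F i) = \sum_(i <- r) psderiv (F i).
Proof.
apply: (big_morph (@psderiv k) psderivD).
by apply/funext => n; rewrite /psderiv mulr0.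
Qed.
Lemma psderivC x : psderiv (psconst x) = 0 :> ps k.
Proof. by apply/funext => n; rewrite /psderiv /psconst mulr0. Qed.
Lemma psderivX c n : psderiv (c ^+ n) = (c ^+ n.-1 * psderiv c) *+ n.
Proof.
elim: n => [|n IH]; first by rewrite expr0 mulr0n -[1]/(psconst 1) psderivC.
rewrite exprS psderivM IH -mulrnAr mulrS /= mulrC; congr (_ + _).
case: n {IH} => [|n]; first by rewrite !mulr0n !mulr0.
by rewrite /= -!mulrnAr mulrA -exprS.
Qed.

(** Substitution of [F] in [z]; the truncation [n <= m] makes it junk unless [F 0 = 0]. *)
Definition pscomp (F z : ps k) : ps k := fun m => \sum_(n < m.+1) z n * (F ^+ n) m.

Lemma pscompC F x : pscomp F (psconst x) = psconst x.
Proof.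
apply/funext => m; rewrite /pscomp big_ord_recl big1; last by move=> i _; rewrite /psconst /= mul0r.
by rewrite expr0 ps1 addr0 /psconst /=; case: eqP; rewrite ?mulr1 ?mulr0.
Qed.

Section Comp.
Variable F : ps k.
Hypothesis F0 : F 0%N = 0.

(** This is why the truncated sum in [pscomp] loses nothing. *)
Lemma psX_lt n m : (m < n)%N -> (F ^+ n) m = 0.
Proof.
elim: n m => [//|n IH] m ltmn; rewrite exprS psM big_ord_recl F0 mul0r add0r.
by rewrite big1 // => i _; rewrite IH ?mulr0 //= /bump /=; have := ltn_ord i; lia.
Qed.

Lemma pscomp_wide N z m : (m < N)%N -> pscomp F z m = \sum_(n < N) z n * (F ^+ n) m.
Proof.
move=> ltmN; rewrite /pscomp -!(big_mkord xpredT (fun n => z n * (F ^+ n) m)).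
rewrite [RHS](big_cat_nat (n := m.+1)) //= [X in _ = _ + X]big_nat_cond [X in _ = _ + X]big1 ?addr0 // => i.
by move=> /andP[/andP[lt _] _]; rewrite psX_lt ?mulr0.
Qed.

(** For polynomials substitution is evaluation in the ring [ps k]; multiplicativity of [pscomp F]
    then follows from [hornerM] by truncation. *)
Lemma pscomp_poly (q : {poly k}) : pscomp F (poly2ps q) = (map_poly (@psconst k) q).[F].
Proof.
apply/funext => m; rewrite (@pscomp_wide (maxn m.+1 (size q))) ?leq_max ?leqnn //.
rewrite (@horner_coef_wide _ (maxn m.+1 (size q))) ?ps_sum; last first.
  by rewrite (leq_trans (size_poly _ _)) // leq_max leqnn orbT.
by apply: eq_bigr => i _; rewrite coef_map psCM.
Qed.

Lemma pscomp_trunc N z m : (m < N)%N -> pscomp F z m = pscomp F (poly2ps (pstrunc N z)) m.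
Proof.
move=> lt; rewrite !(@pscomp_wide N) //; apply: eq_bigr => i _.
by rewrite /poly2ps coef_poly ltn_ord.
Qed.

Fact pscomp_zmod : zmod_morphism (pscomp F).
Proof.
move=> c e; apply/funext => m; rewrite psB -sumrB; apply: eq_bigr => i _.
by rewrite psB mulrBl.
Qed.
Fact pscomp_mon : monoid_morphism (pscomp F).
Proof.
split; first exact: pscompC.
move=> c e; apply/funext => m.
have -> : pscomp F (c * e) m = pscomp F (poly2ps (pstrunc m.+1 c * pstrunc m.+1 e)) m.
  by apply: eq_bigr => i _; rewrite /poly2ps -(psmulE c e).
rewrite pscomp_poly rmorphM hornerM -!pscomp_poly !psM; apply: eq_bigr => i _.
by rewrite -!(@pscomp_trunc m.+1) // ltnS leq_subr.
Qed.
End Comp.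

Lemma pscomp_deriv F z : F 0%N = 0 ->
  psderiv (pscomp F z) = pscomp F (psderiv z) * psderiv F.
Proof.
move=> F0; apply/funext => m; rewrite {1}/psderiv {1}/pscomp big_ord_recl expr0 ps1 mulr0 add0r mulr_sumr.
transitivity (\sum_(l < m.+1) psderiv z l * (F ^+ l * psderiv F) m).
  apply: eq_bigr => i _; rewrite lift0 mulrCA.
  by rewrite -[_%:R * _]/(psderiv (F ^+ i.+1) m) psderivX /= psMn -[_ *+ i.+1]mulr_natl
    mulrCA mulrA.
rewrite psM; under [RHS]eq_bigr => i _ do
  rewrite (@pscomp_wide _ F0 m.+1) ?ltn_ord // mulr_suml.
rewrite exchange_big /=; apply: eq_bigr => l _; rewrite psM mulr_sumr.
by apply: eq_bigr => i _; rewrite mulrA.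
Qed.

Lemma pscompM F c e : F 0%N = 0 -> pscomp F (c * e) = pscomp F c * pscomp F e.
Proof. by move=> F0; apply: (pscomp_mon F0).2. Qed.
Lemma pscompX F c n : F 0%N = 0 -> pscomp F (c ^+ n) = pscomp F c ^+ n.
Proof.
move=> F0; elim: n => [|n IH]; last by rewrite !exprS pscompM // IH.
by rewrite !expr0 -psC1 pscompC.
Qed.
Lemma pscompB F c e : pscomp F (c - e) = pscomp F c - pscomp F e.
Proof. exact: pscomp_zmod. Qed.
Lemma pscomp_sum (I : Type) (r : seq I) F (h : I -> ps k) :
  pscomp F (\sum_(i <- r) h i) = \sum_(i <- r) pscomp F (h i).
Proof.
apply: (big_morph (pscomp F)) => [c e|]; last by rewrite -psC0 pscompC.
have -> : c + e = c - (0 - e) by rewrite sub0r opprK.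
by rewrite !pscompB -psC0 pscompC psC0 sub0r opprK.
Qed.
Lemma pscomp0 F z : pscomp F z 0%N = z 0%N.
Proof. by rewrite /pscomp big_ord_recl big_ord0 expr0 ps1 mulr1 addr0. Qed.
(** Write [c = c(0) (1 - F)] with [F] without constant term, and substitute [F] into the geometric
    series. *)
Lemma ps_inverse c : c 0%N != 0 -> exists e, c * e = 1.
Proof.
move=> c0; pose X : ps k := poly2ps 'X; pose geo : ps k := fun=> 1.
have geoE : (1 - X) * geo = 1.
  apply/funext => -[|n]; rewrite psM ps1.
    by rewrite big_ord_recl big_ord0 psB ps1 /X /poly2ps coefX /geo subr0 mulr1 addr0.
  rewrite big_ord_recl big_ord_recl big1 ?addr0 => [|i _]; last first.
    by rewrite psB ps1 /X /poly2ps coefX /= subr0 mul0r.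
  by rewrite !psB !ps1 /X /poly2ps !coefX /= /geo subr0 sub0r !mulr1 subrr.
pose F := 1 - psconst (c 0%N)^-1 * c.
have F0 : F 0%N = 0 by rewrite /F psB psCM ps1 mulVf // subrr.
have FX : pscomp F X = F.
  by rewrite /X pscomp_poly // map_polyX hornerX.
exists (psconst (c 0%N)^-1 * pscomp F geo).
have := congr1 (pscomp F) geoE; rewrite pscompM // pscompB FX -psC1 pscompC psC1 => <-.
by rewrite /F subKr mulrA [c * _]mulrC.
Qed.

(** Substitution is triangular with diagonal entries [(F ^+ n) n = F 1 ^+ n]. Solving for [z n]
    yields injectivity, and later the estimate [pscomp_bound]. *)
Lemma pscomp_small F z n : F 0%N = 0 -> F 1%N != 0 ->
  z n = (F 1%N ^+ n)^-1 * (pscomp F z n - \sum_(l < n) z l * (F ^+ l) n).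
Proof.
move=> F0 F1; rewrite /pscomp big_ord_recr /= [_ + z n * _]addrC addrK.
have -> : (F ^+ n) n = F 1%N ^+ n.
  elim: n => [|n IH]; first by rewrite !expr0 ps1.
  rewrite !exprS psM big_ord_recl F0 mul0r add0r big_ord_recl big1 ?addr0.
    by rewrite /= /bump /= subn1 IH.
  by move=> i _; rewrite psX_lt ?mulr0 //= /bump /=; have := ltn_ord i; lia.
by rewrite mulrCA mulVf ?mulr1 // expf_eq0 (negPf F1) andbF.
Qed.
Lemma pscomp_inj F : F 0%N = 0 -> F 1%N != 0 -> injective (pscomp F).
Proof.
move=> F0 F1 c e ce; apply/funext => n; elim/ltn_ind: n => n IH.
rewrite (@pscomp_small _ c _ F0 F1) (@pscomp_small _ e _ F0 F1) ce; congr (_ * (_ - _)).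
by apply: eq_bigr => i _; rewrite IH.
Qed.
End PowerSeriesRing.

(** * Convergent power series *)

Section NonArchimedean.
Variables (R : realType) (k : closedFieldType) (abs : k -> R) (p : nat).
Hypothesis Habs : is_nonarch_pabs abs p.
Implicit Types (c e F : ps k) (rho M : R).

Lemma abs_ge0 x : 0 <= abs x. Proof. by case: Habs => _ [h _] _ _ _. Qed.
Lemma abs_eq0 x : (abs x == 0) = (x == 0).
Proof. by case: Habs => _ [_ h] _ _ _; apply/eqP/eqP => /h. Qed.
Lemma abs0 : abs 0 = 0. Proof. by apply/eqP; rewrite abs_eq0. Qed.
Lemma abs_gt0 x : (0 < abs x) = (x != 0).
Proof. by rewrite lt_def abs_ge0 andbT abs_eq0. Qed.
Lemma absM x y : abs (x * y) = abs x * abs y.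
Proof. by case: Habs => _ _ /(_ x y) []. Qed.
Lemma absD x y : abs (x + y) <= Num.max (abs x) (abs y).
Proof. by case: Habs => _ _ /(_ x y) []. Qed.
Lemma abs1 : abs 1 = 1.
Proof.
have n0 : abs 1 != 0 by rewrite abs_eq0 oner_eq0.
by apply: (mulfI n0); rewrite -absM !mulr1.
Qed.
Lemma absX x n : abs (x ^+ n) = abs x ^+ n.
Proof. by elim: n => [|n IH]; rewrite ?expr0 ?abs1 // !exprS absM IH. Qed.
Lemma absN x : abs (- x) = abs x.
Proof.
suff h : abs (- 1) = 1 by rewrite -mulN1r absM h mul1r.
apply/eqP; rewrite -(@eqrXn2 _ 2) ?abs_ge0 ?ler01 //.
by rewrite -absX sqrrN expr1n abs1 expr1n.
Qed.
Lemma absBC x y : abs (x - y) = abs (y - x). Proof. by rewrite -absN opprB. Qed.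
Lemma absV x : abs x^-1 = (abs x)^-1.
Proof.
have [->|x0] := eqVneq x 0; first by rewrite invr0 abs0 invr0.
have a0 : abs x != 0 by rewrite abs_eq0.
by apply: (mulfI a0); rewrite -absM !divff // abs1.
Qed.
Lemma absD_le x y M : abs x <= M -> abs y <= M -> abs (x + y) <= M.
Proof. by move=> hx hy; rewrite (le_trans (absD _ _)) // ge_max hx. Qed.
Lemma absB_le x y M : abs x <= M -> abs y <= M -> abs (x - y) <= M.
Proof. by move=> hx hy; rewrite absD_le ?absN. Qed.
Lemma absD_lt x y M : abs x < M -> abs y < M -> abs (x + y) < M.
Proof. by move=> hx hy; rewrite (le_lt_trans (absD _ _)) // gt_max hx. Qed.
Lemma absB_lt x y M : abs x < M -> abs y < M -> abs (x - y) < M.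
Proof. by move=> hx hy; rewrite absD_lt ?absN. Qed.
Lemma abs_sum_le (I : Type) (r : seq I) (Q : pred I) (h : I -> k) M : 0 <= M ->
  (forall i, Q i -> abs (h i) <= M) -> abs (\sum_(i <- r | Q i) h i) <= M.
Proof.
move=> M0 hM; apply: (big_ind (fun x => abs x <= M)) => //; first by rewrite abs0.
by move=> x y; apply: absD_le.
Qed.
Lemma abs_sum_lt (I : Type) (r : seq I) (Q : pred I) (h : I -> k) M : 0 < M ->
  (forall i, Q i -> abs (h i) < M) -> abs (\sum_(i <- r | Q i) h i) < M.
Proof.
move=> M0 hM; apply: (big_ind (fun x => abs x < M)) => //; first by rewrite abs0.
by move=> x y; apply: absD_lt.
Qed.
Lemma abs_prod (I : Type) (r : seq I) (Q : pred I) (h : I -> k) :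
  abs (\prod_(i <- r | Q i) h i) = \prod_(i <- r | Q i) abs (h i).
Proof. by apply: (big_morph abs absM abs1). Qed.
Lemma abs_nat n : abs n%:R <= 1.
Proof.
elim: n => [|n IH]; first by rewrite abs0 ler01.
by rewrite -natr1 absD_le // abs1.
Qed.
(** Isosceles principle: if [x + y] were smaller than [y], so would be [y = (x + y) - x]. *)
Lemma abs_dom x y : abs x < abs y -> abs (x + y) = abs y.
Proof.
move=> lt; apply/eqP; rewrite eq_le absD_le ?(ltW lt) //=.
rewrite leNgt; apply/negP => lt'.
have := absB_lt lt' lt; rewrite [x + y]addrC addrK ltxx; exact.
Qed.
Lemma p_prime : prime p. Proof. by case: Habs. Qed.
Lemma abs_p_lt1 : 0 < abs p%:R < 1.
Proof.
have p1 := prime_gt1 p_prime.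
case: Habs => _ _ _ -> _; rewrite invr_gt0 ltr0n (ltnW p1) /=.
by rewrite invf_lt1 ?ltr0n ?ltr1n // ltnW.
Qed.
(** Integers congruent to 1 modulo [p] can be divided by without changing absolute values; used for
    characteristic 0 and for the Fourier transform in [gauss_poly]. *)
Lemma abs_p1 n : abs (n * p).+1%:R = 1.
Proof.
rewrite -add1n natrD addrC abs_dom; first exact: abs1.
rewrite [X in _ < X]abs1 natrM absM; case/andP: abs_p_lt1 => p0 p1.
by rewrite (le_lt_trans _ p1) // ler_piMl ?abs_nat // ltW.
Qed.
(** Factors [p] are removed by induction; an integer prime to [p] has a multiple congruent to 1
    modulo [p], which has absolute value 1. *)
Lemma char0 n : n.+1%:R != 0 :> k.
Proof.
elim/ltn_ind: n => n IH.
have pn : (n.+1 %% p < p)%N by rewrite ltn_mod prime_gt0 ?p_prime.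
have p0 : (p%:R : k) != 0 by rewrite -abs_gt0; case/andP: abs_p_lt1.
have pabs := abs_p_lt1; case: (boolP (p %| n.+1)%N) => [/dvdnP[q dq]|ndvd].
  rewrite dq natrM mulf_neq0 //.
  case: q dq => [//|q dq]; apply: IH; move: dq (prime_gt1 p_prime); nia.
apply/eqP => n0.
have cop : coprime n.+1 p by rewrite coprime_sym prime_coprime ?p_prime.
have [u v /= uv _] := egcdnP p (ltn0Sn n).
move: uv; rewrite (eqP cop) => uv.
have : abs ((u * n.+1)%:R : k) = 1 by rewrite uv addn1 abs_p1.
by rewrite natrM n0 mulr0 abs0 => /esym/eqP; rewrite oner_eq0.
Qed.
Lemma eq_abs_small x y : (forall eps, 0 < eps -> abs (x - y) <= eps) -> x = y.
Proof.
move=> h; apply/eqP; rewrite -subr_eq0 -abs_eq0 eq_le abs_ge0 andbT.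
by apply/ler_addgt0Pr => eps e0; rewrite add0r h.
Qed.

(** * Null sequences, limits and sums of series in [k] *)

Definition nullR (u : nat -> R) :=
  forall eps, 0 < eps -> exists N, forall n, (N <= n)%N -> u n < eps.
Lemma nullP (u : nat -> R) : (forall n, 0 <= u n) -> (u @ \oo --> (0 : R)) <-> nullR u.
Proof.
move=> u0; split => [h eps e0|h].
  have /cvgrPdist_lt /(_ _ e0) [N _ hN] := h.
  by exists N => n /hN /=; rewrite sub0r normrN ger0_norm.
apply/cvgrPdist_lt => eps /h [N hN]; exists N => // n /hN /=.
by rewrite sub0r normrN ger0_norm.
Qed.
Lemma null_le (u v : nat -> R) : (forall n, u n <= v n) -> nullR v -> nullR u.
Proof.
move=> uv hv eps /hv [N hN]; exists N => n /hN; exact: le_lt_trans.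
Qed.
Lemma null_scale (u : nat -> R) C : 0 <= C -> nullR u -> nullR (fun n => C * u n).
Proof.
move=> C0 hu eps e0.
have [N hN] := hu (eps / (C + 1)) (divr_gt0 e0 (ltr_wpDl C0 ltr01)).
exists N => n /hN; rewrite ltr_pdivlMr ?ltr_wpDl // mulrC => h.
have [u0|/ltW u0] := leP 0 (u n); first by rewrite (le_lt_trans _ h) // ler_wpM2r // lerDl ler01.
by rewrite (le_lt_trans _ e0) // mulr_ge0_le0.
Qed.

Lemma kcvgP u L : kcvg abs u L <-> nullR (fun n => abs (u n - L)).
Proof. by apply: nullP => n; exact: abs_ge0. Qed.
Lemma kcvg_uniq u L L' : kcvg abs u L -> kcvg abs u L' -> L = L'.
Proof.
move=> /kcvgP h /kcvgP h'; apply: eq_abs_small => eps e0.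
have [N hN] := h _ e0; have [N' hN'] := h' _ e0.
have := absB_lt (hN' _ (leq_maxr N N')) (hN _ (leq_maxl N N')).
by rewrite addrC opprB addrA subrK => /ltW.
Qed.
Lemma klimE u L : kcvg abs u L -> klim abs u = L.
Proof.
move=> h; rewrite /klim; case: xgetP => [x _ /= hx|/(_ L)//].
exact: kcvg_uniq hx h.
Qed.
Lemma kcvg_bound u L M : kcvg abs u L -> (forall n, abs (u n) <= M) -> abs L <= M.
Proof.
move=> /kcvgP h hM; rewrite leNgt; apply/negP => lt.
have L0 : 0 < abs L by rewrite (le_lt_trans _ lt) // (le_trans (abs_ge0 (u 0%N))).
have [N /(_ N (leqnn _)) hN] := h _ L0.
have := absB_lt (le_lt_trans (hM N) lt) hN.
by rewrite opprB addrC subrK ltxx.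
Qed.
Lemma kcvgD u v L L' : kcvg abs u L -> kcvg abs v L' -> kcvg abs (fun n => u n + v n) (L + L').
Proof.
move=> /kcvgP h /kcvgP h'; apply/kcvgP => eps e0.
have [N hN] := h _ e0; have [N' hN'] := h' _ e0.
exists (maxn N N') => n; rewrite geq_max => /andP[/hN h1 /hN' h2].
by rewrite opprD addrACA absD_lt.
Qed.
Lemma kcvgZ u L a : kcvg abs u L -> kcvg abs (fun n => a * u n) (a * L).
Proof.
move=> /kcvgP /(null_scale (abs_ge0 a)) h; apply/kcvgP; apply: null_le h => n.
by rewrite -mulrBr absM.
Qed.
Lemma kcvg_shift u L : kcvg abs (fun n => u n.+1) L -> kcvg abs u L.
Proof.
move=> /kcvgP h; apply/kcvgP => eps /h [N hN]; exists N.+1 => -[//|n]; exact: hN.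
Qed.

Definition sumk (h : nat -> k) : k := klim abs (fun N => \sum_(n < N) h n).
(** By the ultrametric inequality, partial sums are Cauchy as soon as the terms tend to 0. *)
Lemma sumkP h : nullR (fun n => abs (h n)) -> kcvg abs (fun N => \sum_(n < N) h n) (sumk h).
Proof.
move=> h0; suff [L hL] : exists L, kcvg abs (fun N => \sum_(n < N) h n) L.
  by rewrite /sumk (klimE hL).
have Hc : forall u : nat -> k, (forall eps : R, 0 < eps -> exists N, forall m n,
  (N <= m)%N -> (N <= n)%N -> abs (u m - u n) < eps) -> exists L, kcvg abs u L by case: Habs.
apply: Hc => eps e0; have [N hN] := h0 _ e0; exists N => m n.
wlog le_mn : m n / (n <= m)%N.
  move=> W hm hn; case/orP: (leq_total n m) => nm; first exact: W.
  by rewrite absBC; apply: W.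
move=> _ Nn; rewrite -!(big_mkord xpredT h) (big_cat_nat (n := n)) //= addrAC subrr add0r.
rewrite big_nat_cond; apply: abs_sum_lt => // i /andP[/andP[ni _] _].
by apply: hN; rewrite (leq_trans Nn).
Qed.
Lemma sumk_bound h M : nullR (fun n => abs (h n)) -> (forall n, abs (h n) <= M) -> abs (sumk h) <= M.
Proof.
move=> h0 hM; apply: kcvg_bound (sumkP h0) _ => N; apply: abs_sum_le => //.
exact: le_trans (abs_ge0 (h 0%N)) _.
Qed.
Lemma sumkD h h' : nullR (fun n => abs (h n)) -> nullR (fun n => abs (h' n)) ->
  sumk (fun n => h n + h' n) = sumk h + sumk h'.
Proof.
move=> h0 h0'; apply: klimE; have := kcvgD (sumkP h0) (sumkP h0').
by congr (kcvg _ _ _); apply/funext => N; rewrite big_split.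
Qed.
Lemma sumkZ h a : nullR (fun n => abs (h n)) -> sumk (fun n => a * h n) = a * sumk h.
Proof.
move=> h0; apply: klimE; have := kcvgZ a (sumkP h0).
by congr (kcvg _ _ _); apply/funext => N; rewrite mulr_sumr.
Qed.
Lemma sumk_fin h N : (forall n, (N <= n)%N -> h n = 0) -> sumk h = \sum_(n < N) h n.
Proof.
move=> h0; apply: klimE; apply/kcvgP => eps e0; exists N => n Nn.
rewrite -!(big_mkord xpredT h) (big_cat_nat (n := N)) //= addrAC subrr add0r.
rewrite big_nat_cond big1 ?abs0 // => i /andP[/andP[ni _] _]; exact: h0.
Qed.
Lemma sumk_shift h : nullR (fun n => abs (h n)) -> h 0%N = 0 -> sumk h = sumk (fun n => h n.+1).
Proof.
move=> h0 hz; have h1 : nullR (fun n => abs (h n.+1)).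
  by move=> eps /h0 [N hN]; exists N => n Nn; apply: hN; rewrite (leq_trans Nn).
apply: klimE; apply: kcvg_shift; have := sumkP h1.
by congr (kcvg _ _ _); apply/funext => N; rewrite big_ord_recl hz add0r.
Qed.

(** * Convergence on closed discs and the Gauss norm *)

Definition cvs rho c := nullR (fun n => abs (c n) * rho ^+ n).
(** The Gauss norm at radius [rho] is at most [M]; kept as a relation, it needs no supremum. *)
Definition nrm rho c M := forall n, abs (c n) * rho ^+ n <= M.

Lemma nrm_ge0 rho c M : nrm rho c M -> 0 <= M.
Proof. by move=> /(_ 0%N); rewrite expr0 mulr1; apply: le_trans; exact: abs_ge0. Qed.
Lemma nrm_le rho c M M' : nrm rho c M -> M <= M' -> nrm rho c M'.
Proof. by move=> h MM n; exact: le_trans (h n) MM. Qed.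
Lemma cvs_rad rho rho' c : 0 <= rho' <= rho -> cvs rho c -> cvs rho' c.
Proof.
move=> /andP[r0 rr]; apply: null_le => n; rewrite ler_wpM2l ?abs_ge0 //.
by rewrite lerXn2r // nnegrE (le_trans r0).
Qed.
Section Radius.
Variable rho : R.
Hypothesis rho0 : 0 <= rho.

Lemma nrmD c e M : nrm rho c M -> nrm rho e M -> nrm rho (c + e) M.
Proof.
move=> hc he n; rewrite psD -(ger0_norm (exprn_ge0 n rho0)).
(* The radius may be 0, so its powers cannot be divided out directly. *)
have [/eqP r0|r0] := boolP (rho ^+ n == 0).
  by rewrite r0 normr0 mulr0 (nrm_ge0 hc).
have rp : 0 < rho ^+ n by rewrite lt_def r0 exprn_ge0.
rewrite gtr0_norm // -ler_pdivlMr // absD_le // ler_pdivlMr //.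
Qed.
Lemma nrmN c M : nrm rho c M -> nrm rho (- c) M.
Proof. by move=> h n; rewrite psN absN. Qed.
Lemma nrmB c e M : nrm rho c M -> nrm rho e M -> nrm rho (c - e) M.
Proof. by move=> hc he; apply: nrmD => //; apply: nrmN. Qed.
Lemma nrm0 M : 0 <= M -> nrm rho 0 M.
Proof. by move=> M0 n; rewrite ps0 abs0 mul0r. Qed.
Lemma nrmM c e M M' : nrm rho c M -> nrm rho e M' -> nrm rho (c * e) (M * M').
Proof.
move=> hc he n; have M0 := nrm_ge0 hc; have M0' := nrm_ge0 he.
have [/eqP r0|r0] := boolP (rho ^+ n == 0); first by rewrite r0 mulr0 mulr_ge0.
have rp : 0 < rho ^+ n by rewrite lt_def r0 exprn_ge0.
rewrite -ler_pdivlMr // psM abs_sum_le // ?divr_ge0 ?mulr_ge0 ?(ltW rp) // => i _.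
rewrite ler_pdivlMr // absM.
have -> : rho ^+ n = rho ^+ i * rho ^+ (n - i) by rewrite -exprD subnKC // -ltnS.
by rewrite mulrACA ler_pM ?mulr_ge0 ?abs_ge0 ?exprn_ge0.
Qed.
Lemma nrmC x : nrm rho (psconst x) (abs x).
Proof.
move=> n; rewrite /psconst; case: eqP => [->|_]; first by rewrite expr0 mulr1.
by rewrite abs0 mul0r abs_ge0.
Qed.
Lemma nrmX c M n : nrm rho c M -> nrm rho (c ^+ n) (M ^+ n).
Proof.
move=> h; elim: n => [|n IH]; last by rewrite !exprS; apply: nrmM.
by rewrite !expr0 -abs1; apply: nrmC.
Qed.

Lemma cvs_trunc c eps : cvs rho c -> 0 < eps ->
  exists N, nrm rho (c - poly2ps (pstrunc N c)) eps.
Proof.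
move=> h e0; have [N hN] := h _ e0; exists N => n; rewrite psB /poly2ps coef_poly.
case: ltnP => Nn; first by rewrite subrr abs0 mul0r ltW.
by rewrite subr0 ltW ?hN.
Qed.
(** With [cvs_trunc], this makes [cvs rho] the closure of the polynomials for the Gauss norm;
    products, evaluation and substitution are reduced to polynomials in this way. *)
Lemma cvs_approx c : (forall eps, 0 < eps -> exists q, nrm rho (c - poly2ps q) eps) -> cvs rho c.
Proof.
move=> h eps e0; have e2 : 0 < eps / 2 by lra.
have [q hq] := h _ e2; exists (size q) => n qn.
have := hq n; rewrite psB /poly2ps nth_default // subr0; lra.
Qed.
Lemma cvs_poly q : cvs rho (poly2ps q).
Proof. by apply: cvs_approx => eps e0; exists q; rewrite subrr; apply/nrm0/ltW. Qed.
Lemma cvsC x : cvs rho (psconst x).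
Proof. by rewrite -poly2psC; apply: cvs_poly. Qed.
Lemma cvs_bounded c : cvs rho c -> exists2 M, 0 < M & nrm rho c M.
Proof.
move=> h; have [N hN] := h 1 ltr01.
exists (1 + \sum_(i < N) abs (c i) * rho ^+ i).
  by rewrite ltr_wpDr // sumr_ge0 // => i _; rewrite mulr_ge0 ?abs_ge0 ?exprn_ge0.
have pos i : 0 <= abs (c i) * rho ^+ i by rewrite mulr_ge0 ?abs_ge0 ?exprn_ge0.
move=> n; case: (ltnP n N) => nN; last first.
  by rewrite (le_trans (ltW (hN _ nN))) // lerDl sumr_ge0.
rewrite (bigD1 (Ordinal nN)) //= addrCA lerDl addr_ge0 // sumr_ge0 //.
Qed.
Lemma cvsN c : cvs rho c -> cvs rho (- c).
Proof. by apply: null_le => n; rewrite psN absN. Qed.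
Lemma cvsD c e : cvs rho c -> cvs rho e -> cvs rho (c + e).
Proof.
move=> hc he; apply: cvs_approx => eps e0.
have [N hN] := cvs_trunc hc e0; have [N' hN'] := cvs_trunc he e0.
exists (pstrunc N c + pstrunc N' e); rewrite rmorphD opprD addrACA; exact: nrmD.
Qed.
Lemma cvsB c e : cvs rho c -> cvs rho e -> cvs rho (c - e).
Proof. by move=> hc /cvsN; apply: cvsD. Qed.
Lemma cvs_sum (I : Type) (r : seq I) (h : I -> ps k) :
  (forall i, cvs rho (h i)) -> cvs rho (\sum_(i <- r) h i).
Proof.
move=> hM; apply: (big_ind (cvs rho)) => //; first by rewrite -psC0; exact: cvsC.
exact: cvsD.
Qed.
Lemma cvsM_approx c e eps : cvs rho c -> cvs rho e -> 0 < eps -> exists q h,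
  [/\ nrm rho (c - poly2ps q) eps, nrm rho (e - poly2ps h) eps &
      nrm rho (c * e - poly2ps (q * h)) eps].
Proof.
move=> hc he e0.
have [A A0 hA] := cvs_bounded hc; have [B B0 hB] := cvs_bounded he.
(* Adapted to [c e - q h = c (e - h) + (c - q) h], where [c] is bounded by [A] and [h] by
   [B + eps]. *)
pose d := Num.min eps (Num.min (eps / A) (eps / (B + eps))).
have Be : 0 < B + eps by rewrite addr_gt0.
have d0 : 0 < d by rewrite !lt_min e0 !divr_gt0.
have [N hN] := cvs_trunc hc d0; have [N' hN'] := cvs_trunc he d0.
have dle : d <= eps by rewrite ge_min lexx.
exists (pstrunc N c), (pstrunc N' e); split; try exact: nrm_le dle.
set q := poly2ps _ in hN; set h := poly2ps _ in hN'.
have -> : c * e - poly2ps (pstrunc N c * pstrunc N' e) = c * (e - h) + (c - q) * h.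
  by rewrite rmorphM /= -/q -/h; ring.
apply: nrmD.
  apply: nrm_le (nrmM hA hN') _.
  by rewrite mulrC -ler_pdivlMr // !ge_min lexx !orbT.
have hh : nrm rho h (B + eps).
  have -> : h = e - (e - h) by rewrite opprB addrC subrK.
  apply: nrmB; [apply: nrm_le hB _ | apply: nrm_le hN' _]; rewrite ?lerDl ?(ltW e0) //.
  by rewrite (le_trans dle) // lerDr (ltW B0).
apply: nrm_le (nrmM hN hh) _.
by rewrite -ler_pdivlMr // !ge_min lexx !orbT.
Qed.
Lemma cvsM c e : cvs rho c -> cvs rho e -> cvs rho (c * e).
Proof.
move=> hc he; apply: cvs_approx => eps e0.
by have [q [h [_ _ H]]] := cvsM_approx hc he e0; exists (q * h).
Qed.
Lemma cvsX c n : cvs rho c -> cvs rho (c ^+ n).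
Proof. by move=> h; elim: n => [|n IH]; [exact: (cvsC 1)|rewrite exprS; exact: cvsM]. Qed.

Section Point.
Variable x : k.
Hypothesis x_le : abs x <= rho.
Lemma peval_term c : cvs rho c -> nullR (fun n => abs (c n * x ^+ n)).
Proof.
apply: null_le => n; rewrite absM absX ler_wpM2l ?abs_ge0 //.
by rewrite lerXn2r // nnegrE abs_ge0.
Qed.
Lemma peval_bound c M : cvs rho c -> nrm rho c M -> abs (peval abs c x) <= M.
Proof.
move=> hc hM; apply: sumk_bound (peval_term hc) _ => n.
rewrite absM absX (le_trans _ (hM n)) // ler_wpM2l ?abs_ge0 //.
by rewrite lerXn2r // nnegrE abs_ge0.
Qed.
Lemma pevalD c e : cvs rho c -> cvs rho e -> peval abs (c + e) x = peval abs c x + peval abs e x.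
Proof.
move=> hc he; rewrite -[RHS](sumkD (peval_term hc) (peval_term he)).
by congr klim; apply/funext => N; apply: eq_bigr => i _; rewrite psD mulrDl.
Qed.
Lemma pevalN c : cvs rho c -> peval abs (- c) x = - peval abs c x.
Proof.
move=> hc; rewrite -[RHS]mulN1r -[RHS](sumkZ (-1) (peval_term hc)).
by congr klim; apply/funext => N; apply: eq_bigr => i _; rewrite psN mulN1r mulNr.
Qed.
Lemma pevalB c e : cvs rho c -> cvs rho e -> peval abs (c - e) x = peval abs c x - peval abs e x.
Proof. by move=> hc he; rewrite pevalD ?pevalN //; apply: cvsN. Qed.
End Point.

Lemma peval_poly q x : peval abs (poly2ps q) x = q.[x].
Proof.
rewrite horner_coef; apply: (@sumk_fin (fun n => poly2ps q n * x ^+ n)) => n qn.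
by rewrite /poly2ps nth_default ?mul0r.
Qed.
Lemma pevalC y x : peval abs (psconst y) x = y.
Proof. by rewrite -poly2psC peval_poly hornerC. Qed.

(** Evaluation is continuous for the Gauss norm, and the claim for the approximating polynomials is
    [hornerM]. *)
Lemma pevalM x c e : abs x <= rho -> cvs rho c -> cvs rho e ->
  peval abs (c * e) x = peval abs c x * peval abs e x.
Proof.
move=> xr hc he; apply: eq_abs_small => eps e0.
have [A A0 hA] := cvs_bounded hc; have [B B0 hB] := cvs_bounded he.
pose d := Num.min eps (Num.min (eps / A) (eps / (B + eps))).
have Be : 0 < B + eps by rewrite addr_gt0.
have d0 : 0 < d by rewrite !lt_min e0 !divr_gt0.
have dle : d <= eps by rewrite ge_min lexx.
have [q [h [hq hh hqh]]] := cvsM_approx hc he d0.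
have pol u v : cvs rho u -> nrm rho (u - poly2ps v) d -> abs (peval abs u x - v.[x]) <= d.
  move=> hu huv; rewrite -peval_poly -(pevalB xr) //; last exact: cvs_poly.
  by apply: peval_bound => //; apply: cvsB => //; apply: cvs_poly.
have /pol h1 := cvsM hc he; have {h1} := h1 _ hqh; have /(pol _ _ hc) h2 := hq.
have /(pol _ _ he) h3 := hh.
rewrite hornerM => h1; set X := peval abs _ x in h1 *.
set C := peval abs c x in h2 *; set E := peval abs e x in h3 *.
have -> : X - C * E = (X - q.[x] * h.[x]) - (C * (E - h.[x]) + (C - q.[x]) * h.[x]) by ring.
have hC : abs C <= A by apply: peval_bound.
have hE : abs E <= B by apply: peval_bound.
apply: absB_le; first exact: le_trans h1 dle.
apply: absD_le; rewrite absM.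
  rewrite (le_trans (ler_pM (abs_ge0 _) (abs_ge0 _) hC h3)) // mulrC -ler_pdivlMr //.
  by rewrite !ge_min lexx !orbT.
have hH : abs h.[x] <= B + eps.
  have -> : h.[x] = E - (E - h.[x]) by ring.
  apply: absB_le; first by rewrite (le_trans hE) // lerDl ltW.
  by rewrite (le_trans h3) // (le_trans dle) // lerDr (ltW B0).
rewrite (le_trans (ler_pM (abs_ge0 _) (abs_ge0 _) h2 hH)) // -ler_pdivlMr //.
by rewrite !ge_min lexx !orbT.
Qed.
Lemma pevalX x c n : abs x <= rho -> cvs rho c -> peval abs (c ^+ n) x = peval abs c x ^+ n.
Proof.
move=> xr hc; elim: n => [|n IH]; first exact: (pevalC 1).
by rewrite !exprS pevalM ?IH //; apply: cvsX.
Qed.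
Lemma peval_sum x (I : Type) (r : seq I) (h : I -> ps k) : abs x <= rho ->
  (forall i, cvs rho (h i)) ->
  peval abs (\sum_(i <- r) h i) x = \sum_(i <- r) peval abs (h i) x.
Proof.
move=> xr hh; elim: r => [|i r IH]; first by rewrite !big_nil -psC0; exact: pevalC.
by rewrite !big_cons (pevalD xr) ?IH //; apply: cvs_sum.
Qed.
Lemma peval0 c : peval abs c 0 = c 0%N.
Proof.
rewrite /peval -/(sumk (fun n => c n * 0 ^+ n)) (@sumk_fin _ 1).
  by rewrite big_ord_recl big_ord0 expr0 mulr1 addr0.
by case=> // n _; rewrite expr0n mulr0.
Qed.
End Radius.

(** * Re-expansion of a convergent series at another point of its disc *)

Section Recenter.
Variables (rho : R) (b : k).
Hypotheses (rho0 : 0 < rho) (b_le : abs b <= rho).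
Let rho0' := ltW rho0.

(** Binomial coefficients are integers, hence of absolute value at most 1, and [abs b <= rho]:
    moving the centre inside the disc does not increase the Gauss norm. *)
Lemma recenter_term_le c m n :
  abs (c n * 'C(n, m)%:R * b ^+ (n - m)) <= (rho ^+ m)^-1 * (abs (c n) * rho ^+ n).
Proof.
rewrite [leRHS]mulrC ler_pdivlMr ?exprn_gt0 // !absM absX.
case: (leqP m n) => [mn|nm]; last first.
  by rewrite bin_small // abs0 mulr0 !mul0r mulr_ge0 ?abs_ge0 ?exprn_ge0.
have -> : rho ^+ n = rho ^+ (n - m) * rho ^+ m by rewrite -exprD subnK.
rewrite mulrA ler_wpM2r ?exprn_ge0 // ler_pM ?mulr_ge0 ?exprn_ge0 ?abs_ge0 //.
  by rewrite ler_piMr ?abs_ge0 ?abs_nat.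
by rewrite lerXn2r // nnegrE ?abs_ge0.
Qed.
Lemma recenter_null c m : cvs rho c ->
  nullR (fun n => abs (c n * 'C(n, m)%:R * b ^+ (n - m))).
Proof.
move=> hc; apply: null_le (recenter_term_le c m) _; apply: null_scale hc.
by rewrite invr_ge0 exprn_ge0.
Qed.
Lemma nrm_recenter c M : cvs rho c -> nrm rho c M -> nrm rho (recenter abs c b) M.
Proof.
move=> hc hM m; rewrite -ler_pdivlMr ?exprn_gt0 //.
apply: sumk_bound (recenter_null m hc) _ => n.
by rewrite (le_trans (recenter_term_le _ _ _)) // mulrC ler_pdivrMr ?exprn_gt0 //
  divfK ?expf_neq0 ?gt_eqF.
Qed.
Lemma recenterB c e : cvs rho c -> cvs rho e ->
  recenter abs (c - e) b = recenter abs c b - recenter abs e b.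
Proof.
move=> hc he; apply/funext => m.
have he' := cvsN he; transitivity (recenter abs c b m + recenter abs (- e) b m).
  rewrite -[RHS](sumkD (recenter_null m hc) (recenter_null m he')).
  by congr klim; apply/funext => N; apply: eq_bigr => i _; rewrite psD !mulrDl.
rewrite psB; congr (_ + _); rewrite -[RHS]mulN1r -[RHS](sumkZ (-1) (recenter_null m he)).
by congr klim; apply/funext => N; apply: eq_bigr => i _; rewrite psN mulN1r !mulNr.
Qed.
Lemma recenter_poly q : recenter abs (poly2ps q) b = poly2ps (q \Po ('X + b%:P)).
Proof.
apply/funext => m; rewrite /recenter.
rewrite -/(sumk (fun n => poly2ps q n * 'C(n, m)%:R * b ^+ (n - m))) (@sumk_fin _ (size q)) => [|n qn]; last by rewrite /poly2ps nth_default ?mul0r.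
rewrite /poly2ps comp_polyE coef_sum; apply: eq_bigr => i _.
rewrite coefZ -mulrA; congr (_ * _); rewrite addrC exprDn coef_sum.
case: (leqP m i) => mi.
  rewrite (bigD1 (Ordinal (n := i.+1) (m := m) mi)) //= big1 ?addr0.
    by rewrite coefMn -rmorphXn /= coefCM coefXn eqxx mulr1 mulr_natl.
  move=> j /negP jm; rewrite coefMn -rmorphXn /= coefCM coefXn.
  by case: eqP => [e|]; rewrite ?mulr0 ?mul0rn //; case: jm; apply/eqP/val_inj.
rewrite bin_small // mul0r big1 // => j _.
rewrite coefMn -rmorphXn /= coefCM coefXn gtn_eqF ?mulr0 ?mul0rn //.
by rewrite (leq_ltn_trans _ mi) // -ltnS.
Qed.
Lemma recenter_trunc c q eps : cvs rho c -> nrm rho (c - poly2ps q) eps ->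
  nrm rho (recenter abs c b - poly2ps (q \Po ('X + b%:P))) eps.
Proof.
move=> hc hN; rewrite -recenter_poly -recenterB //; last exact: cvs_poly.
by apply: nrm_recenter => //; apply: cvsB => //; apply: cvs_poly.
Qed.
Lemma cvs_recenter c : cvs rho c -> cvs rho (recenter abs c b).
Proof.
move=> hc; apply: cvs_approx => eps e0; have [N hN] := cvs_trunc hc e0.
by exists (pstrunc N c \Po ('X + b%:P)); apply: recenter_trunc.
Qed.
Lemma peval_recenter c y : cvs rho c -> abs y <= rho ->
  peval abs (recenter abs c b) y = peval abs c (b + y).
Proof.
move=> hc yr; apply: eq_abs_small => eps e0; have [N hN] := cvs_trunc hc e0.
have by_le : abs (b + y) <= rho by apply: absD_le.
have h1 : abs (peval abs c (b + y) - (pstrunc N c).[b + y]) <= eps.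
  rewrite -peval_poly -(pevalB rho0' by_le) //; last exact: cvs_poly.
  by apply: (peval_bound (rho := rho)) => //; apply: cvsB => //; apply: cvs_poly.
have h2 : abs (peval abs (recenter abs c b) y - (pstrunc N c).[b + y]) <= eps.
  have -> : (pstrunc N c).[b + y] = (pstrunc N c \Po ('X + b%:P)).[y].
    by rewrite horner_comp !hornerE addrC.
  rewrite -peval_poly -(pevalB rho0' yr); first 1 last.
  - exact: cvs_recenter.
  - exact: cvs_poly.
  apply: (peval_bound (rho := rho)) => //; last exact: recenter_trunc.
  by apply: cvsB => //; [exact: cvs_recenter|exact: cvs_poly].
by have := absB_le h2 h1; rewrite opprB addrA subrK.
Qed.
Lemma recenter0 c : recenter abs c b 0%N = peval abs c b.
Proof. by congr klim; apply/funext => N; apply: eq_bigr => i _; rewrite bin0 mulr1 subn0. Qed.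
Lemma cvs_deriv c : cvs rho c -> cvs rho (psderiv c).
Proof.
move=> hc; apply: (@null_le _ (fun n => rho^-1 * (abs (c n.+1) * rho ^+ n.+1))).
  move=> n; rewrite /psderiv absM exprS [abs (c _) * _]mulrCA mulKf ?gt_eqF //.
  by rewrite ler_wpM2r ?exprn_ge0 // ler_piMl ?abs_ge0 ?abs_nat.
apply: null_scale; first by rewrite invr_ge0.
by move=> eps /hc [N hN]; exists N => n Nn; apply: hN; rewrite (leq_trans Nn).
Qed.
Lemma recenter_deriv c : cvs rho c ->
  psderiv (recenter abs c b) = recenter abs (psderiv c) b.
Proof.
move=> hc; apply/funext => m; rewrite /psderiv.
(* The term of index 0 vanishes because ['C(0, m.+1) = 0]; the others match by [(m + 1) 'C(n + 1, m
   + 1) = (n + 1) 'C(n, m)]. *)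
rewrite -[LHS](sumkZ _ (recenter_null m.+1 hc)) [LHS]sumk_shift.
- congr klim; apply/funext => N; apply: eq_bigr => n _.
  rewrite subSS !mulrA; congr (_ * _).
  by rewrite mulrAC -natrM -mul_bin_diag natrM [RHS]mulrAC -mulrA mulrC.
- apply: null_le (null_scale (abs_ge0 m.+1%:R) (recenter_null m.+1 hc)) => n.
  by rewrite absM.
- by rewrite bin0n mulr0 mul0r mulr0.
Qed.
End Recenter.

(** * Density of the value group, the maximum principle and multiplicativity of the Gauss norm *)

Lemma abs_dense al be : 0 <= al -> al < be -> be <= 1 -> exists y, al < abs y < be.
Proof.
move=> al0 ab be1; have be0 : 0 < be by apply: le_lt_trans ab.
have /andP[p0 p1] := abs_p_lt1.
(* A root [x] of [p] of high order has [q < abs x < 1]; its powers then descend in steps too small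
   to jump over the interval from [al] to [be]. *)
pose q := al / be; have q0 : 0 <= q by rewrite divr_ge0 // ltW.
have q1 : q < 1 by rewrite ltr_pdivrMr // mul1r.
have [N qN] : exists N, q ^+ N.+1 < abs p%:R.
  have /cvgrPdist_lt /(_ _ p0) [N _ hN] : (fun n => q ^+ n) @ \oo --> (0 : R).
    by apply: cvg_expr; rewrite ger0_norm.
  exists N; have := hN N.+1 (leqnSn N).
  by rewrite /= sub0r normrN ger0_norm ?exprn_ge0.
have [x hx] : exists x : k, x ^+ N.+1 = p%:R.
  have : size ('X^(N.+1) - p%:R%:P : {poly k}) != 1%N by rewrite size_XnsubC.
  case/closed_rootP => x /rootP; rewrite !hornerE => /eqP.
  by rewrite subr_eq0 => /eqP; exists x.
have xN : abs x ^+ N.+1 = abs p%:R by rewrite -absX hx.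
have qx : q < abs x by rewrite -(@ltr_pXn2r _ N.+1) ?nnegrE ?abs_ge0 ?xN.
have x1 : abs x < 1 by rewrite -(@ltr_pXn2r _ N.+1) ?nnegrE ?abs_ge0 ?xN ?expr1n.
have [m hm] : exists m, abs x ^+ m < be.
  have /cvgrPdist_lt /(_ _ be0) [m _ hm] : (fun n => abs x ^+ n) @ \oo --> (0 : R).
    by apply: cvg_expr; rewrite ger0_norm ?abs_ge0.
  by exists m; have := hm m (leqnn m); rewrite /= sub0r normrN ger0_norm ?exprn_ge0 ?abs_ge0.
(* At the first power below [be], the preceding one is at least [be], so this one exceeds
   [q * be = al]. Exponent 0 is excluded by [be <= 1]. *)
elim: m hm => [|m IH] hm; first by move: hm; rewrite expr0 ltNge be1.
case: (ltP (abs x ^+ m) be) => [/IH//|le_m].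
exists (x ^+ m.+1); rewrite absX hm andbT exprS.
apply: lt_le_trans (_ : abs x * be <= _); last by rewrite ler_wpM2l ?abs_ge0.
by rewrite -ltr_pdivrMr.
Qed.

Lemma prim_root_exists n : exists z : k, n.+1.-primitive_root z.
Proof.
pose q : {poly k} := 'X^(n.+1) - 1.
have [r Dr] := closed_field_poly_normal q.
have q_mon : q \is monic by rewrite monicXnsubC.
rewrite (monicP q_mon) scale1r in Dr.
have sz : size r = n.+1.
  by apply: succn_inj; rewrite -(size_prod_XsubC r id) -Dr size_XnsubC.
have rn1 : all n.+1.-unity_root r.
  by apply/allP => z; rewrite -root_prod_XsubC unity_rootE -Dr /root !hornerE subr_eq0.
have ur : uniq r by rewrite -separable_prod_XsubC -Dr separable_Xn_sub_1 // char0.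
by have /hasP[z _ hz] := has_prim_root (ltn0Sn n) rn1 ur (eq_leq (esym sz)); exists z.
Qed.

(** Discrete Fourier transform over the [n]-th roots of unity with [n = 1 mod p],
    so that dividing by [n] is harmless. *)
Lemma gauss_poly (q : {poly k}) y M : (forall x, abs x <= abs y -> abs q.[x] <= M) ->
  nrm (abs y) (poly2ps q) M.
Proof.
move=> hM m; have M0 : 0 <= M by apply: le_trans (hM 0 _); rewrite ?abs0 ?abs_ge0.
(* The order [n.+1] of the root of unity exceeds [m] and is at least [size q], so the exponents
   involved stay distinct modulo it. *)
pose n := (maxn m (size q) * p)%N.
have p0 := prime_gt0 p_prime.
have nm : (m < n.+1)%N by rewrite ltnS; apply: leq_trans (leq_maxl _ (size q)) (leq_pmulr _ p0).
have nq : (size q <= n.+1)%N by apply/leqW; apply: leq_trans (leq_maxr m _) (leq_pmulr _ p0).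
have [z pz] := prim_root_exists n.
have z1 : abs z = 1.
  apply/eqP; rewrite -(@eqrXn2 _ n.+1) ?abs_ge0 ?ler01 //.
  by rewrite -absX (prim_expr_order pz) expr1n abs1.
have z0 : z != 0 by rewrite -abs_eq0 z1 oner_eq0.
have key : \sum_(i < n.+1) (z ^+ i) ^- m * q.[y * z ^+ i] = n.+1%:R * (q`_m * y ^+ m).
  transitivity (\sum_(i < n.+1) \sum_(j < n.+1) q`_j * y ^+ j * (z ^+ j / z ^+ m) ^+ i).
    apply: eq_bigr => i _; rewrite (horner_coef_wide _ nq) mulr_sumr; apply: eq_bigr => j _.
    rewrite exprMn exprMn exprVn -!exprM [(i * m)%N]mulnC [(i * j)%N]mulnC; ring.
  rewrite exchange_big /= (bigD1 (Ordinal nm)) //= [X in _ + X]big1 ?addr0.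
    rewrite divff ?expf_neq0 // (eq_bigr (fun=> q`_m * y ^+ m)) => [|i _].
      by rewrite sumr_const card_ord mulr_natl.
    by rewrite expr1n mulr1.
  move=> j jm; rewrite -mulr_sumr.
  set w := z ^+ j / z ^+ m.
  have w1 : w - 1 != 0.
    rewrite subr_eq0 -(inj_eq (mulIf (expf_neq0 m z0))) mul1r divfK ?expf_neq0 //.
    rewrite (eq_prim_root_expr pz) !modn_small ?ltn_ord //.
  have : (w - 1) * \sum_(i < n.+1) w ^+ i = 0.
    rewrite -subrX1 expr_div_n -!exprM ![(_ * n.+1)%N]mulnC !exprM (prim_expr_order pz).
    by rewrite !expr1n divr1 subrr.
  by move/eqP; rewrite mulf_eq0 (negPf w1) => /eqP ->; rewrite mulr0.
have : abs (n.+1%:R * (q`_m * y ^+ m)) <= M.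
  rewrite -key; apply: abs_sum_le => // i _.
  rewrite absM absV !absX z1 !expr1n invr1 mul1r hM //.
  by rewrite absM absX z1 expr1n mulr1.
by rewrite absM abs_p1 mul1r absM absX.
Qed.
(** Maximum principle, carried over from polynomials by truncation. The radius is an absolute value
    [abs y] because [gauss_poly] samples at the points [y] times roots of unity. *)
Lemma gauss c y M : cvs (abs y) c ->
  (forall x, abs x <= abs y -> abs (peval abs c x) <= M) -> nrm (abs y) c M.
Proof.
move=> hc hM m; apply/ler_addgt0Pr => eps e0.
have M0 : 0 <= M by apply: le_trans (hM 0 _); rewrite ?abs0 ?abs_ge0.
have [N hN] := cvs_trunc hc e0.
suff h : nrm (abs y) (poly2ps (pstrunc N c)) (M + eps).
  have -> : c = (c - poly2ps (pstrunc N c)) + poly2ps (pstrunc N c) by rewrite subrK.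
  apply: (nrmD (abs_ge0 y)) => //; apply: nrm_le hN _; by rewrite lerDr.
apply: gauss_poly => x xy; have hp := cvs_poly (abs y) (pstrunc N c).
rewrite -peval_poly.
have -> : peval abs (poly2ps (pstrunc N c)) x =
    peval abs c x - peval abs (c - poly2ps (pstrunc N c)) x.
  by rewrite (pevalB (abs_ge0 y) xy) // opprB addrC subrK.
apply: absB_le; first by rewrite (le_trans (hM _ xy)) // lerDl ltW.
have := peval_bound (abs_ge0 y) xy (cvsB (abs_ge0 y) hc hp) hN.
by move=> h; rewrite (le_trans h) // lerDr.
Qed.
(** By [gauss], the difference has Gauss norm 0. *)
Lemma cvs_inj c e y : y != 0 -> cvs (abs y) c -> cvs (abs y) e ->
  (forall x, abs x <= abs y -> peval abs c x = peval abs e x) -> c = e.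
Proof.
move=> y0 hc he ce; apply/funext => n.
have h : nrm (abs y) (c - e) 0.
  apply: gauss => [|x xy]; first exact: (cvsB (abs_ge0 y) hc he).
  by rewrite (pevalB (abs_ge0 y) xy) // ce // subrr abs0.
apply/eqP; rewrite -subr_eq0 -abs_eq0 eq_le abs_ge0 andbT.
by have := h n; rewrite pmulr_lle0 ?exprn_gt0 ?abs_gt0.
Qed.

(** Multiplicativity of the Gauss norm, in the form of a cancellation bound. *)
Lemma nrm_cancel rho c e M i : 0 < rho -> cvs rho c -> cvs rho e -> nrm rho (c * e) M ->
  abs (c i) * rho ^+ i != 0 -> nrm rho e (M / (abs (c i) * rho ^+ i)).
Proof.
move=> r0 hc he hM ci0.
(* [dom] provides the last index at which the Gauss norm is attained. With such indices [j] for [c]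
   and [m] for [e], the term [c j * e m] strictly dominates the rest of coefficient [j + m] of the
   product. *)
have dom h j0 : cvs rho h -> abs (h j0) * rho ^+ j0 != 0 -> exists j,
    [/\ abs (h j0) * rho ^+ j0 <= abs (h j) * rho ^+ j,
        (forall l, abs (h l) * rho ^+ l <= abs (h j) * rho ^+ j) &
        (forall l, (j < l)%N -> abs (h l) * rho ^+ l < abs (h j) * rho ^+ j)].
  move=> hh h0; set v := fun l => abs (h l) * rho ^+ l.
  have v0 l : 0 <= v l by rewrite mulr_ge0 ?abs_ge0 ?exprn_ge0 // ltW.
  have vj0 : 0 < v j0 by rewrite lt_def h0 v0.
  have [N hN] := hh _ vj0.
  have jN : (j0 < N)%N by rewrite ltnNge; apply/negP => /hN; rewrite ltxx.
  have [j _ jmax0] := arg_maxP (fun l : 'I_N => v l) (isT : xpredT (Ordinal jN)).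
  have jmax1 l : (l < N)%N -> v l <= v j by move=> lN; have := jmax0 (Ordinal lN) isT.
  have jmax l : v l <= v j.
    case: (ltnP l N) => lN; first exact: jmax1.
    by rewrite (le_trans (ltW (hN _ lN))) // jmax1.
  have ex : exists l, (v j <= v l) && (l < N)%N by exists j; rewrite lexx ltn_ord.
  have bd l : (v j <= v l) && (l < N)%N -> (l <= N)%N by case/andP => _ /ltnW.
  have [m /andP[vm mN] mmax] := ex_maxnP ex bd.
  exists m; split.
  - exact: le_trans (jmax j0) vm.
  - by move=> l; apply: le_trans (jmax l) vm.
  - move=> l ml; case: (ltnP l N) => lN; last first.
      by apply: lt_le_trans (hN _ lN) _; apply: le_trans (jmax j0) vm.
    rewrite ltNge; apply/negP => h1.
    by have := mmax l; rewrite lN andbT (le_trans vm h1) => /(_ isT); rewrite leqNgt ml.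
have [j [ij jmax jlast]] := dom c i hc ci0.
have cij0 : 0 < abs (c i) * rho ^+ i.
  by rewrite lt_def ci0 mulr_ge0 ?abs_ge0 ?exprn_ge0 // ltW.
have M0 := nrm_ge0 hM.
move=> l; have [/eqP el0|el0] := boolP (abs (e l) * rho ^+ l == 0).
  by rewrite el0 divr_ge0 // ltW.
have [m [lm mmax mlast]] := dom e l he el0.
apply: le_trans lm _; rewrite ler_pdivlMr // mulrC.
apply: le_trans (ler_wpM2r _ ij) _; first by rewrite mulr_ge0 ?abs_ge0 ?exprn_ge0 // ltW.
have el_pos : 0 < abs (e m) * rho ^+ m.
  apply: lt_le_trans (mmax l); rewrite lt_def el0 mulr_ge0 ?abs_ge0 ?exprn_ge0 // ltW //.
have cj_pos : 0 < abs (c j) * rho ^+ j by apply: lt_le_trans ij.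
rewrite mulrACA -exprD -absM; apply: le_trans (hM (j + m)%N).
rewrite ler_wpM2r ?exprn_ge0 ?(ltW r0) // psM.
have jlt : (j < (j + m).+1)%N by rewrite ltnS leq_addr.
rewrite (bigD1 (Ordinal jlt)) //= addKn addrC abs_dom //.
have rp : 0 < rho ^+ (j + m) by rewrite exprn_gt0.
apply: abs_sum_lt.
  by rewrite absM -(pmulr_lgt0 _ rp) exprD mulrACA mulr_gt0.
move=> t tj; rewrite -(ltr_pM2r rp) !absM.
have -> : abs (c t) * abs (e (j + m - t)%N) * rho ^+ (j + m) =
    (abs (c t) * rho ^+ t) * (abs (e (j + m - t)%N) * rho ^+ (j + m - t)).
  by rewrite mulrACA -exprD subnKC // -ltnS.
rewrite exprD [ltRHS]mulrACA.
have pos h n : 0 <= abs (h n : k) * rho ^+ n by rewrite mulr_ge0 ?abs_ge0 ?exprn_ge0 // ltW.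
have [tlj|jlt'|tej] := ltngtP t j; last by case/negP: tj; apply/eqP/val_inj.
- apply: le_lt_trans (ler_wpM2r (pos e _) (jmax t)) _.
  by rewrite ltr_pM2l // mlast // ltn_subRL ltn_add2r.
- apply: le_lt_trans (ler_wpM2l (pos c _) (mmax _)) _.
  by rewrite ltr_pM2r // jlast.
Qed.

(** The case of a polynomial [z] is clear, and the general one follows by approximation
    of [z] in the Gauss norm. *)
Section Substitution.
Variables (rho sg : R) (F z : ps k).
Hypotheses (rho0 : 0 <= rho) (F0 : F 0%N = 0) (hF : cvs rho F) (nF : nrm rho F sg).
Hypothesis hz : cvs sg z.
Lemma nrm_pscomp z' M : nrm sg z' M -> nrm rho (pscomp F z') M.
Proof.
move=> hz' m; have M0 := nrm_ge0 hz'.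
have [/eqP r0|r0] := boolP (rho ^+ m == 0); first by rewrite r0 mulr0.
have rp : 0 < rho ^+ m by rewrite lt_def r0 exprn_ge0.
rewrite -ler_pdivlMr // /pscomp abs_sum_le // ?divr_ge0 ?(ltW rp) // => i _.
rewrite ler_pdivlMr // absM -mulrA; apply: le_trans (hz' i).
by rewrite ler_wpM2l ?abs_ge0 // nrmX.
Qed.
Lemma cvs_map_horner (q : {poly k}) : cvs rho (map_poly (@psconst k) q).[F].
Proof.
rewrite horner_coef; apply: cvs_sum => // i; apply: cvsM => //; last exact: cvsX.
by rewrite coef_map; apply: cvsC.
Qed.
Lemma pscomp_approx eps : 0 < eps -> exists q, nrm sg (z - poly2ps q) eps /\
  nrm rho (pscomp F z - (map_poly (@psconst k) q).[F]) eps.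
Proof.
move=> e0; have [N hN] := cvs_trunc hz e0; exists (pstrunc N z); split=> //.
rewrite -pscomp_poly //; have := nrm_pscomp hN.
by rewrite (pscomp_zmod F z).
Qed.
Lemma cvs_pscomp : cvs rho (pscomp F z).
Proof.
apply: cvs_approx => eps e0; have [q [_ hq]] := pscomp_approx e0.
have [N hN] := cvs_trunc (cvs_map_horner q) e0; exists (pstrunc N (map_poly (@psconst k) q).[F]).
by have := nrmD rho0 hq hN; rewrite addrA subrK.
Qed.
Lemma peval_pscomp x : abs x <= rho -> peval abs (pscomp F z) x = peval abs z (peval abs F x).
Proof.
move=> xr; have yr : abs (peval abs F x) <= sg by apply: peval_bound nF.
have sg0 := nrm_ge0 nF.
apply: eq_abs_small => eps e0; have [q [h1 h2]] := pscomp_approx e0.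
have e1 : peval abs (map_poly (@psconst k) q).[F] x = q.[peval abs F x].
  rewrite horner_coef (peval_sum rho0) // => [|i]; last first.
    by apply: cvsM; rewrite // ?coef_map; [exact: cvsC|exact: cvsX].
  rewrite horner_coef size_map_inj_poly; first 1 last.
  - exact: fmorph_inj.
  - exact: rmorph0.
  apply: eq_bigr => i _; rewrite coef_map (pevalM rho0 xr); last exact: cvsX.
    by rewrite (pevalX rho0 _ xr) // pevalC.
  exact: cvsC.
have b2 : abs (peval abs (pscomp F z) x - q.[peval abs F x]) <= eps.
  rewrite -e1 -(pevalB rho0 xr); [|exact: cvs_pscomp|exact: cvs_map_horner].
  by apply: peval_bound h2 => //; apply: cvsB; [|exact: cvs_pscomp|exact: cvs_map_horner].
have b1 : abs (peval abs z (peval abs F x) - q.[peval abs F x]) <= eps.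
  rewrite -peval_poly -(pevalB sg0 yr) //; last exact: cvs_poly.
  by apply: peval_bound h1 => //; apply: cvsB => //; exact: cvs_poly.
by have := absB_le b2 b1; rewrite opprB addrA subrK.
Qed.
End Substitution.

(** * Germs of analytic functions *)

Lemma small_abs al : 0 < al -> exists2 y, y != 0 & abs y <= al.
Proof.
move=> al0; have [||y /andP[y0 ya]] := @abs_dense 0 (Num.min al 1) (lexx _).
- by rewrite lt_min al0 ltr01.
- by rewrite ge_min lexx orbT.
exists y; first by rewrite -abs_gt0.
by move: ya; rewrite lt_min => /andP[/ltW].
Qed.
(** Since [F] has no constant term, every term gains at least one factor [abs y / rho] when the
    radius shrinks from [rho] to [abs y]. *)
Lemma small_nrm rho F sg : 0 < rho -> cvs rho F -> F 0%N = 0 -> 0 < sg ->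
  exists y, [/\ y != 0, abs y <= rho & nrm (abs y) F sg].
Proof.
move=> r0 hF F0 s0; have [M M0 hM] := cvs_bounded (ltW r0) hF.
have [|y y0 ym] := @small_abs (Num.min rho (rho * sg / M)).
  by rewrite lt_min r0 divr_gt0 // mulr_gt0.
move: ym; rewrite le_min => /andP[yr ys]; exists y; split=> //.
case=> [|n]; first by rewrite F0 abs0 mul0r ltW.
have -> : abs (F n.+1) * abs y ^+ n.+1 = (abs (F n.+1) * rho ^+ n.+1) * (abs y / rho) ^+ n.+1.
  by rewrite -mulrA -exprMn [rho * _]mulrC divfK ?gt_eqF.
have q0 : 0 <= abs y / rho by rewrite divr_ge0 ?abs_ge0 // ltW.
have q1 : abs y / rho <= 1 by rewrite ler_pdivrMr // mul1r.
have -> : sg = M * (sg / M) by rewrite mulrC divfK ?gt_eqF.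
rewrite ler_pM ?mulr_ge0 ?exprn_ge0 ?abs_ge0 ?(ltW r0) //.
rewrite exprS; apply: (@le_trans _ _ (abs y / rho)).
  by rewrite ler_piMr // exprn_ile1.
by rewrite ler_pdivrMr // mulrC mulrA.
Qed.

(** Relates a function on [k] to its expansion [c] at [a], on some unspecified disc. Identities
    between functions become identities between formal series through [germ_uniq]. *)
Definition germ a c (h : k -> k) := exists2 y, y != 0 &
  cvs (abs y) c /\ forall x, abs x <= abs y -> h (a + x) = peval abs c x.

Lemma germ_le a c h y : y != 0 -> germ a c h -> exists2 y', y' != 0 &
  [/\ abs y' <= abs y, cvs (abs y') c & forall x, abs x <= abs y' -> h (a + x) = peval abs c x].
Proof.
move=> y0 [z z0 [hc hh]]; case: (leP (abs z) (abs y)) => zy; first by exists z.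
exists y => //; split=> //; first by apply: cvs_rad hc; rewrite abs_ge0 ltW.
by move=> x xy; apply: hh; rewrite (le_trans xy) // ltW.
Qed.
Lemma germ2 a c e h h' : germ a c h -> germ a e h' -> exists2 y, y != 0 &
  [/\ cvs (abs y) c, cvs (abs y) e, forall x, abs x <= abs y -> h (a + x) = peval abs c x &
      forall x, abs x <= abs y -> h' (a + x) = peval abs e x].
Proof.
move=> hc [y y0 [he hh']]; have [z z0 [zy hcz hh]] := germ_le y0 hc; exists z => //.
split=> //; first by apply: cvs_rad he; rewrite abs_ge0.
by move=> x xz; apply: hh'; apply: le_trans xz zy.
Qed.
Lemma germ_uniq a c e h : germ a c h -> germ a e h -> c = e.
Proof.
move=> /germ2 gc /gc [y y0 [hc he hh hh']]; apply: (cvs_inj y0) => // x xy.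
by rewrite -hh // -hh'.
Qed.
Lemma germM a c e h h' : germ a c h -> germ a e h' -> germ a (c * e) (fun x => h x * h' x).
Proof.
move=> /germ2 gc /gc [y y0 [hc he hh hh']]; exists y => //.
split; first exact: (cvsM (abs_ge0 y)).
by move=> x xy; rewrite (pevalM (abs_ge0 y) xy) // -hh // -hh'.
Qed.
Lemma germD a c e h h' : germ a c h -> germ a e h' -> germ a (c + e) (fun x => h x + h' x).
Proof.
move=> /germ2 gc /gc [y y0 [hc he hh hh']]; exists y => //.
split; first exact: (cvsD (abs_ge0 y)).
by move=> x xy; rewrite (pevalD (abs_ge0 y) xy) // -hh // -hh'.
Qed.
Lemma germC a w : germ a (psconst w) (fun=> w).
Proof.
by exists 1; rewrite ?oner_eq0 //; split=> [|x _]; [exact: cvsC|rewrite pevalC].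
Qed.
Lemma germ_poly a q : germ a (poly2ps (q \Po ('X + a%:P))) (fun x => q.[x]).
Proof.
exists 1; rewrite ?oner_eq0 //; split=> [|x _]; first exact: cvs_poly.
by rewrite peval_poly horner_comp !hornerE addrC.
Qed.
Lemma germX a c h n : germ a c h -> germ a (c ^+ n) (fun x => h x ^+ n).
Proof.
move=> g; elim: n => [|n IH].
  rewrite expr0 -psC1; have := germC a 1; congr germ; by apply/funext => x; rewrite expr0.
by rewrite exprS; have := germM g IH; congr germ; apply/funext => x; rewrite exprS.
Qed.
Lemma germ_sum (I : Type) (r : seq I) a (c : I -> ps k) (h : I -> k -> k) :
  (forall i, germ a (c i) (h i)) ->
  germ a (\sum_(i <- r) c i) (fun x => \sum_(i <- r) h i x).
Proof.
move=> g; elim: r => [|i r IH].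
  rewrite big_nil -psC0; have := germC a 0; congr germ.
  by apply/funext => x; rewrite big_nil.
rewrite big_cons; have := germD (g i) IH; congr germ; apply/funext => x.
by rewrite big_cons.
Qed.
Lemma germ_at a c h : germ a c h -> c 0%N = h a.
Proof. by case=> y _ [_ /(_ 0)]; rewrite abs0 abs_ge0 addr0 peval0 => /(_ isT). Qed.
Lemma germ_local a c h h' y : y != 0 -> germ a c h ->
  (forall x, abs x <= abs y -> h (a + x) = h' (a + x)) -> germ a c h'.
Proof.
move=> y0 g hh; have [z z0 [zy hc hz]] := germ_le y0 g; exists z => //; split=> // x xz.
by rewrite -hh ?hz // (le_trans xz).
Qed.
(** [small_nrm] supplies a disc that [h] maps into the disc where [z] represents [g]. *)
Lemma germ_comp a c h z g : germ a c h -> germ (h a) z g ->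
  germ a (pscomp (c - psconst (h a)) z) (fun x => g (h x)).
Proof.
move=> gc [y y0 [hz hg]]; have c0 := germ_at gc; have [w w0 [hc hh]] := gc.
have F0 : (c - psconst (h a)) 0%N = 0 by rewrite psB c0 /psconst /= subrr.
set F := c - _ in F0 *.
have hF : cvs (abs w) F by apply: cvsB => //; [exact: abs_ge0|exact: cvsC].
have [||v [v0 vw nv]] := @small_nrm (abs w) F (abs y) _ hF F0; rewrite ?abs_gt0 //.
have hFv : cvs (abs v) F by apply: cvs_rad hF; rewrite abs_ge0.
exists v => //; split; first exact: cvs_pscomp (abs_ge0 _) F0 hFv nv hz.
move=> x xv; rewrite (peval_pscomp (abs_ge0 v) F0 hFv nv hz xv).
have bF : abs (peval abs F x) <= abs y by apply: peval_bound nv; rewrite ?abs_ge0.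
have xw := le_trans xv vw.
rewrite -hg // (pevalB (abs_ge0 w) xw) //; last exact: cvsC.
by rewrite pevalC -hh // [h a + _]addrC subrK.
Qed.

(** * Analytic functions on the open or closed unit disc *)

Section Disc.
Variable cl : bool.
Notation inD := (indisc abs cl).
Notation inR := (in_tree_range cl).

(** Phrasing membership through admissible radii lets the open and the closed case share most
    proofs. *)
Lemma inD_range x : inD x <-> inR (abs x).
Proof. by rewrite /indisc /in_tree_range; case: cl; split=> [h|[]//]; split; rewrite ?abs_ge0. Qed.
Lemma range_le rho rho' : 0 <= rho' <= rho -> inR rho -> inR rho'.
Proof.
move=> /andP[r0 rr] [_]; rewrite /in_tree_range; case: cl => h; split=> //.
  exact: le_trans rr h.
exact: le_lt_trans rr h.
Qed.
Lemma range_le1 rho : inR rho -> rho <= 1.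
Proof. by case=> _; case: cl => // /ltW. Qed.
Lemma range_max rho rho' : inR rho -> inR rho' -> inR (Num.max rho rho').
Proof. by case: leP. Qed.
Lemma range_exists rho : inR rho -> exists z, [/\ z != 0, rho <= abs z & inR (abs z)].
Proof.
rewrite /in_tree_range; case: cl => -[r0 r1].
  by exists 1; rewrite oner_eq0 abs1 lexx ler01.
have [z /andP[z1 z2]] := abs_dense r0 r1 (lexx 1).
by exists z; rewrite -abs_gt0 z2 abs_ge0 (ltW z1) (le_lt_trans r0).
Qed.
Lemma range0 : inR (0 : R). Proof. by split=> //; case: cl; rewrite ?ler01 ?ltr01. Qed.
Lemma inD_shift x y rho : inD x -> inR rho -> abs (y - x) <= rho -> inD y.
Proof.
move=> /inD_range xr rr yx; apply/inD_range; apply: range_le (range_max xr rr).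
rewrite abs_ge0 -[y](subrK x) addrC (le_trans (absD _ _)) // ge_max !le_max lexx yx orbT.
by [].
Qed.
Lemma inO_cvs c rho : inO abs cl c -> inR rho -> cvs rho c.
Proof.
rewrite /inO /in_tree_range; case: cl => h [r0 r1].
  have h1 : cvs 1 c.
    by have h' := (nullP (fun n => abs_ge0 (c n))).1 h; move=> eps /h'[N hN]; exists N => n /hN; rewrite expr1n mulr1.
  by apply: cvs_rad h1; rewrite r0.
have pos n : 0 <= abs (c n) * rho ^+ n by rewrite mulr_ge0 ?abs_ge0 ?exprn_ge0.
by apply/(nullP pos)/h; rewrite r0.
Qed.
(** Together with [inO_cvs]: the ring of the disc is the intersection of the rings of the closed
    discs of admissible radius, from which it inherits its closure properties. *)
Lemma cvs_inO c : (forall rho, 0 < rho -> inR rho -> cvs rho c) -> inO abs cl c.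
Proof.
rewrite /inO /in_tree_range => h; case: cl h => h.
  apply/nullP => [n|]; first exact: abs_ge0.
  have h1 : cvs 1 c by apply: h; rewrite ?ltr01 ?ler01 ?lexx.
  by move=> eps /h1 [N hN]; exists N => n /hN; rewrite expr1n mulr1.
move=> rho /andP[r0 r1]; apply/nullP => [n|]; first by rewrite mulr_ge0 ?abs_ge0 ?exprn_ge0.
have [z /andP[z1 z2]] := abs_dense r0 r1 (lexx 1).
apply: (@cvs_rad (abs z)); first by rewrite r0 ltW.
by apply: h; rewrite ?abs_ge0 ?z2 //; apply: le_lt_trans z1.
Qed.
Lemma inO_poly q : inO abs cl (poly2ps q).
Proof. by apply: cvs_inO => rho _ _; apply: cvs_poly. Qed.
Lemma inOC x : inO abs cl (psconst x).
Proof. by rewrite -poly2psC; apply: inO_poly. Qed.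
Lemma inOM c e : inO abs cl c -> inO abs cl e -> inO abs cl (c * e).
Proof.
by move=> hc he; apply: cvs_inO => rho r0 rr; apply: cvsM; rewrite ?ltW //; apply: inO_cvs.
Qed.
Lemma inOD c e : inO abs cl c -> inO abs cl e -> inO abs cl (c + e).
Proof.
by move=> hc he; apply: cvs_inO => rho r0 rr; apply: cvsD; rewrite ?ltW //; apply: inO_cvs.
Qed.
Lemma inOB c e : inO abs cl c -> inO abs cl e -> inO abs cl (c - e).
Proof.
by move=> hc he; apply: cvs_inO => rho r0 rr; apply: cvsB; rewrite ?ltW //; apply: inO_cvs.
Qed.
Lemma inO_deriv c : inO abs cl c -> inO abs cl (psderiv c).
Proof. by move=> hc; apply: cvs_inO => rho r0 rr; apply: cvs_deriv => //; apply: inO_cvs. Qed.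

Section Point.
Variable x : k.
Hypothesis xD : inD x.
Let cx c : inO abs cl c -> cvs (abs x) c.
Proof. by move=> hc; apply: inO_cvs => //; apply/inD_range. Qed.
Lemma inO_pevalM c e : inO abs cl c -> inO abs cl e ->
  peval abs (c * e) x = peval abs c x * peval abs e x.
Proof. by move=> hc he; apply: (pevalM (abs_ge0 x)) => //; apply: cx. Qed.
Lemma inO_pevalD c e : inO abs cl c -> inO abs cl e ->
  peval abs (c + e) x = peval abs c x + peval abs e x.
Proof. by move=> hc he; apply: (pevalD (abs_ge0 x)) => //; apply: cx. Qed.
Lemma inO_pevalB c e : inO abs cl c -> inO abs cl e ->
  peval abs (c - e) x = peval abs c x - peval abs e x.
Proof. by move=> hc he; apply: (pevalB (abs_ge0 x)) => //; apply: cx. Qed.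
Lemma inO_germ c : inO abs cl c -> germ x (recenter abs c x) (peval abs c).
Proof.
move=> hc; have [z [z0 xz zR]] := range_exists ((inD_range x).1 xD).
have hz : cvs (abs z) c by apply: inO_cvs.
have zp : 0 < abs z by rewrite abs_gt0.
exists z => //; split=> [|y yz]; first exact: cvs_recenter.
by rewrite (peval_recenter zp xz).
Qed.
End Point.

Lemma inO_eq c e : inO abs cl c -> inO abs cl e ->
  (forall x, inD x -> peval abs c x = peval abs e x) -> c = e.
Proof.
move=> hc he ce; have [z [z0 _ zR]] := range_exists range0.
apply: (cvs_inj z0) => [||x xz]; try exact: inO_cvs.
by apply: ce; apply/inD_range; apply: range_le zR; rewrite abs_ge0.
Qed.
(** Expand at [x], drop the constant term, shift the coefficients by one, and move the centre back
    to 0. *)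
Lemma inO_divide h x : inO abs cl h -> inD x -> exists2 h1, inO abs cl h1 &
  forall y, inD y -> peval abs h y - peval abs h x = (y - x) * peval abs h1 y.
Proof.
move=> hh xD; pose c := recenter abs h x; pose c1 : ps k := fun n => c n.+1.
have eqc : c = psconst (c 0%N) + poly2ps 'X * c1.
  apply/funext => -[|n]; rewrite psD psM /poly2ps /psconst /=.
    by rewrite big_ord_recl big_ord0 coefX mul0r !addr0.
  rewrite big_ord_recl coefX mul0r !add0r big_ord_recl coefX mul1r big1 ?addr0.
    by rewrite subSS subn0.
  by move=> i _; rewrite coefX mul0r.
have pick rho : inR rho -> exists z, [/\ 0 < abs z, rho <= abs z, abs x <= abs z &
    [/\ cvs (abs z) h, cvs (abs z) c & cvs (abs z) c1]].
  move=> rr; have [z [z0 mz zR]] := range_exists (range_max rr ((inD_range x).1 xD)).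
  move: mz; rewrite ge_max => /andP[rz xz]; have zp : 0 < abs z by rewrite abs_gt0.
  have hz := inO_cvs hh zR; have cz : cvs (abs z) c by apply: cvs_recenter.
  exists z; split=> //; split=> // eps e0; have [N hN] := cz _ (mulr_gt0 e0 zp).
  exists N => n Nn; have := hN n.+1 (leqW Nn).
  by rewrite exprSr mulrA ltr_pM2r.
exists (recenter abs c1 (- x)).
  apply: cvs_inO => rho r0 /pick [z [zp rz xz [_ _ c1z]]].
  apply: (@cvs_rad (abs z)); first by rewrite ltW.
  by apply: cvs_recenter; rewrite ?absN.
move=> y yD; have [z [zp rz xz [hz cz c1z]]] := pick _ ((inD_range y).1 yD).
have yx : abs (y - x) <= abs z by apply: absB_le.
rewrite (peval_recenter zp) ?absN // [- x + y]addrC.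
have -> : peval abs h y = peval abs c (y - x).
  by rewrite (peval_recenter zp xz) // addrC subrK.
have -> : peval abs h x = c 0%N by rewrite /c recenter0.
rewrite [in peval abs c (y - x)]eqc (pevalD (ltW zp) yx) //; [|exact: cvsC|by apply: cvsM => //; [exact: ltW|exact: cvs_poly]].
rewrite (pevalM (ltW zp) yx) //; last exact: cvs_poly.
by rewrite peval_poly pevalC hornerX addrAC subrr add0r.
Qed.
(** A point outside the disc exceeds every admissible radius, so the geometric expansion of
    [1 / (t - x)] at 0 converges. *)
Lemma inO_inverse x : ~ inD x -> exists2 h1, inO abs cl h1 &
  forall y, inD y -> (y - x) * peval abs h1 y = 1.
Proof.
move=> xD; have big rho : inR rho -> rho < abs x.
  by move: xD; rewrite /indisc /in_tree_range; case: cl => /negP; rewrite -?leNgt -?ltNge => h [_ h'];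
    [apply: le_lt_trans h|apply: lt_le_trans h].
have x0 : x != 0 by rewrite -abs_gt0; apply: big range0.
pose h1 : ps k := fun n => - x ^- n.+1.
have hO : inO abs cl h1.
  apply: cvs_inO => rho r0 /big rx.
  have ax : 0 < abs x by apply: lt_trans rx.
  apply: (@null_le _ (fun n => (abs x)^-1 * (rho / abs x) ^+ n)).
    by move=> n; rewrite absN absV absX exprS invfM expr_div_n mulrA mulrAC.
  apply: null_scale; first by rewrite invr_ge0 abs_ge0.
  apply/nullP => [n|]; first by rewrite exprn_ge0 // divr_ge0 ?abs_ge0 // ltW.
  by apply: cvg_expr; rewrite ger0_norm ?divr_ge0 ?abs_ge0 ?ltW // ltr_pdivrMr // mul1r.
exists h1 => // y yD.
have -> : y - x = peval abs (poly2ps ('X - x%:P)) y by rewrite peval_poly !hornerE.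
rewrite -inO_pevalM //; last exact: inO_poly.
suff -> : poly2ps ('X - x%:P) * h1 = 1 by rewrite -psC1 pevalC.
apply/funext => -[|n]; rewrite psM ps1.
  by rewrite big_ord_recl big_ord0 /poly2ps coefB coefX coefC /= sub0r addr0 mulNr mulrN opprK expr1 divff.
rewrite big_ord_recl /poly2ps coefB coefX coefC /= sub0r subn0.
rewrite big_ord_recl coefB coefX coefC /= subr0 mul1r big1 ?addr0 => [|i _]; last first.
  by rewrite coefB coefX coefC /= subr0 mul0r.
by rewrite subSS subn0 /h1 mulrN mulNr opprK exprS invfM mulrA divff // mul1r subrr.
Qed.
(** Replaces letting [abs z] tend to 1, which is not admissible in the open case: if [abs c > 1],
    some [z] in the disc has [abs z ^+ n > 1 / abs c], a contradiction. *)
Lemma unit_bound (c : k) n rho : inR rho ->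
  (forall z, inR (abs z) -> rho <= abs z -> abs c * abs z ^+ n <= 1) -> abs c <= 1.
Proof.
rewrite /in_tree_range; case: cl => -[r0 r1] h.
  by have := h 1; rewrite abs1 expr1n mulr1; apply=> //; rewrite ler01 lexx.
rewrite leNgt; apply/negP => c1; have c0 : 0 < abs c by apply: lt_trans c1.
case: n h => [|n] h.
  have [z /andP[z1 z2]] := abs_dense r0 r1 (lexx 1).
  have := h z; rewrite expr0 mulr1 abs_ge0 z2 => /(_ (conj isT isT) (ltW z1)).
  by rewrite leNgt c1.
have [x hx] : exists x : k, x ^+ n.+1 = c^-1.
  have : size ('X^(n.+1) - c^-1%:P : {poly k}) != 1%N by rewrite size_XnsubC.
  case/closed_rootP => x /rootP; rewrite !hornerE => /eqP.
  by rewrite subr_eq0 => /eqP; exists x.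
have xN : abs x ^+ n.+1 = (abs c)^-1 by rewrite -absX hx absV.
have x1 : abs x < 1.
  by rewrite -(@ltr_pXn2r _ n.+1) ?nnegrE ?abs_ge0 ?xN // expr1n invf_lt1.
have m1 : Num.max rho (abs x) < 1 by rewrite gt_max r1.
have [|z /andP[z1 z2]] := abs_dense _ m1 (lexx 1); first by rewrite le_max r0.
move: z1; rewrite gt_max => /andP[rz xz].
have := h z; rewrite z2 abs_ge0 => /(_ (conj isT isT) (ltW rz)).
rewrite leNgt => /negP; apply.
rewrite -[ltLHS](divff (lt0r_neq0 c0)) ltr_pM2l // -xN.
by rewrite ltr_pXn2r ?nnegrE ?abs_ge0.
Qed.
(** Termwise, [x^n - y^n] is [x - y] times an integral polynomial in points of the unit disc. *)
Lemma peval_lip c x y : inO abs cl c -> inD x -> inD y -> (forall n, abs (c n) <= 1) ->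
  abs (peval abs c x - peval abs c y) <= abs (x - y).
Proof.
move=> hc xD yD c1.
have /inD_range xR := xD; have /inD_range yR := yD.
have tx := peval_term (abs_ge0 x) (lexx _) (inO_cvs hc xR); have ty := peval_term (abs_ge0 y) (lexx _) (inO_cvs hc yR).
have -> : peval abs c x - peval abs c y = sumk (fun n => c n * x ^+ n + (-1) * (c n * y ^+ n)).
  rewrite sumkD ?sumkZ ?mulN1r //.
  by apply: null_le ty => n; rewrite mulN1r absN.
apply: sumk_bound => [|n].
  move=> eps e0; have [N hN] := tx _ e0; have [N' hN'] := ty _ e0.
  exists (maxn N N') => n; rewrite geq_max => /andP[/hN h1 /hN' h2].
  by rewrite mulN1r; apply: absB_lt.
rewrite mulN1r -mulrBr absM -[leRHS]mul1r ler_pM ?abs_ge0 // subrXX absM ler_piMr ?abs_ge0 //.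
apply: abs_sum_le => // i _; rewrite absM !absX mulr_ile1 ?exprn_ge0 ?exprn_ile1 ?abs_ge0 //.
  exact: range_le1 xR.
exact: range_le1 yR.
Qed.

(** * Finite etale covers of discs *)

Section Cover.
Variables (d : nat) (f : ps k).
Hypotheses (Hf : inO abs cl f) (Hfmap : forall x, inD x -> inD (peval abs f x)).
Hypothesis Hfree : forall h, inO abs cl h ->
  exists! g : 'I_d -> ps k, (forall j, inO abs cl (g j)) /\
    forall x, inD x ->
      peval abs h x = \sum_(j < d) peval abs (g j) (peval abs f x) * x ^+ j.
Variable P : 'I_d.+1 -> ps k.
Hypotheses (HPO : forall j, inO abs cl (P j)) (HPmonic : P ord_max = psconst 1).
Hypothesis HPf : forall x, inD x ->
  \sum_(j < d.+1) peval abs (P j) (peval abs f x) * x ^+ j = 0.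

Definition Ppol s : {poly k} := \poly_(j < d.+1) peval abs (P (inord j)) s.
Lemma Ppol_horner s x : (Ppol s).[x] = \sum_(j < d.+1) peval abs (P j) s * x ^+ j.
Proof. by rewrite horner_poly; apply: eq_bigr => j _; rewrite inord_val. Qed.
Lemma Ppol_top s : peval abs (P (inord d)) s = 1.
Proof.
have -> : inord d = ord_max :> 'I_d.+1 by apply: val_inj; rewrite /= inordK.
by rewrite HPmonic pevalC.
Qed.
Lemma size_Ppol s : size (Ppol s) = d.+1.
Proof. by rewrite size_poly_eq // Ppol_top oner_eq0. Qed.
Lemma Ppol_monic s : Ppol s \is monic.
Proof. by rewrite monicE lead_coefE size_Ppol coef_poly ltnSn Ppol_top. Qed.
Lemma d_gt0 : (0 < d)%N.
Proof.
case: (posnP d) => // d0; have [g [[_ hg] _]] := Hfree (inOC 1).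
have := hg 0; rewrite pevalC big1 => [h|i _]; last by have := ltn_ord i; rewrite {2}d0.
have /h/eqP : inD 0 by rewrite /indisc abs0; case: cl; rewrite ?ler01 ?ltr01.
by rewrite oner_eq0.
Qed.

(** A nonzero polynomial with a root is not constant, so [q + 1] would have a root as well. *)
Lemma poly_fun0 (q : {poly k}) : (forall x, q.[x] = 0) -> q = 0.
Proof.
move=> q0; apply/eqP; apply: contraT => qn0.
have sq : (1 < size q)%N.
  by rewrite (root_size_gt1 (a := 0) qn0) //; apply/rootP.
have : size (q + 1) != 1%N by rewrite size_polyDl ?size_poly1 // gtn_eqF.
by case/closed_rootP => x /rootP; rewrite !hornerE q0 add0r => /eqP; rewrite oner_eq0.
Qed.

(** If [h1 = z(f) / (t - x)] has coordinates [g], then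
    [(X - x) * (\sum_j g_j X^j) - g_(d-1) P] and [z] agree modulo [P] by uniqueness
    of coordinates, hence agree since both have degree [< d]. *)
Lemma fibre_identity h1 z H x : inO abs cl h1 -> inO abs cl z -> inO abs cl H ->
  (forall y, inD y -> (y - x) * peval abs h1 y = peval abs H y) ->
  (forall y, inD y -> peval abs z (peval abs f y) = peval abs H y) ->
  exists q : k -> {poly k}, exists l : k -> k,
    (forall y, inD y -> (q (peval abs f y)).[y] = peval abs h1 y) /\
    (forall s, inD s -> ('X - x%:P) * q s = l s *: Ppol s + (peval abs z s)%:P).
Proof.
move=> h1O zO HO h1H zH.
have [g [[gO hg] _]] := Hfree h1O.
pose gn j : ps k := if insub j is Some i then g i else 0.
have gnO j : inO abs cl (gn j).
  by rewrite /gn; case: insubP => [i _ _|_]; [exact: gO|rewrite -psC0; exact: inOC].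
have gnE (j : 'I_d) : gn j = g j by rewrite /gn valK.
pose pr j : ps k := if j is j'.+1 then gn j' else 0.
have prO j : inO abs cl (pr j) by case: j => [|j] /=; [rewrite -psC0; exact: inOC|exact: gnO].
(* Multiplication by [X - x] shifts the coordinates ([pr]); the overflow in degree [d] is removed
   with the monic [P]. *)
pose K j : ps k := pr j - psconst x * gn j - gn d.-1 * P (inord j).
have xgO j : inO abs cl (psconst x * gn j) by apply: inOM => //; exact: inOC.
have gPO j : inO abs cl (gn d.-1 * P (inord j)) by apply: inOM.
have prxO j : inO abs cl (pr j - psconst x * gn j) by apply: inOB.
have KO j : inO abs cl (K j) by apply: inOB.
pose q s : {poly k} := \sum_(j < d) peval abs (g j) s *: 'X^j.
have qE s y : (q s).[y] = \sum_(j < d) peval abs (g j) s * y ^+ j.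
  by rewrite horner_sum; apply: eq_bigr => j _; rewrite hornerZ hornerXn.
have Ksum t y : inD t -> \sum_(j < d) peval abs (K j) t * y ^+ j =
    (y - x) * (q t).[y] - peval abs (gn d.-1) t * (Ppol t).[y].
  move=> tD.
  pose G j := peval abs (gn j) t; pose Q j := peval abs (P (inord j)) t.
  have Ke j : peval abs (K j) t = (if j is j'.+1 then G j' else 0) - x * G j - G d.-1 * Q j.
    rewrite (inO_pevalB tD) // (inO_pevalB tD) // !(inO_pevalM tD) ?pevalC //; last exact: inOC.
    by case: j => [|j] //=; rewrite -psC0 pevalC.
  have dE : d = d.-1.+1 by rewrite prednK // d_gt0.
  have -> : (q t).[y] = \sum_(j < d) G j * y ^+ j.
    by rewrite qE; apply: eq_bigr => j _; rewrite /G gnE.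
  under eq_bigr => j _ do rewrite Ke !mulrBl -[x * _ * _]mulrA -[G d.-1 * _ * _]mulrA.
  rewrite !sumrB -!mulr_sumr mulrBl.
  have -> : \sum_(j < d) Q j * y ^+ j = (Ppol t).[y] - y ^+ d.
    by rewrite horner_poly big_ord_recr /= Ppol_top mul1r addrK.
  have main : \sum_(j < d) (if nat_of_ord j is j'.+1 then G j' else 0) * y ^+ j + G d.-1 * y ^+ d =
      y * \sum_(j < d) G j * y ^+ j.
    rewrite -(big_mkord xpredT (fun j => (if j is j'.+1 then G j' else 0) * y ^+ j)).
    rewrite -(big_mkord xpredT (fun j => G j * y ^+ j)).
    rewrite [in LHS]dE big_nat_recl //= mul0r add0r.
    rewrite [in RHS]dE big_nat_recr //= mulrDr mulr_sumr -dE.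
    congr (_ + _); last by rewrite mulrCA -exprS -dE.
    by apply: eq_bigr => j _; rewrite exprS mulrCA.
  by rewrite -main -/(G d.-1); ring.
have [g' [_ uniq]] := Hfree HO.
have K1 : (fun j : 'I_d => K j) = g'.
  symmetry; apply: uniq; split=> [j|y yD]; first exact: KO.
  rewrite (Ksum _ _ (Hfmap yD)) Ppol_horner HPf // mulr0 subr0.
  by rewrite qE -hg // h1H.
have K2 : (fun j : 'I_d => if j == 0%N :> nat then z else 0) = g'.
  symmetry; apply: uniq; split=> [j|y yD].
    by case: ifP => // _; rewrite -psC0; exact: inOC.
  rewrite (bigD1 (Ordinal d_gt0)) //= expr0 mulr1 zH // big1 ?addr0 // => j j0.
  by rewrite ifN -?psC0 ?pevalC ?mul0r //; apply: contra j0 => /eqP j0; apply/eqP/val_inj.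
have KE (j : 'I_d) : K j = if j == 0%N :> nat then z else 0.
  by have := congr1 (fun q => q j) (etrans K1 (esym K2)).
exists q, (fun s => peval abs (gn d.-1) s); split=> [y yD|s sD]; first by rewrite qE hg.
apply/eqP; rewrite -subr_eq0; apply/eqP/poly_fun0 => y.
have := Ksum s y sD; rewrite (bigD1 (Ordinal d_gt0)) //=.
rewrite (KE (Ordinal d_gt0)) /= expr0 mulr1 big1 ?addr0 => [zE|j j0].
  by rewrite hornerD hornerN hornerM hornerXsubC hornerD hornerZ hornerC zE; ring.
by rewrite KE ifN -?psC0 ?pevalC ?mul0r //; apply: contra j0 => /eqP j0; apply/eqP/val_inj.
Qed.
(** Put [X = x] in [fibre_identity]. For a root [x] of [P(s, X)], the choice [z = 1] shows that [x]
    lies in the disc, and [z = s - f(x)] that [x] lies over [s]. *)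
Lemma fibre_key h1 z H x s : inO abs cl h1 -> inO abs cl z -> inO abs cl H ->
  (forall y, inD y -> (y - x) * peval abs h1 y = peval abs H y) ->
  (forall y, inD y -> peval abs z (peval abs f y) = peval abs H y) ->
  inD s -> root (Ppol s) x -> peval abs z s = 0.
Proof.
move=> h1O zO HO h1H zH sD /rootP rx.
have [q [l [_ /(_ s sD)]]] := fibre_identity h1O zO HO h1H zH.
by move=> /(congr1 (fun r => r.[x])); rewrite !hornerE rx subrr mul0r mulr0 add0r.
Qed.

Lemma fibre_root s x : inD s -> root (Ppol s) x -> inD x /\ peval abs f x = s.
Proof.
move=> sD rx; have xD : inD x.
  apply: contrapT => /inO_inverse [h1 h1O h1E].
  have := @fibre_key h1 (psconst 1) (psconst 1) x s h1O (inOC 1) (inOC 1).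
  rewrite pevalC => h; have /eqP : 1 = 0 :> k.
    by apply: h => // y yD; rewrite ?pevalC ?h1E.
  by rewrite oner_eq0.
split=> //; have [h1 h1O h1E] := inO_divide Hf xD.
pose w := peval abs f x.
have HO : inO abs cl (f - psconst w) by apply: inOB => //; exact: inOC.
have := @fibre_key h1 (poly2ps ('X - w%:P)) (f - psconst w) x s h1O (inO_poly _) HO.
rewrite peval_poly !hornerE => h; apply/esym/eqP; rewrite -subr_eq0; apply/eqP/h => // y yD.
  by rewrite -h1E // inO_pevalB ?pevalC //; exact: inOC.
by rewrite peval_poly !hornerE inO_pevalB ?pevalC //; exact: inOC.
Qed.
Lemma root_fibre x : inD x -> root (Ppol (peval abs f x)) x.
Proof. by move=> xD; rewrite /root Ppol_horner HPf. Qed.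
Lemma Ppol_split s : inD s -> exists x : d.-tuple k,
  Ppol s = \prod_(y <- x) ('X - y%:P) /\
  (forall i, inD (tnth x i) /\ peval abs f (tnth x i) = s).
Proof.
move=> sD; have [r] := closed_field_poly_normal (Ppol s).
rewrite (monicP (Ppol_monic s)) scale1r => Dr.
have sz : size r == d by rewrite -eqSS -(size_prod_XsubC r id) -Dr size_Ppol.
exists (Tuple sz); split=> // i; apply: fibre_root => //.
by rewrite Dr root_prod_XsubC; apply: (mem_tnth i (Tuple sz)).
Qed.
Lemma inD_le1 x : inD x -> abs x <= 1.
Proof. by move=> /inD_range/range_le1. Qed.
Lemma nrm_prod_XsubC (r : seq k) : (forall x, x \in r -> abs x <= 1) ->
  nrm 1 (poly2ps (\prod_(y <- r) ('X - y%:P))) 1.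
Proof.
elim: r => [|y r IH] hr.
  by rewrite big_nil rmorph1 -psC1 -abs1; apply: nrmC.
rewrite big_cons rmorphM -[X in nrm _ _ X]mulr1; apply: nrmM; rewrite ?ler01 //; last first.
  by apply: IH => x xr; apply: hr; rewrite inE xr orbT.
move=> n; rewrite expr1n mulr1 /= /poly2ps coefB coefX coefC.
apply: absB_le; first exact: abs_nat.
by case: eqP => _; rewrite ?abs0 ?ler01 // hr // inE eqxx.
Qed.
(** The values of the coefficients of [P] are symmetric functions of fibre points, all in the unit
    disc; [gauss] and [unit_bound] turn this into a bound on each power series coefficient. *)
Lemma P_le1 j n : abs (P j n) <= 1.
Proof.
have Pb s : inD s -> abs (peval abs (P j) s) <= 1.
  move=> sD; have [x [Dx hx]] := Ppol_split sD.
  have := @nrm_prod_XsubC x _ j; rewrite -Dx expr1n mulr1 /poly2ps coef_poly ltn_ord inord_val.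
  by apply=> y /tnthP [i ->]; apply: inD_le1; case: (hx i).
apply: (@unit_bound _ n 0); first exact: range0.
move=> z zR _; apply: gauss; first exact: inO_cvs.
move=> x xz; apply: Pb; apply/inD_range; apply: range_le zR; by rewrite abs_ge0.
Qed.

(** * A fibre and the absolute value of [f - b] *)

Section Fibre.
Variables (b : k) (a : 'I_d -> k).
Hypotheses (Hb : inD b) (Ha_inj : injective a) (a_root : forall i, root (Ppol b) (a i)).

Lemma a_inD i : inD (a i). Proof. by have [] := fibre_root Hb (a_root i). Qed.
Lemma f_a i : peval abs f (a i) = b. Proof. by have [] := fibre_root Hb (a_root i). Qed.
Lemma Ppol_b : Ppol b = \prod_(i < d) ('X - (a i)%:P).
Proof.
have := @all_roots_prod_XsubC _ (Ppol b) (codom a).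
rewrite size_Ppol size_codom card_ord (monicP (Ppol_monic b)) scale1r => -> //.
- by rewrite /codom /image_mem big_map enumT.
- by apply/allP => x /codomP [i ->]; apply: a_root.
- by rewrite uniq_rootsE map_inj_uniq // enum_uniq.
Qed.
(** The product is the absolute value of [P(b, x) - P(f(x), x)], and the coefficients of [P] are
    Lipschitz with constant 1 by [P_le1]. *)
Lemma prod_le_f x : inD x -> \prod_i abs (x - a i) <= abs (peval abs f x - b).
Proof.
move=> xD; have := root_fibre xD; rewrite -abs_prod => /rootP r0.
have -> : \prod_i (x - a i) = (Ppol b).[x] - (Ppol (peval abs f x)).[x].
  by rewrite r0 subr0 Ppol_b horner_prod; apply: eq_bigr => i _; rewrite !hornerE.
rewrite !Ppol_horner -sumrB; apply: abs_sum_le; rewrite ?abs_ge0 // => j _.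
rewrite -mulrBl absM absX [leRHS]absBC -[leRHS]mulr1.
apply: ler_pM; rewrite ?exprn_ge0 ?abs_ge0 //.
  by apply: peval_lip => //; [exact: Hfmap|move=> n; exact: P_le1].
by rewrite exprn_ile1 ?abs_ge0 ?inD_le1.
Qed.
Lemma f_b_le1 x : inD x -> abs (peval abs f x - b) <= 1.
Proof. by move=> xD; apply: absB_le; apply: inD_le1 => //; apply: Hfmap. Qed.

(** The roots are divided out one at a time; the last clause keeps the remaining [a_j] zeros of the
    cofactor. *)
Lemma f_factor (s : seq 'I_d) : uniq s -> exists E, [/\ inO abs cl E,
  forall y, inD y -> peval abs f y - b = \prod_(i <- s) (y - a i) * peval abs E y &
  forall j, j \notin s -> peval abs E (a j) = 0].
Proof.
elim: s => [|i s IH] /=.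
  exists (f - psconst b); have O : inO abs cl (f - psconst b) by apply: inOB => //; exact: inOC.
  have E y : inD y -> peval abs (f - psconst b) y = peval abs f y - b.
    by move=> yD; rewrite inO_pevalB ?pevalC //; exact: inOC.
  split=> // [y yD|j _]; first by rewrite big_nil mul1r E.
  by rewrite E ?f_a ?subrr //; exact: a_inD.
case/andP => is_ us; have [E [EO hE E0]] := IH us.
have [E1 E1O hE1] := inO_divide EO (a_inD i).
exists E1; split=> // [y yD|j].
  by rewrite hE // big_cons -[peval abs E y]subr0 -(E0 i is_) hE1 //; ring.
rewrite inE negb_or => /andP[ji js]; have := hE1 _ (a_inD j).
rewrite !E0 // subrr => /esym/eqP; rewrite mulf_eq0 subr_eq0 (inj_eq Ha_inj) (negPf ji).
by move/eqP.
Qed.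
(** On a disc of radius [abs z], [f - b] is bounded by 1 and the monic [P(b, t)] has a term of size
    [abs z ^+ d]; [nrm_cancel] bounds [E] by the inverse of that size, and [unit_bound] lets the
    radius go to 1. *)
Lemma f_quotient : exists E, [/\ inO abs cl E, f - psconst b = poly2ps (Ppol b) * E &
  forall x, inD x -> abs (peval abs E x) <= 1].
Proof.
have [E [EO hE _]] := f_factor (enum_uniq 'I_d).
have fE : f - psconst b = poly2ps (Ppol b) * E.
  have qO := inO_poly (Ppol b); have bO := inOC b.
  apply: inO_eq => [||y yD]; [exact: inOB|exact: inOM|].
  rewrite inO_pevalB // inO_pevalM // pevalC hE // peval_poly Ppol_b horner_prod big_enum.
  by congr (_ * _); apply: eq_bigr => i _; rewrite !hornerE.
exists E; split=> // x xD.
apply: (@unit_bound _ d (abs x)); first exact/inD_range.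
move=> z zR xz.
have [z0|z0] := eqVneq z 0.
  by move: d_gt0; case: {+}d => // d' _; rewrite z0 abs0 expr0n mulr0 ler01.
have zp : 0 < abs z by rewrite abs_gt0.
have n1 : nrm (abs z) (poly2ps (Ppol b) * E) 1.
  rewrite -fE; apply: gauss => [|y yz]; first by apply: cvsB; rewrite ?ltW //; [exact: inO_cvs|exact: cvsC].
  have yD : inD y by apply/inD_range; apply: range_le zR; rewrite abs_ge0.
  by rewrite inO_pevalB ?pevalC ?f_b_le1 //; exact: inOC.
have qd : poly2ps (Ppol b) d = 1 by rewrite /poly2ps coef_poly ltnSn Ppol_top.
have := @nrm_cancel (abs z) (poly2ps (Ppol b)) E 1 d zp (cvs_poly _ _) (inO_cvs EO zR) n1.
rewrite qd abs1 mul1r expf_neq0 ?gt_eqF // => /(_ isT) hn.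
have := peval_bound (ltW zp) xz (inO_cvs EO zR) hn.
by rewrite ler_pdivlMr ?exprn_gt0.
Qed.
Lemma f_le_prod x : inD x -> abs (peval abs f x - b) <= \prod_i abs (x - a i).
Proof.
move=> xD; have [E [EO fE E1]] := f_quotient.
have -> : peval abs f x - b = (Ppol b).[x] * peval abs E x.
  rewrite -peval_poly -inO_pevalM //; last exact: inO_poly.
  by rewrite -fE inO_pevalB ?pevalC //; exact: inOC.
rewrite Ppol_b horner_prod absM abs_prod.
have -> : \prod_i abs ('X - (a i)%:P).[x] = \prod_i abs (x - a i).
  by apply: eq_bigr => i _; rewrite !hornerE.
by rewrite ler_piMr ?E1 // prodr_ge0 // => i _; exact: abs_ge0.
Qed.
End Fibre.

(** * Separability of the fibres and bounds on coordinates *)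

Hypothesis Hetale : forall x, inD x -> peval abs (psderiv f) x != 0.

Lemma psderiv_poly (q : {poly k}) : psderiv (poly2ps q) = poly2ps q^`().
Proof. by apply/funext => n; rewrite /psderiv /poly2ps coef_deriv mulr_natl. Qed.

(** Apply [fibre_identity] to [h1 = (f - f(x)) / (t - x)]. At [s = f(x)] the identity is
    [(X - x) q = l P], whose derivative at [x] reads [f'(x) = l P'(x)]. *)
Lemma Ppol_deriv_neq0 x : inD x -> (Ppol (peval abs f x))^`().[x] != 0.
Proof.
move=> xD; set w := peval abs f x; have [h1 h1O h1E] := inO_divide Hf xD.
have wO : inO abs cl (f - psconst w) by apply: inOB => //; exact: inOC.
have [|y yD|q [l [hq /(_ w (Hfmap xD))]]] :=
    @fibre_identity h1 (poly2ps ('X - w%:P)) (f - psconst w) x h1O (inO_poly _) wO.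
- by move=> y yD; rewrite -h1E // inO_pevalB ?pevalC //; exact: inOC.
- by rewrite peval_poly !hornerE inO_pevalB ?pevalC //; exact: inOC.
rewrite peval_poly hornerXsubC subrr addr0 => /(congr1 (fun r => r^`().[x])).
rewrite derivM derivXsubC derivZ hornerZ hornerD !hornerM hornerC hornerXsubC subrr mul0r addr0 mul1r.
rewrite hq // => h1l; apply/negP => /eqP P0.
have /eqP := Hetale xD; apply.
have -> : f = psconst w + poly2ps ('X - x%:P) * h1.
  have xO := inO_poly ('X - x%:P); have cO := inOC w.
  apply: inO_eq => // [|y yD]; first by apply: inOD => //; apply: inOM.
  rewrite inO_pevalD ?inO_pevalM ?pevalC ?peval_poly ?hornerXsubC -?h1E //; last exact: inOM.
  by rewrite addrC subrK.
rewrite psderivD psderivC add0r psderivM psderiv_poly derivXsubC.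
have dO := inO_deriv h1O; have xO := inO_poly ('X - x%:P); have oO := inO_poly 1.
rewrite inO_pevalD ?inO_pevalM //; [|exact: inOM|exact: inOM].
by rewrite !peval_poly hornerC hornerXsubC subrr mul0r addr0 mul1r h1l P0 mulr0.
Qed.
Lemma Ppol_fibre s : inD s -> exists2 x : 'I_d -> k, injective x & forall i, root (Ppol s) (x i).
Proof.
move=> sD; have [x [Dx hx]] := Ppol_split sD; exists (tnth x) => [|i]; last first.
  by rewrite Dx root_prod_XsubC mem_tnth.
apply/tuple_uniqP; rewrite -separable_prod_XsubC -Dx separable_poly.unlock.
apply: Pdiv.ClosedField.root_coprimep => y ry.
by have [yD fy] := fibre_root sD ry; rewrite -fy; apply: Ppol_deriv_neq0.
Qed.

Lemma horner_deriv_prod (x : 'I_d -> k) i :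
  (\prod_j ('X - (x j)%:P))^`().[x i] = \prod_(j | j != i) (x i - x j).
Proof.
rewrite (bigD1 i) //= derivM derivXsubC mul1r hornerD hornerM hornerXsubC subrr mul0r addr0.
by rewrite horner_prod; apply: eq_bigr => j _; rewrite hornerXsubC.
Qed.
Lemma lagrange (x : 'I_d -> k) (q : {poly k}) : injective x -> (size q <= d)%N ->
  q = \sum_i (q.[x i] / \prod_(j | j != i) (x i - x j)) *: \prod_(j | j != i) ('X - (x j)%:P).
Proof.
move=> x_inj sq; apply/eqP; rewrite -subr_eq0; apply/eqP.
apply: (@roots_geq_poly_eq0 _ _ (codom x)).
- apply/allP => y /codomP [i ->]; apply/rootP.
  rewrite hornerD hornerN horner_sum (bigD1 i) //= [X in - (_ + X)]big1 ?addr0 => [|l li].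
    rewrite hornerZ horner_prod.
    under [X in _ / _ * X]eq_bigr => j _ do rewrite hornerXsubC.
    rewrite divfK ?subrr //; apply/prodf_neq0 => j ji.
    by rewrite subr_eq0 (inj_eq x_inj) eq_sym.
  rewrite hornerZ horner_prod [X in _ / _ * X](bigD1 i) /=; last by rewrite eq_sym.
  by rewrite hornerXsubC subrr mul0r mulr0.
- by rewrite map_inj_uniq // enum_uniq.
- rewrite size_codom card_ord (leq_trans (size_polyD _ _)) // geq_max sq size_polyN.
  apply: (leq_trans (size_sum _ _ _)); apply/bigmax_leqP => i _.
  rewrite (leq_trans (size_scale_leq _ _)) // size_prod => [|j _]; last by rewrite polyXsubC_eq0.
  rewrite (eq_bigr (fun=> 2)) => [|j _]; last exact: size_XsubC.
  have -> : #|[pred j | j != i]| = d.-1 by rewrite (cardC1 i) card_ord.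
  rewrite sum_nat_const (_ : #|_| = d.-1); last by rewrite (cardC1 i) card_ord.
  by have := d_gt0; lia.
Qed.

Variable G : 'I_d -> 'I_d -> ps k.
Hypothesis HGO : forall i j, inO abs cl (G i j).
Hypothesis HG : forall (j : 'I_d) x, inD x ->
  j%:R * x ^+ j.-1 =
  peval abs (psderiv f) x * \sum_(i < d) peval abs (G i j) (peval abs f x) * x ^+ i.

(** Differentiate [f - w = P(w, t) E] at [x], a root of [P(w, X)] for [w = f(x)], and use that [E]
    is bounded by 1. *)
Lemma f_deriv_le x : inD x ->
  abs (peval abs (psderiv f) x) <= abs (Ppol (peval abs f x))^`().[x].
Proof.
move=> xD; set w := peval abs f x; have wD : inD w by apply: Hfmap.
have [y y_inj ry] := Ppol_fibre wD; have [E [EO fE E1]] := f_quotient wD y_inj ry.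
have /rootP rx := root_fibre xD.
have -> : psderiv f = poly2ps (Ppol w)^`() * E + poly2ps (Ppol w) * psderiv E.
  rewrite -psderiv_poly -psderivM -fE.
  by rewrite -{1}[f](subrK (psconst w)) [LHS]psderivD psderivC addr0.
have dO := inO_deriv EO.
rewrite inO_pevalD ?inO_pevalM ?peval_poly ?rx //; try by [exact: inO_poly|apply: inOM => //; exact: inO_poly].
by rewrite mul0r addr0 absM ler_piMr ?abs_ge0 ?E1.
Qed.

(** The inverse of [f'] has bounded coordinates, namely the second column of [G]. *)
Lemma Ppol_deriv_lower b rho : inD b -> inR rho -> exists2 dl, 0 < dl &
  forall s x, abs (s - b) <= rho -> root (Ppol s) x -> dl <= abs (Ppol s)^`().[x].
Proof.
(* In degree 1 there is no second column of [G], but [P(s, X)] is monic linear and has derivative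
   1. *)
move=> bD rR; case: (ltnP 1 d) => [d1|d1]; last first.
  exists 1 => // s x _ rx; have d1' : d = 1%N by apply/eqP; rewrite eqn_leq d1 d_gt0.
  have : size (Ppol s) = 2 by rewrite size_Ppol d1'.
  have /monicP := Ppol_monic s; rewrite lead_coefE => + sz; rewrite sz /= => c1.
  have s1 : (size (Ppol s)^`() <= 1)%N.
    by have := @lt_size_deriv _ (Ppol s); rewrite -size_poly_eq0 sz ltnS; apply.
  rewrite (horner_coef_wide _ s1).
  by rewrite big_ord1 coef_deriv c1 expr0 mulr1 mulr1n abs1.
have mR : inR (Num.max (abs b) rho) by apply: range_max => //; exact/inD_range.
have m0 : 0 <= Num.max (abs b) rho by case: mR.
have bd l : exists2 M, 0 < M & nrm (Num.max (abs b) rho) (G l (Ordinal d1)) M.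
  by apply: cvs_bounded => //; apply: inO_cvs.
pose M := fun l => sval (cid2 (bd l)).
have M0 l : 0 < M l by rewrite /M; case: cid2.
have hM l : nrm (Num.max (abs b) rho) (G l (Ordinal d1)) (M l) by rewrite /M; case: cid2.
have S0 : 0 < 1 + \sum_l M l by rewrite ltr_pwDl // sumr_ge0 // => l _; rewrite ltW.
exists (1 + \sum_l M l)^-1 => [|s x sb rx]; first by rewrite invr_gt0.
have sD : inD s by apply: inD_shift sb.
have [xD fx] := fibre_root sD rx.
apply: le_trans (_ : abs (peval abs (psderiv f) x) <= _); last by rewrite -fx f_deriv_le.
have := HG (Ordinal d1) xD; rewrite /= expr0 mulr1 fx => /(congr1 abs).
rewrite abs1 absM => e1; rewrite -[leLHS]mulr1 [X in _ * X]e1 ler_pdivrMl // mulrC.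
rewrite ler_wpM2r ?abs_ge0 //; apply: abs_sum_le => [|l _]; first exact: ltW.
have sm : abs s <= Num.max (abs b) rho.
  by rewrite -[s](subrK b) addrC (le_trans (absD _ _)) // ge_max !le_max lexx sb orbT.
have h1 := peval_bound m0 sm (inO_cvs (HGO l (Ordinal d1)) mR) (hM l).
rewrite absM absX; apply: (@le_trans _ _ (M l)).
  rewrite -[leRHS]mulr1 ler_pM ?exprn_ge0 ?abs_ge0 //.
  by rewrite exprn_ile1 ?abs_ge0 ?inD_le1.
by rewrite (bigD1 l) //= addrCA lerDl addr_ge0 // sumr_ge0 // => i _; rewrite ltW.
Qed.

(** The constant, the inverse of the lower bound in [Ppol_deriv_lower], is uniform in [g]; so one
    bound serves all iterates in [conv_lower]. *)
Lemma coord_bound b y : inD b -> inR (abs y) -> y != 0 -> exists2 C, 0 < C &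
  forall (g : 'I_d -> ps k) M, (forall j, inO abs cl (g j)) -> 0 <= M ->
    (forall x, inD x -> abs (peval abs f x - b) <= abs y ->
       abs (\sum_(j < d) peval abs (g j) (peval abs f x) * x ^+ j) <= M) ->
    forall j, nrm (abs y) (recenter abs (g j) b) (C * M).
Proof.
move=> bD yR y0; have [dl dl0 hdl] := Ppol_deriv_lower bD yR.
exists dl^-1 => [|g M gO M0 hM j]; first by rewrite invr_gt0.
have [z [z0 mz zR]] := range_exists (range_max yR ((inD_range b).1 bD)).
move: mz; rewrite ge_max => /andP[yz bz]; have zp : 0 < abs z by rewrite abs_gt0.
have gz : cvs (abs z) (g j) by apply: inO_cvs.
apply: gauss => [|t ty].
  by apply: (@cvs_rad (abs z)); [rewrite abs_ge0|exact: cvs_recenter].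
rewrite (peval_recenter zp bz) //; last exact: le_trans yz.
set s := b + t; have sb : abs (s - b) <= abs y by rewrite /s addrC addKr.
have sD : inD s by apply: inD_shift sb.
have [x x_inj rx] := Ppol_fibre sD.
pose q : {poly k} := \poly_(l < d) peval abs (g (insubd j l)) s.
have qE w : q.[w] = \sum_(l < d) peval abs (g l) s * w ^+ l.
  by rewrite horner_poly; apply: eq_bigr => l _; rewrite valKd.
have -> : peval abs (g j) s = q`_j by rewrite coef_poly ltn_ord valKd.
have qs : (size q <= d)%N by apply: size_poly.
rewrite (lagrange x_inj qs) coef_sum; apply: abs_sum_le => [|i _].
  by rewrite mulr_ge0 // invr_ge0 ltW.
have [xD fx] := fibre_root sD (rx i).
rewrite coefZ absM absM absV -[leRHS]mulr1 mulrC [X in _ <= X * _]mulrC.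
have hq : abs q.[x i] <= M by rewrite qE -fx; apply: hM => //; rewrite fx.
have hp : dl <= abs (\prod_(j0 < d | j0 != i) (x i - x j0)).
  by rewrite -horner_deriv_prod -(Ppol_b x_inj rx); apply: hdl.
rewrite [leRHS]mulrC; apply: ler_pM; rewrite ?mulr_ge0 ?invr_ge0 ?abs_ge0 //.
  (* The Lagrange numerator has roots in the unit disc, hence coefficients bounded by 1. *)
  have := @nrm_prod_XsubC [seq x l | l <- enum 'I_d & l != i] _ j.
  rewrite big_map big_filter big_enum_cond /= expr1n mulr1; apply=> w /mapP [l _ ->].
  by apply: inD_le1; have [] := fibre_root sD (rx l).
apply: ler_pM; rewrite ?invr_ge0 ?abs_ge0 // lef_pV2 // posrE (lt_le_trans dl0) //.
Qed.

Lemma nrm_cvs rho rho' c M : 0 <= rho < rho' -> nrm rho' c M -> cvs rho c.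
Proof.
move=> /andP[r0 rr] hM; have M0 := nrm_ge0 hM; have r0' : 0 < rho' by apply: le_lt_trans rr.
apply: (@null_le _ (fun n => M * (rho / rho') ^+ n)) => [n|].
  by rewrite expr_div_n mulrA ler_pdivlMr ?exprn_gt0 // mulrAC ler_wpM2r ?exprn_ge0.
apply: null_scale => //.
apply/nullP => [n|]; first by rewrite exprn_ge0 // divr_ge0 // ltW.
by apply: cvg_expr; rewrite ger0_norm ?divr_ge0 ?ltr_pdivrMr ?mul1r // ltW.
Qed.
Lemma conv_openP c r : conv_open abs c r <-> forall rho, 0 <= rho < r -> cvs rho c.
Proof.
split=> h rho rr; have := h rho rr; apply nullP => n;
  by rewrite mulr_ge0 ?abs_ge0 ?exprn_ge0 //; case/andP: rr.
Qed.
Lemma psderiv_eq0 c : psderiv c = 0 -> c = psconst (c 0%N).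
Proof.
move=> c0; apply/funext => -[|n] //; have := congr1 (fun e : ps k => e n) c0.
by move=> /eqP; rewrite /psderiv mulf_eq0 (negPf (char0 n)) => /eqP.
Qed.
(** Quantitative form of [pscomp_inj], from the recursion [pscomp_small]; the constant depends only
    on [F] and [n]. *)
Lemma pscomp_bound F n : F 0%N = 0 -> F 1%N != 0 -> exists2 C, 0 <= C &
  forall z eps, (forall m, (m <= n)%N -> abs (pscomp F z m) <= eps) ->
    forall m, (m <= n)%N -> abs (z m) <= C * eps.
Proof.
move=> F0 F1; elim: n => [|n [C C0 IH]].
  by exists 1 => // z eps h m mn; rewrite mul1r; have := h m mn; case: m mn => // _; rewrite pscomp0.
pose B := \sum_(l < n.+1) abs ((F ^+ l) n.+1); have B0 : 0 <= B by rewrite sumr_ge0 // => i _; exact: abs_ge0.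
pose C' := abs (F 1%N ^+ n.+1)^-1 * (1 + C * B).
have C'0 : 0 <= C' by rewrite mulr_ge0 ?abs_ge0 // addr_ge0 // mulr_ge0.
exists (C + C') => [|z eps h m]; first by rewrite addr_ge0.
have e0 : 0 <= eps by apply: le_trans (h 0%N isT); exact: abs_ge0.
have IH' := IH z eps (fun m mn => h m (leqW mn)).
rewrite leq_eqVlt ltnS => /orP[/eqP ->|mn]; last first.
  by rewrite (le_trans (IH' m mn)) // mulrDl lerDl mulr_ge0.
rewrite (pscomp_small _ _ F0 F1) absM.
apply: (@le_trans _ _ (C' * eps)); last by rewrite mulrDl lerDr mulr_ge0.
rewrite /C' -mulrA ler_wpM2l ?abs_ge0 // mulrDl mul1r.
apply: absB_le; first by rewrite ler_wpDr ?mulr_ge0 // h.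
apply: abs_sum_le => [|l _]; first by rewrite addr_ge0 ?mulr_ge0.
rewrite absM ler_wpDl // mulrAC ler_pM ?abs_ge0 //; first by apply: IH'; rewrite -ltnS.
by rewrite /B (bigD1 l) //= lerDl sumr_ge0 // => i _; exact: abs_ge0.
Qed.

Lemma vdm_inj (x y : 'I_d -> k) : injective x ->
  (forall i, \sum_(j < d) x i ^+ j * y j = 0) -> forall j, y j = 0.
Proof.
move=> x_inj h j; pose q : {poly k} := \poly_(l < d) y (insubd j l).
have -> : y j = q`_j by rewrite coef_poly ltn_ord valKd.
have q0 i : q.[x i] = 0.
  by rewrite -[RHS](h i) horner_poly; apply: eq_bigr => l _; rewrite valKd mulrC.
rewrite (lagrange x_inj (size_poly _ _ : (size q <= d)%N)) coef_sum big1 // => i _.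
by rewrite q0 mul0r scale0r coef0.
Qed.

(** * Horizontal elements and the Vandermonde system *)

Section Horizontal.
Variables (b : k) (a : 'I_d -> k) (u : 'I_d -> ps k).
Hypotheses (Hb : inD b) (Ha_inj : injective a).
Hypothesis Hu0 : forall i, u i 0%N = a i.
Hypothesis HuP : forall i n,
  \sum_(j < d.+1) psmul (recenter abs (P j) b) (pspow (u i) j) n = 0.

(** Constant term of the equation satisfied by [u i]. *)
Lemma a_root i : root (Ppol b) (a i).
Proof.
apply/rootP; rewrite Ppol_horner -[RHS](HuP i 0); apply: eq_bigr => j _.
by rewrite pspowE psmulMul psM0 recenter0 psX0 Hu0.
Qed.
Let aD i : inD (a i) := a_inD Hb a_root i.
Let fa i : peval abs f (a i) = b := f_a Hb a_root i.

(** This is [s - b] as a series in [t - a_i], and [coord i] is [t]; thus [Phi i] rewrites series in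
    [s - b] as series in [t - a_i]. It is injective because [f'(a_i)] is not 0. *)
Definition loc i : ps k := recenter abs f (a i) - psconst b.
Definition coord i : ps k := poly2ps ('X + (a i)%:P).
Local Notation Phi i := (pscomp (loc i)).

Lemma loc0 i : loc i 0%N = 0.
Proof. by rewrite /loc psB recenter0 fa /psconst /= subrr. Qed.
Lemma psderiv_loc i : psderiv (loc i) = recenter abs (psderiv f) (a i).
Proof.
have [z [z0 az zR]] := range_exists ((inD_range (a i)).1 (aD i)).
rewrite -(recenter_deriv _ az) ?abs_gt0 //; last exact: inO_cvs.
by rewrite -[in RHS](subrK (psconst b) (recenter abs f (a i))) [RHS]psderivD psderivC addr0.
Qed.
Lemma loc1 i : loc i 1%N != 0.
Proof.
have := congr1 (fun c : ps k => c 0%N) (psderiv_loc i).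
by rewrite recenter0 /psderiv mul1r => ->; apply: Hetale.
Qed.
Lemma germ_inD x c e h h' : inD x -> germ x c h -> germ x e h' ->
  (forall y, inD y -> h y = h' y) -> c = e.
Proof.
move=> xD gc ge hh; have [z [z0 xz zR]] := range_exists ((inD_range x).1 xD).
apply: germ_uniq ge; apply: (germ_local z0 gc) => y yz; apply: hh.
by apply: inD_shift xD zR _; rewrite addrC addKr.
Qed.
Lemma germ_coord i : germ (a i) (coord i) id.
Proof.
have := germ_poly (a i) 'X; rewrite comp_polyX; congr germ.
by apply/funext => x; rewrite hornerX.
Qed.
Lemma germ_base i g : inO abs cl g ->
  germ (a i) (Phi i (recenter abs g b)) (fun x => peval abs g (peval abs f x)).
Proof.
move=> gO; have := @germ_comp _ _ _ (recenter abs g b) (peval abs g) (inO_germ (aD i) Hf).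
by rewrite fa; apply; apply: inO_germ.
Qed.
Lemma germ_module i n (g : 'I_n -> ps k) : (forall j, inO abs cl (g j)) ->
  germ (a i) (\sum_j Phi i (recenter abs (g j) b) * coord i ^+ j)
    (fun x => \sum_j peval abs (g j) (peval abs f x) * x ^+ j).
Proof.
move=> gO; apply: germ_sum => j; apply: germM; first exact: germ_base.
exact: (germX _ (germ_coord i)).
Qed.

(** [t = u_i(f(t))] near [a_i]: both sides are roots of [P(f, X)] with the same
    constant term [a_i], which is a simple root of [P(b, X)]. *)
Lemma comp_u i : Phi i (u i) = coord i.
Proof.
pose q : {poly ps k} := \poly_(j < d.+1) Phi i (recenter abs (P (inord j)) b).
have qE z : q.[z] = \sum_(j < d.+1) Phi i (recenter abs (P j) b) * z ^+ j.
  by rewrite horner_poly; apply: eq_bigr => j _; rewrite inord_val.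
have qA : q.[coord i] = 0.
  rewrite qE (germ_inD (aD i) (germ_module i HPO) (germC _ 0)) ?psC0 //.
have qB : root q (Phi i (u i)).
  apply/rootP; rewrite qE.
  have -> : \sum_(j < d.+1) Phi i (recenter abs (P j) b) * Phi i (u i) ^+ j =
      Phi i (\sum_(j < d.+1) recenter abs (P j) b * u i ^+ j).
    by rewrite pscomp_sum; apply: eq_bigr => j _; rewrite pscompM ?pscompX ?loc0.
  rewrite (_ : \sum_(j < d.+1) _ = 0) -?psC0 ?pscompC //.
  apply/funext => n; rewrite psC0 ps0 -[RHS](HuP i n) ps_sum.
  by apply: eq_bigr => j _; rewrite pspowE.
have [q1 q1E] := factor_theorem _ _ qB.
(* This constant term is the product of the [a_i - a_j] over [j != i], so the cofactor can be
   cancelled. *)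
have q10 : q1.[coord i] 0%N != 0.
  have e1 : map_poly (@pscoef0 k) q = Ppol b.
    apply/polyP => j; rewrite coef_map /= !coef_poly; case: ifP => // _.
    by rewrite /pscoef0 pscomp0 recenter0.
  have e2 : map_poly (@pscoef0 k) q1 = \prod_(j | j != i) ('X - (a j)%:P).
    apply: (mulIf (negbT (polyXsubC_eq0 (a i)))).
    have -> : map_poly (@pscoef0 k) q1 * ('X - (a i)%:P) = map_poly (@pscoef0 k) q.
      rewrite q1E rmorphM /= rmorphB /= map_polyX map_polyC /=.
      by congr (_ * ('X - _%:P)); rewrite /pscoef0 pscomp0 Hu0.
    by rewrite e1 (Ppol_b Ha_inj a_root) (bigD1 i) //= mulrC.
  have -> : q1.[coord i] 0%N = (map_poly (@pscoef0 k) q1).[a i].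
    have -> : a i = pscoef0 (coord i).
      by rewrite /pscoef0 /coord /poly2ps coefD coefX coefC /= add0r.
    by rewrite horner_map.
  rewrite e2 horner_prod; apply/prodf_neq0 => j ji.
  by rewrite hornerXsubC subr_eq0 (inj_eq Ha_inj) eq_sym.
have := qA; rewrite q1E hornerM hornerXsubC => /(ps_regular q10)/eqP.
by rewrite subr_eq0 => /eqP.
Qed.

Lemma psderiv_coord i : psderiv (coord i) = 1.
Proof. by rewrite /coord psderiv_poly derivD derivX derivC addr0 rmorph1. Qed.

(** After substitution of [s = f(t)] and multiplication by [f'], where [u_i] becomes [t], this is
    the expansion of [HG] at [a_i]. *)
Lemma u_deriv i (j : 'I_d) :
  psderiv (u i ^+ j) = \sum_(l < d) recenter abs (G l j) b * u i ^+ l.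
Proof.
apply: (pscomp_inj (loc0 i) (loc1 i)).
have F1 : psderiv (loc i) 0%N != 0 by rewrite /psderiv mul1r loc1.
apply/eqP; rewrite -subr_eq0; apply/eqP/(ps_regular F1); rewrite mulrBr.
apply/eqP; rewrite subr_eq0; apply/eqP.
rewrite mulrC -pscomp_deriv ?loc0 // pscompX ?loc0 // comp_u psderivX psderiv_coord mulr1.
rewrite psderiv_loc pscomp_sum.
have -> : \sum_(l < d) Phi i (recenter abs (G l j) b * u i ^+ l) =
    \sum_(l < d) Phi i (recenter abs (G l j) b) * coord i ^+ l.
  by apply: eq_bigr => l _; rewrite pscompM ?pscompX ?comp_u ?loc0.
have g2 := germM (inO_germ (aD i) (inO_deriv Hf)) (germ_module i (fun l => HGO l j)).
have g1 := germM (germC (a i) j%:R) (germX j.-1 (germ_coord i)).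
rewrite -(germ_inD (aD i) g1 g2); last by move=> y yD; rewrite HG.
by rewrite rmorph_nat mulr_natl.
Qed.

Definition vdm (w : 'I_d -> ps k) i : ps k := \sum_(j < d) u i ^+ j * w j.
Lemma VsolP v w : Vsol u v w <-> forall i, vdm w i = psconst (v i).
Proof.
have E i n : vdm w i n = \sum_(j < d) psmul (pspow (u i) j) (w j) n.
  by rewrite /vdm ps_sum; apply: eq_bigr => j _; rewrite pspowE.
split=> [h i|h i n]; last by rewrite -E h.
by apply/funext => n; rewrite E h.
Qed.
(** The determinant of the Vandermonde matrix reduces to that of the distinct [a_i], so it is a unit
    of [ps k]; [W] is the matrix written V(s) in the theorem. *)
Lemma vdm_inverse : exists W : 'I_d -> 'I_d -> ps k,
  (forall w j, \sum_i W j i * vdm w i = w j) /\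
  (forall v i, vdm (fun j => \sum_l W j l * v l) i = v i).
Proof.
pose V : 'M[ps k]_d := \matrix_(i, j) u i ^+ j.
pose A : 'M[k]_d := \matrix_(i, j) a i ^+ j.
have detA : \det A != 0.
  rewrite -det_tr; apply/det0P => -[y y0 yA]; case/negP: y0; apply/eqP/rowP => j.
  rewrite mxE; apply: (vdm_inj Ha_inj) => i.
  have := congr1 (fun r : 'rV_d => r 0 i) yA; rewrite !mxE => yi; rewrite -[RHS]yi.
  by apply: eq_bigr => l _; rewrite !mxE mulrC.
have [e eE] : exists e, \det V * e = 1.
  apply: ps_inverse; rewrite -[_ 0%N]/(pscoef0 _) -det_map_mx.
  suff -> : map_mx (@pscoef0 k) V = A by [].
  by apply/matrixP => i j; rewrite !mxE /pscoef0 psX0 Hu0.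
pose W := e *: \adj V; exists (fun j i => W j i).
have WV : W *m V = 1%:M.
  by rewrite -scalemxAl mul_adj_mx scale_scalar_mx mulrC eE.
have VW : V *m W = 1%:M.
  by rewrite -scalemxAr mul_mx_adj scale_scalar_mx mulrC eE.
split=> [w j|v i].
  have := congr1 (fun X : 'cV_d => X j 0) (congr1 (fun X => X *m \col_l w l) WV).
  rewrite -mulmxA mul1mx !mxE => <-; apply: eq_bigr => l _; congr (_ * _).
  by rewrite mxE; apply: eq_bigr => m _; rewrite !mxE.
have := congr1 (fun X : 'cV_d => X i 0) (congr1 (fun X => X *m \col_l v l) VW).
rewrite -mulmxA mul1mx !mxE => <-; apply: eq_bigr => l _; rewrite !mxE; congr (_ * _).
by apply: eq_bigr => m _; rewrite !mxE.
Qed.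
Lemma Vsol_exists v : exists w, Vsol u v w.
Proof.
have [W [_ hW]] := vdm_inverse; exists (fun j => \sum_l W j l * psconst (v l)).
by apply/VsolP => i; rewrite hW.
Qed.
Lemma Vsol_uniq v w w' : Vsol u v w -> Vsol u v w' -> w = w'.
Proof.
move=> /VsolP h /VsolP h'; have [W [hW _]] := vdm_inverse; apply/funext => j.
by rewrite -(hW w) -(hW w'); apply: eq_bigr => i _; rewrite h h'.
Qed.
Lemma Vsol_lin (q : nat) (c : 'I_q -> k) (v : 'I_q -> 'I_d -> k) (w : 'I_q -> vec k d) :
  (forall l, Vsol u (v l) (w l)) ->
  Vsol u (fun i => \sum_l c l * v l i) (fun j n => \sum_l c l * w l j n).
Proof.
move=> h i n; transitivity (\sum_l c l * \sum_(j < d) psmul (pspow (u i) j) (w l j) n).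
  rewrite (eq_bigr (fun j : 'I_d => \sum_l c l * psmul (pspow (u i) j) (w l j) n)).
    by rewrite exchange_big /=; apply: eq_bigr => l _; rewrite mulr_sumr.
  move=> j _; rewrite /psmul; under [RHS]eq_bigr => l _ do rewrite mulr_sumr.
  rewrite exchange_big /=; apply: eq_bigr => m _; rewrite mulr_sumr.
  by apply: eq_bigr => l _; rewrite mulrCA.
rewrite /psconst; case: eqP => n0.
  by apply: eq_bigr => l _; rewrite h /psconst n0.
by rewrite big1 // => l _; rewrite h /psconst; move/eqP/negPf: n0 => ->; rewrite mulr0.
Qed.
(** By [u_deriv], [vdm] intertwines [D_s] with the derivation of [ps k] ([key]), whose kernel
    consists of the constants in characteristic 0. *)
Lemma Ds_kerP w : Ds_ker abs b G w <-> exists v, Vsol u v w.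
Proof.
pose D l : ps k := psderiv (w l) + \sum_(j < d) recenter abs (G l j) b * w j.
have DE : Ds_ker abs b G w <-> forall l, D l = 0.
  have E l n : D l n = psderiv (w l) n + \sum_(j < d) psmul (recenter abs (G l j) b) (w j) n.
    by rewrite /D psD ps_sum.
  split=> [h l|h l n]; last by rewrite -E h.
  by apply/funext => n; rewrite E h.
have key i : psderiv (vdm w i) = vdm D i.
  rewrite /vdm psderiv_sum; under eq_bigr => j _ do rewrite psderivM u_deriv mulr_suml.
  rewrite big_split /= addrC; under [RHS]eq_bigr => l _ do rewrite /D mulrDr mulr_sumr.
  rewrite big_split /=; congr (_ + _); rewrite exchange_big /=.
  by apply: eq_bigr => l _; apply: eq_bigr => j _; rewrite mulrCA mulrA.
split=> [/DE D0|[v /VsolP hv]].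
  exists (fun i => vdm w i 0%N); apply/VsolP => i; apply: psderiv_eq0; rewrite key.
  by rewrite /vdm big1 // => j _; rewrite D0 mulr0.
apply/DE => l; have [W [hW _]] := vdm_inverse.
by rewrite -(hW D) big1 // => i _; rewrite -key hv psderivC mulr0.
Qed.
(** Continuity of the inverse Vandermonde system: germs small up to order [n] at all the [a_i] force
    a small coefficient [n] in each coordinate. *)
Lemma vdm_bound n : exists2 C, 0 <= C & forall w eps, 0 <= eps ->
  (forall i m, (m <= n)%N -> abs (Phi i (vdm w i) m) <= eps) ->
  forall j, abs (w j n) <= C * eps.
Proof.
have bd i := pscomp_bound n (loc0 i) (loc1 i).
pose C i := sval (cid2 (bd i)).
have C0 i : 0 <= C i by rewrite /C; case: cid2.
have hC i z eps : (forall m, (m <= n)%N -> abs (Phi i z m) <= eps) ->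
    forall m, (m <= n)%N -> abs (z m) <= C i * eps.
  by rewrite /C; case: cid2 => ? ? h; apply: h.
have [W [hW _]] := vdm_inverse.
pose T j i m := abs (W j i m) * C i.
have T0 j i m : 0 <= T j i m by rewrite mulr_ge0 ?abs_ge0.
exists (\sum_j \sum_i \sum_(m < n.+1) T j i m) => [|w eps e0 h j].
  by do 3!(rewrite sumr_ge0 // => ? _).
rewrite -(hW w j) ps_sum; apply: abs_sum_le => [|i _].
  by rewrite mulr_ge0 //; do 3!(rewrite sumr_ge0 // => ? _).
rewrite psM; apply: abs_sum_le => [|m _].
  by rewrite mulr_ge0 //; do 3!(rewrite sumr_ge0 // => ? _).
apply: (@le_trans _ _ (T j i m * eps)).
  by rewrite absM /T -mulrA ler_wpM2l ?abs_ge0 // (hC i _ _ (h i)) // leq_subr.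
rewrite ler_wpM2r // (bigD1 j) //= ler_wpDr //; first by do 3!(rewrite sumr_ge0 // => ? _).
rewrite (bigD1 i) //= ler_wpDr //; first by do 2!(rewrite sumr_ge0 // => ? _).
by rewrite (bigD1 m) //= lerDl sumr_ge0.
Qed.

Lemma const_on_disc v w r (c : 'I_d) y (B : R) : Vsol u v w -> (forall l, conv_open abs (w l) r) ->
  y != 0 -> inR (abs y) ->
  (forall x, abs (x - a c) <= abs y -> abs (peval abs f x - b) <= B) -> B < r ->
  forall i j, abs (a i - a c) <= abs y -> abs (a j - a c) <= abs y -> v i = v j.
Proof.
move=> /VsolP hv hw y0 yR hB Br i j ai aj; have y_ge0 := abs_ge0 y.
have B0 : 0 <= B by have := hB (a c); rewrite subrr abs0 => /(_ (abs_ge0 _)); apply: le_trans (abs_ge0 _).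
have [z [z0 mz zR]] := range_exists (range_max yR ((inD_range (a i)).1 (aD i))).
move: mz; rewrite ge_max => /andP[yz az]; have zp : 0 < abs z by rewrite abs_gt0.
have fz := inO_cvs Hf zR.
have cz : cvs (abs z) (recenter abs f (a i)) by apply: cvs_recenter.
have cy : cvs (abs y) (recenter abs f (a i)) by apply: cvs_rad cz; rewrite y_ge0.
have locE t : abs t <= abs y -> peval abs (loc i) t = peval abs f (a i + t) - b.
  move=> ty; rewrite (pevalB y_ge0 ty cy) ?pevalC; last exact: cvsC.
  by rewrite (peval_recenter zp az fz (le_trans ty yz)).
have cl0 : cvs (abs y) (loc i) by apply: cvsB => //; exact: cvsC.
(* As [B < r], this lets each [w l] be composed with [loc i] on the whole disc of radius [abs y]. *)
have nl : nrm (abs y) (loc i) B.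
  apply: gauss => // t ty; rewrite locE // hB //.
  by rewrite addrAC; apply: absD_le.
have cw l : cvs B (w l) by apply: ((conv_openP _ _).1 (hw l)); rewrite B0.
pose t := a j - a i; have ty : abs t <= abs y.
  by have := absB_le aj ai; rewrite opprB addrA subrK.
(* At [t = a_j - a_i] the composite only sees the constant terms of the [w l], and their combination
   at [a_j] is [v j]. *)
have ft : peval abs (loc i) t = 0 by rewrite locE // /t [a i + _]addrC subrK fa subrr.
have := congr1 (Phi i) (hv i); rewrite pscompC pscomp_sum => /(congr1 (fun e => peval abs e t)).
rewrite pevalC (peval_sum y_ge0 _ ty) => [|l]; last first.
  rewrite pscompM ?pscompX ?comp_u ?loc0 //; apply: cvsM => //.
    by apply: cvsX => //; exact: cvs_poly.
  exact: (cvs_pscomp y_ge0 (loc0 i) cl0 nl).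
move=> <-; have := congr1 (fun e : ps k => e 0%N) (hv j).
rewrite /vdm ps_sum /psconst /= => <-; apply: eq_bigr => l _.
rewrite psM0 psX0 Hu0 pscompM ?pscompX ?comp_u ?loc0 //.
have cp := cvs_poly (abs y) ('X + (a i)%:P).
rewrite (pevalM y_ge0 ty); [|exact: cvsX|exact: (cvs_pscomp y_ge0 (loc0 i) cl0 nl)].
rewrite (pevalX y_ge0 _ ty) // peval_poly !hornerE /t subrK.
by rewrite (peval_pscomp y_ge0 (loc0 i) cl0 nl (cw l) ty) ft peval0.
Qed.

(** The classical step for lifting idempotents. *)
Definition smoothstep (h : {poly k}) : {poly k} := h ^+ 2 *+ 3 - h ^+ 3 *+ 2.
Lemma smoothstepE h x : (smoothstep h).[x] = h.[x] ^+ 2 *+ 3 - h.[x] ^+ 3 *+ 2.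
Proof. by rewrite hornerD hornerN !hornerMn !horner_exp. Qed.
Lemma abs_mulrn_le x n M : abs x <= M -> abs (x *+ n) <= M.
Proof.
by move=> xM; rewrite -mulr_natl absM (le_trans _ xM) // ler_piMl ?abs_ge0 ?abs_nat.
Qed.
Lemma smoothstep_le1 h x : abs h.[x] <= 1 -> abs (smoothstep h).[x] <= 1.
Proof.
by move=> h1; rewrite smoothstepE; apply: absB_le; apply: abs_mulrn_le;
  rewrite absX exprn_ile1 ?abs_ge0.
Qed.
Lemma smoothstep_lim h x v : (v == 0) || (v == 1) -> abs (h.[x] - v) <= 1 ->
  abs ((smoothstep h).[x] - v) <= abs (h.[x] - v) ^+ 2.
Proof.
rewrite smoothstepE; set t := h.[x] => /orP[/eqP ->|/eqP ->]; rewrite -absX => t1.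
  rewrite !subr0 in t1 *; have -> : t ^+ 2 *+ 3 - t ^+ 3 *+ 2 = t ^+ 2 * (3%:R - t *+ 2) by ring.
  rewrite absM ler_piMr ?abs_ge0 //; apply: absB_le; first exact: abs_nat.
  exact: abs_mulrn_le.
have -> : t ^+ 2 *+ 3 - t ^+ 3 *+ 2 - 1 = - ((t - 1) ^+ 2 * ((t - 1) *+ 2 + 3%:R)) by ring.
rewrite absN absM ler_piMr ?abs_ge0 //; apply: absD_le; last exact: abs_nat.
exact: abs_mulrn_le.
Qed.
Lemma smoothstep_iter N h x v th : (v == 0) || (v == 1) -> 0 <= th <= 1 ->
  abs (h.[x] - v) <= th -> abs ((iter N smoothstep h).[x] - v) <= th ^+ N.+1.
Proof.
move=> v01 /andP[t0 t1] hv; elim: N => [|N IH]; first by rewrite expr1.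
have le1 : abs ((iter N smoothstep h).[x] - v) <= 1 by rewrite (le_trans IH) // exprn_ile1.
rewrite iterS (le_trans (smoothstep_lim v01 le1)) //.
apply: (@le_trans _ _ ((th ^+ N.+1) ^+ 2)).
  by rewrite lerXn2r // nnegrE ?abs_ge0 ?exprn_ge0.
by rewrite -exprM ler_wiXn2l //; lia.
Qed.
Lemma poly_near (q : {poly k}) x eta : 0 < eta ->
  exists y, [/\ y != 0, abs y <= 1 & forall t, abs (t - x) <= abs y -> abs (q.[t] - q.[x]) <= eta].
Proof.
move=> e0; pose F := poly2ps (q \Po ('X + x%:P) - q.[x]%:P).
have FE t : peval abs F t = q.[t + x] - q.[x].
  by rewrite /F peval_poly hornerD hornerN hornerC horner_comp !hornerE.
have F0 : F 0%N = 0 by rewrite -peval0 FE add0r subrr.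
have [y [y0 y1 yF]] := small_nrm ltr01 (cvs_poly 1 _) F0 e0.
exists y; split=> // t ty; have := peval_bound (abs_ge0 y) ty (cvs_poly _ _) yF.
by rewrite FE subrK.
Qed.
Lemma abs_prod_near1 (I : finType) (Q : pred I) (e : I -> k) : (forall i, Q i -> abs (e i - 1) < 1) ->
  abs (\prod_(i | Q i) e i - 1) < 1.
Proof.
move=> h; apply: (big_ind (fun x => abs (x - 1) < 1)) => //; first by rewrite subrr abs0 ltr01.
move=> x y hx hy; have -> : x * y - 1 = (x - 1) * (y - 1) + ((x - 1) + (y - 1)) by ring.
apply: absD_lt; last exact: absD_lt.
by rewrite absM -[ltRHS]mulr1 ltr_pM ?abs_ge0.
Qed.

(** * Convergence of the solution attached to a branch *)

Section LowerBound.
Variables (c j : 'I_d) (rho r : R).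
Hypotheses (rho0 : 0 < rho) (ajc : abs (a j - a c) <= rho) (r1 : r <= 1).
(** The right-hand side is the value of the product of the [abs (t - a_i)] at the tree point;
    [brad_le_prod] compares it with the branching radius. *)
Hypothesis r_le : r <= \prod_i Num.max rho (abs (a c - a i)).
Let U : {set 'I_d} := [set i | abs (a i - a j) < rho].
Let v := vU k U.

(** Almost the indicator function of the branch of [a_j]: it has absolute value [1] there
    and [< 1] on the rest of the inverse image of a disc of radius [< r]. *)
Definition quasi_idem : {poly k} := \prod_(i | i \notin U) ((a j - a i)^-1 *: ('X - (a i)%:P)).

Lemma quasi_idemE x : quasi_idem.[x] = \prod_(i | i \notin U) ((x - a i) / (a j - a i)).
Proof.
rewrite horner_prod; apply: eq_bigr => i _.
by rewrite hornerZ hornerXsubC mulrC.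
Qed.
Lemma notinU i : i \notin U -> rho <= abs (a j - a i).
Proof. by rewrite inE -leNgt absBC. Qed.
(** If [x] lies in the branch, every factor has absolute value 1. Otherwise [abs (x - a_i) >= rho]
    for [i] in [U], and multiplying by [rho ^+ #|U|] compares the numerator with the full product,
    which is [< r], and the denominator with the bound in [r_le]. *)
Lemma quasi_idem_le1 x : \prod_i abs (x - a i) < r -> abs quasi_idem.[x] <= 1.
Proof.
move=> xr; rewrite quasi_idemE abs_prod.
have [near|far] := ltP (abs (x - a j)) rho.
  rewrite big1 // => i iU; have iU' := notinU iU.
  have a0 : abs (a j - a i) != 0 by rewrite gt_eqF // (lt_le_trans rho0).
  rewrite absM absV (_ : x - a i = (x - a j) + (a j - a i)); last by rewrite addrA subrK.
  by rewrite (abs_dom (lt_le_trans near iU')) divff.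
pose l := #|U|.
have e1 : \prod_(i | i \notin U) abs ((x - a i) / (a j - a i)) =
    \prod_(i | i \notin U) abs (x - a i) / \prod_(i | i \notin U) abs (a j - a i).
  by rewrite -prodf_div; apply: eq_bigr => i _; rewrite absM absV.
have p0 : 0 < \prod_(i | i \notin U) abs (a j - a i).
  by apply: prodr_gt0 => i /notinU; apply: lt_le_trans.
rewrite e1 ler_pdivrMr // mul1r -(ler_pM2l (exprn_gt0 l rho0)).
apply: (@le_trans _ _ (\prod_i abs (x - a i))).
  rewrite [leRHS](bigID (mem U)) /= ler_wpM2r //; first by apply: prodr_ge0 => i _; exact: abs_ge0.
  rewrite -prodr_const; apply: ler_prod => i; rewrite inE => iU.
  rewrite ltW //= (_ : x - a i = (a j - a i) + (x - a j)); last by ring.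
  have iU' : abs (a j - a i) < abs (x - a j) by rewrite (absBC (a j)); apply: (@lt_le_trans _ _ rho).
  by rewrite abs_dom.
apply: (le_trans (ltW (lt_le_trans xr r_le))).
rewrite (bigID (mem U)) /= -prodr_const; apply: ler_pM.
- by apply: prodr_ge0 => i _; rewrite le_max ltW.
- by apply: prodr_ge0 => i _; rewrite le_max ltW.
- apply: ler_prod => i; rewrite inE => iU; rewrite le_max ltW //= ge_max lexx /=.
  rewrite absBC (_ : a i - a c = (a i - a j) + (a j - a c)); last by rewrite addrA subrK.
  by apply: absD_le => //; apply: ltW.
- apply: ler_prod => i iU; rewrite le_max ltW //= ge_max notinU //=.
  rewrite (_ : a c - a i = (a j - a i) - (a j - a c)); last by ring.
  by apply: absB_le => //; apply: le_trans (notinU iU).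
Qed.
(** For [i] in [U] every factor is within distance [< 1] of 1; for other [i] one factor vanishes. *)
Lemma quasi_idem_near i : abs (quasi_idem.[a i] - v i) < 1.
Proof.
rewrite /v /vU; case: ifP => iU.
  rewrite quasi_idemE; apply: abs_prod_near1 => l lU.
  have lU' := notinU lU; have ap : 0 < abs (a j - a l) by apply: lt_le_trans lU'.
  have a0 : a j - a l != 0 by rewrite -abs_gt0.
  have -> : (a i - a l) / (a j - a l) - 1 = (a i - a j) / (a j - a l) by field.
  rewrite absM absV ltr_pdivrMr // mul1r.
  by apply: lt_le_trans lU'; move: iU; rewrite inE.
by rewrite quasi_idemE (bigD1 i) ?iU //= subrr mul0r mul0r subr0 abs0 ltr01.
Qed.
Lemma v01 i : (v i == 0) || (v i == 1).
Proof. by rewrite /v /vU; case: ifP; rewrite eqxx ?orbT. Qed.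

Lemma quasi_idem_coef i n eta : 0 < eta -> exists N0, forall N, (N0 <= N)%N -> forall m, (m <= n)%N ->
  abs ((poly2ps (iter N smoothstep quasi_idem \Po ('X + (a i)%:P)) - psconst (v i)) m) <= eta.
Proof.
(* The value [2^-1] only keeps [th] positive when [q] already equals [v i] at [a_i]. *)
move=> e0; set q := quasi_idem; pose th := Num.max (abs (q.[a i] - v i)) 2^-1.
have th1 : th < 1 by rewrite gt_max quasi_idem_near /= invf_lt1 ?ltr1n // ltr0n.
have th0 : 0 < th by rewrite lt_max invr_gt0 ltr0n orbT.
have [y [y0 y1 hy]] := poly_near q (a i) th0.
have yp : 0 < abs y by rewrite abs_gt0.
have near t : abs (t - a i) <= abs y -> abs (q.[t] - v i) <= th.
  move=> /hy ht; rewrite (_ : _ - _ = (q.[t] - q.[a i]) + (q.[a i] - v i)); last by rewrite addrA subrK.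
  by apply: absD_le => //; rewrite le_max lexx.
(* The factor [abs y ^+ n] converts a Gauss norm bound into a bound on the coefficients up to [n],
   as [abs y <= 1]. *)
have [N0 hN0] : exists N0, forall N, (N0 <= N)%N -> th ^+ N.+1 < eta * abs y ^+ n.
  have ey : 0 < eta * abs y ^+ n by rewrite mulr_gt0 ?exprn_gt0.
  have /cvgrPdist_lt /(_ _ ey) [N0 _ hN0] : (fun n => th ^+ n) @ \oo --> (0 : R).
    by apply: cvg_expr; rewrite ger0_norm // ltW.
  exists N0 => N NN; have := hN0 N.+1 (leqW NN).
  by rewrite /= sub0r normrN ger0_norm ?exprn_ge0 // ltW.
exists N0 => N NN m mn.
set h := iter N smoothstep q.
have : nrm (abs y) (poly2ps (h \Po ('X + (a i)%:P) - (v i)%:P)) (th ^+ N.+1).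
  apply: gauss_poly => x xy; rewrite hornerD hornerN hornerC horner_comp !hornerE.
  apply: smoothstep_iter; rewrite ?v01 ?(ltW th0) ?(ltW th1) //.
  by apply: near; rewrite addrK.
move=> /(_ m); rewrite rmorphB /= poly2psC => hm.
rewrite -(ler_pM2r (exprn_gt0 m yp)); apply: (le_trans hm).
apply: (le_trans (ltW (hN0 N NN))); rewrite ler_wpM2l ?(ltW e0) //.
by rewrite ler_wiXn2l // ltW.
Qed.

Lemma conv_lower w : Vsol u v w -> forall l, conv_open abs (w l) r.
Proof.
move=> /VsolP hw l; apply/conv_openP => rho' /andP[rp rr].
(* A coefficient bound at the intermediate radius [abs y] gives convergence at [rho']. *)
have [y /andP[y1 y2]] := abs_dense rp rr r1.
have y0 : y != 0 by rewrite -abs_gt0 (le_lt_trans rp).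
have yR : inR (abs y).
  have y3 : abs y < 1 by apply: lt_le_trans r1.
  by split; rewrite ?abs_ge0 //; case: cl => //; exact: ltW.
have [C C0 hC] := coord_bound Hb yR y0.
apply: (@nrm_cvs _ (abs y) _ C); first by rewrite rp.
move=> n; apply/ler_addgt0Pr => eps e0.
have [K K0 hK] := vdm_bound n.
have yn : 0 < abs y ^+ n by rewrite exprn_gt0 // abs_gt0.
(* Makes the error [K * eta] of coefficient [n], weighted by [abs y ^+ n], at most [eps]; [K + 1]
   avoids a division by 0. *)
pose eta := eps / ((K + 1) * abs y ^+ n).
have K1 : 0 < K + 1 by rewrite ltr_wpDl.
have eta0 : 0 < eta by rewrite divr_gt0 // mulr_gt0.
have big i := quasi_idem_coef i n eta0.
pose N0 i := sval (cid (big i)).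
have hN0 i N : (N0 i <= N)%N -> forall m, (m <= n)%N ->
    abs ((poly2ps (iter N smoothstep quasi_idem \Po ('X + (a i)%:P)) - psconst (v i)) m) <= eta.
  by rewrite /N0; case: cid => ? h; apply: h.
pose N := \max_i N0 i; pose h := iter N smoothstep quasi_idem.
have [g [[gO hg] _]] := Hfree (inO_poly h).
have h1 x : \prod_i abs (x - a i) < r -> abs h.[x] <= 1.
  move=> xr; rewrite /h; elim: {h gO hg}N => [|M IH]; first exact: quasi_idem_le1.
  by rewrite iterS smoothstep_le1.
have ng : nrm (abs y) (recenter abs (g l) b) (C * 1).
  apply: hC => // x xD xy; rewrite -hg // peval_poly h1 //.
  by apply: le_lt_trans y2; apply: le_trans xy; apply: prod_le_f => //; exact: a_root.
pose e j0 : ps k := recenter abs (g j0) b - w j0.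
have eE i : Phi i (vdm e i) = poly2ps (h \Po ('X + (a i)%:P)) - psconst (v i).
  have -> : vdm e i = vdm (fun l => recenter abs (g l) b) i - vdm w i.
    by rewrite -sumrB; apply: eq_bigr => l' _; rewrite /e mulrBr.
  rewrite hw pscompB pscompC; congr (_ - _); rewrite pscomp_sum.
  have gh := germ_poly (a i) h; rewrite -(germ_inD (aD i) (germ_module i gO) gh).
    by apply: eq_bigr => l' _; rewrite pscompM ?pscompX ?comp_u ?loc0 // mulrC.
  by move=> t tD; rewrite -hg // peval_poly.
have : abs (e l n) <= K * eta.
  apply: hK; first exact: ltW.
  move=> i m mn; rewrite eE; apply: hN0 => //; exact: leq_bigmax.
move=> el; have -> : w l n = recenter abs (g l) b n - e l n by rewrite /e psB opprB addrC subrK.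
rewrite -ler_pdivlMr //; apply: absB_le.
  rewrite ler_pdivlMr // (le_trans (ng n)) // mulr1 lerDl ltW //.
have etaE : eta * abs y ^+ n = eps / (K + 1) by rewrite /eta invfM mulrA divfK ?gt_eqF.
apply: (le_trans el); rewrite ler_pdivlMr // -mulrA etaE mulrCA.
apply: (@le_trans _ _ eps); last by rewrite lerDr ltW.
by rewrite ler_piMr ?(ltW e0) // ler_pdivrMr // mul1r lerDl.
Qed.
End LowerBound.

(** * Bounds on the branching radius *)

Lemma brad_ub (c : 'I_d) rho x : inR rho -> abs (x - a c) <= rho ->
  abs (peval abs f x - b) <= brad abs b a f c rho.
Proof.
move=> rR xc; apply: ub_le_sup; last by exists x.
exists 1 => _ [t /= tc <-]; apply: f_b_le1 => //; exact: inD_shift (aD c) rR tc.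
Qed.
Lemma brad_le (c : 'I_d) rho (B : R) : 0 <= rho ->
  (forall x, abs (x - a c) <= rho -> abs (peval abs f x - b) <= B) -> brad abs b a f c rho <= B.
Proof.
move=> r0 h; apply: ge_sup; last by move=> _ [x /= xc <-]; exact: h.
by exists (abs (peval abs f (a c) - b)), (a c); rewrite //= subrr abs0.
Qed.
Lemma brad_le1 (c : 'I_d) rho : inR rho -> brad abs b a f c rho <= 1.
Proof.
move=> rR; apply: brad_le => [|x xc]; first by case: rR.
apply: f_b_le1 => //; exact: inD_shift (aD c) rR xc.
Qed.
Lemma brad_mono (c c' : 'I_d) rho rho' : inR rho -> 0 <= rho' <= rho -> abs (a c' - a c) <= rho ->
  brad abs b a f c' rho' <= brad abs b a f c rho.
Proof.
move=> rR /andP[r0 rr] cc; apply: brad_le => // x xc; apply: brad_ub => //.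
rewrite (_ : x - a c = (x - a c') + (a c' - a c)); last by rewrite addrA subrK.
by apply: absD_le => //; apply: le_trans rr.
Qed.
Lemma brad_le_prod (c : 'I_d) rho : inR rho ->
  brad abs b a f c rho <= \prod_i Num.max rho (abs (a c - a i)).
Proof.
move=> rR; apply: brad_le => [|x xc]; first by case: rR.
have xD : inD x by apply: inD_shift (aD c) rR xc.
apply: (le_trans (f_le_prod Hb Ha_inj a_root xD)); apply: ler_prod => i _.
rewrite abs_ge0 /= (_ : x - a i = (x - a c) + (a c - a i)); last by rewrite addrA subrK.
by apply: absD_le; rewrite le_max ?xc ?lexx ?orbT.
Qed.
(** A point of the disc distinct from [a_c], but closer to it than every other [a_i], is not in the
    fibre of [b]. *)
Lemma brad_gt0 (c : 'I_d) rho : inR rho -> 0 < rho -> 0 < brad abs b a f c rho.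
Proof.
move=> rR r0; pose m := \big[Num.min/rho]_(i | i != c) abs (a i - a c).
have m0 : 0 < m.
  apply: (big_ind (fun z => 0 < z)) => // [z z' h h'|i ic]; first by rewrite lt_min h.
  by rewrite abs_gt0 subr_eq0 (inj_eq Ha_inj).
have [y y0 ym] : exists2 y, y != 0 & abs y < m.
  have [|y y0 ym] := @small_abs (m / 2); first by rewrite divr_gt0.
  by exists y => //; apply: (le_lt_trans ym); rewrite ltr_pdivrMr // ltr_pMr // ltr1n.
have yr : abs y <= rho.
  by apply: (le_trans (ltW ym)); rewrite /m; elim/big_rec: _ => // i z _ h; rewrite ge_min h orbT.
apply: lt_le_trans (brad_ub (x := a c + y) rR _); last by rewrite addrC addKr.
have xD : inD (a c + y) by apply: (inD_shift (aD c) rR); rewrite addrC addKr.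
apply: lt_le_trans (prod_le_f Hb Ha_inj a_root xD); apply: prodr_gt0 => i _.
rewrite abs_gt0; have [->|ic] := eqVneq i c; first by rewrite addrC addKr.
apply/negP => /eqP e; have yi : y = a i - a c by apply/eqP; rewrite eq_sym subr_eq addrC -subr_eq0 -opprB e oppr0.
move: ym; rewrite yi /m (bigD1 i) //= lt_min ltxx; exact.
Qed.

(** * Branches of the tree of the fibre *)

Definition odisc (j : 'I_d) (rho : R) : {set 'I_d} := [set i | abs (a i - a j) < rho].
Definition cdisc (c : 'I_d) (rho : R) : {set 'I_d} := [set i | abs (a i - a c) <= rho].
Local Notation fullset := ([set: 'I_d]%SET).
Local Notation isbranching := (branching abs a cl).

Lemma ultra_le x y z rho : abs (x - y) <= rho -> abs (y - z) <= rho -> abs (x - z) <= rho.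
Proof. by move=> h h'; rewrite (_ : x - z = (x - y) + (y - z)); [exact: absD_le|ring]. Qed.
Lemma ultra_lt x y z rho : abs (x - y) < rho -> abs (y - z) < rho -> abs (x - z) < rho.
Proof. by move=> h h'; rewrite (_ : x - z = (x - y) + (y - z)); [exact: absD_lt|ring]. Qed.
Lemma odisc_eq i j rho : i \in odisc j rho -> odisc i rho = odisc j rho.
Proof.
rewrite inE => ij; apply/finset.setP => x; rewrite !inE; apply/idP/idP => h.
  exact: ultra_lt h ij.
by apply: ultra_lt h _; rewrite absBC.
Qed.
Lemma branchesP (c : 'I_d) rho U : reflect (exists2 j, j \in cdisc c rho & U = odisc j rho)
  (U \in branches abs a c rho).
Proof. exact: imsetP. Qed.
Lemma odisc_neq (c : 'I_d) rho j j' : j \in cdisc c rho -> j' \in cdisc c rho ->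
  odisc j rho != odisc j' rho -> abs (a j - a j') = rho.
Proof.
rewrite !inE => hj hj' ne; apply/eqP; rewrite eq_le (ultra_le hj) 1?absBC //=.
rewrite leNgt; apply: contra ne => lt; apply/eqP/odisc_eq.
by rewrite inE absBC.
Qed.
(** In particular [rho] belongs to the value group, as [const_on_disc] requires of its radius. *)
Lemma branching_witness (c : 'I_d) rho : isbranching c rho ->
  exists j j', [/\ j \in cdisc c rho, j' \in cdisc c rho & abs (a j - a j') = rho /\ 0 < rho].
Proof.
case=> -[r0 _]; rewrite /delta => /card_gt1P [_ [_ [/branchesP [j hj ->] /branchesP [j' hj' ->] ne]]].
have jj := odisc_neq hj hj' ne; exists j, j'; split=> //; split=> //.
rewrite lt_def r0 andbT -jj abs_eq0 subr_eq0 (inj_eq Ha_inj).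
by apply: contra ne => /eqP ->.
Qed.
Lemma branchingI (c : 'I_d) rho j : inR rho -> 0 < rho -> abs (a j - a c) = rho -> isbranching c rho.
Proof.
move=> rR r0 jc; split=> //; apply/card_gt1P; exists (odisc c rho), (odisc j rho); split.
- by apply/branchesP; exists c; rewrite // inE subrr abs0 ltW.
- by apply/branchesP; exists j; rewrite // inE jc.
- apply/eqP => /finset.setP /(_ c); rewrite !inE subrr abs0 r0 => /esym.
  by rewrite absBC jc ltxx.
Qed.
(** The next branching point upwards has as radius the distance from [a_c] to the nearest [a_i]
    outside the disc. *)
Lemma cdisc_branch (c : 'I_d) rho : inR rho -> cdisc c rho = fullset \/
  exists2 rho', isbranching c rho' & cdisc c rho \in branches abs a c rho'.
Proof.
move=> rR; have [->|/eqP ne] := eqVneq (cdisc c rho) fullset; first by left.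
right; have [i0 i0c] : exists i, i \notin cdisc c rho.
  apply: contrapT => h; apply: ne; apply/finset.setP => i; rewrite [RHS]inE.
  by apply: contrapT => /negP hi; apply: h; exists i.
have [i ic0 imin] := @arg_minP _ R 'I_d i0 [pred i | i \notin cdisc c rho] (fun i => abs (a i - a c)) i0c.
have ic : i \notin cdisc c rho := ic0.
have lt : rho < abs (a i - a c) by move: ic; rewrite inE -ltNge.
have iR : inR (abs (a i - a c)).
  by apply/inD_range; have /inD_range ai := aD i; have /inD_range ac := aD c;
    apply/inD_range; apply: range_le (range_max ai ac); rewrite abs_ge0 (le_trans (absD _ _)) // absN.
have i0' : 0 < abs (a i - a c) by case: rR => r0 _; apply: le_lt_trans lt.
exists (abs (a i - a c)); first exact: branchingI iR i0' erefl.
apply/branchesP; exists c; first by rewrite inE subrr abs0 ltW.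
apply/finset.setP => x; rewrite !inE; apply/idP/idP => h; first exact: le_lt_trans lt.
by rewrite leNgt; apply: contraL h => h; rewrite -leNgt; apply: imin; rewrite /= inE -ltNge.
Qed.

(** * The basis of [k^d] given by all branches but one at each branching point *)

Section Choice.
Variable Uch : 'I_d -> R -> {set {set 'I_d}}.
Hypothesis HUsub : forall (c : 'I_d) rho, isbranching c rho -> Uch c rho \subset branches abs a c rho.
Hypothesis HUcard : forall (c : 'I_d) rho, isbranching c rho -> #|Uch c rho| = (delta abs a c rho).-1.
Hypothesis HUwd : forall (c c' : 'I_d) rho, isbranching c rho -> abs (a c' - a c) <= rho ->
  Uch c' rho = Uch c rho.

Definition chosen (U : {set 'I_d}) := exists (c : 'I_d) rho, isbranching c rho /\ U \in Uch c rho.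
(** Index sets stand for the vectors [v_U]; the full set stands for the constant vector, that is for
    [E1]. *)
Definition basis_sets : {set {set 'I_d}} := fullset |: [set U | `[< chosen U >]].

Lemma missing_branch (c : 'I_d) rho : isbranching c rho -> exists U0,
  [/\ U0 \in branches abs a c rho, U0 \notin Uch c rho & branches abs a c rho = U0 |: Uch c rho].
Proof.
move=> hc; have card : #|branches abs a c rho| = #|Uch c rho|.+1.
  by rewrite HUcard // prednK //; case: hc => _ /ltnW.
have : #|branches abs a c rho :\: Uch c rho| == 1%N.
  by rewrite cardsD (finset.setIidPr (HUsub hc)) card subSnn.
case/cards1P => U0 eU0; exists U0.
have : U0 \in branches abs a c rho :\: Uch c rho by rewrite eU0 set11.
rewrite inE => /andP[n0 b0]; split=> //.
rewrite -eU0; apply/finset.setP => V; rewrite !inE; case: (boolP (V \in Uch c rho)); rewrite ?orbT ?orbF //=.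
by apply: (fintype.subsetP (HUsub hc)).
Qed.

(** Evaluating at two points in different branches at the smallest branching points first
    isolates one coefficient at a time. *)
Lemma coef_eq0 (cf : {set 'I_d} -> k) (v : 'I_d -> k) (r : R) :
  (forall i, v i = \sum_(U in basis_sets) cf U * vU k U i) ->
  (forall (c : 'I_d) rho, isbranching c rho -> brad abs b a f c rho < r ->
     forall i j, i \in cdisc c rho -> j \in cdisc c rho -> v i = v j) ->
  forall (c : 'I_d) rho U, isbranching c rho -> brad abs b a f c rho < r -> U \in Uch c rho -> cf U = 0.
Proof.
move=> vE vconst c rho.
have [n] := ubnP #|cdisc c rho|; elim: n c rho => // n IH c rho le_n U hc hr UU.
have /branchesP [j jc Uj] := fintype.subsetP (HUsub hc) U UU.
have [U0 [/branchesP [j0 j0c U0j] U0n _]] := missing_branch hc.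
have ne : odisc j rho != odisc j0 rho by rewrite -Uj -U0j; apply: contraNneq U0n => <-.
have jj0 := odisc_neq jc j0c ne.
have rp : 0 < rho by have [? [? [_ _ []]]] := branching_witness hc.
have UB : U \in basis_sets.
  by rewrite !inE; apply/orP; right; apply/asboolP; exists c, rho.
have jU : j \in U by rewrite Uj inE subrr abs0.
have j0U : j0 \notin U by rewrite Uj inE absBC jj0 ltxx.
(* [j] lies in [U] and [j0] in the omitted branch, so the coefficient of [U] survives in the
   difference of the values; the other terms are shown to vanish. *)
have := vconst c rho hc hr j j0 jc j0c; rewrite !vE => /eqP.
rewrite -subr_eq0 -sumrB (bigD1 U) //= [X in _ + X]big1 => [|U' /andP[U'B U'U]].
  by rewrite /vU jU (negPf j0U) mulr1 mulr0 subr0 addr0 => /eqP.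
rewrite -mulrBr; have [eqm|neqm] := eqVneq (j \in U') (j0 \in U').
  by rewrite /vU eqm subrr mulr0.
have U'T : U' != fullset by apply: contraNneq neqm => ->; rewrite !inE.
move: U'B; rewrite !inE (negPf U'T) => /asboolP [c' [rho' [hc' U'ch]]].
have /branchesP [j' j'c' U'E] := fintype.subsetP (HUsub hc') U' U'ch.
(* [U'] separates two points at distance [rho]. It is too big to do so if [rho' > rho]; if
   [rho' = rho] it would be [U] or the omitted branch; so it sits at a smaller branching point below
   [c], where induction applies. *)
suff key m m' : m \in cdisc c rho -> m' \in cdisc c rho -> abs (a m - a m') = rho ->
    (U' \in Uch c rho -> U' <> odisc m rho) -> m \in U' -> m' \notin U' -> cf U' = 0.
  have j0j : abs (a j0 - a j) = rho by rewrite absBC.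
  case: (boolP (j \in U')) neqm => jU'; rewrite ?negbK => j0U'.
    rewrite (key j j0) ?mul0r // => _ e; case/eqP: U'U; by rewrite e Uj.
  rewrite (key j0 j) ?mul0r // => U'c e; by case/negP: U0n; rewrite U0j -e.
move=> mc m'c mm' hU' mU' m'U'.
have U'm : U' = odisc m rho' by rewrite U'E; apply/esym/odisc_eq; rewrite -U'E.
have m'm : abs (a m' - a m) = rho by rewrite absBC.
have rp' : 0 < rho' by have [? [? [_ _ []]]] := branching_witness hc'.
have mc' : abs (a m - a c') <= rho'.
  move: mU' j'c'; rewrite U'E !inE => /ltW; exact: ultra_le.
move: (mc); rewrite inE => mc0.
have [lt|gt|eqr] := ltgtP rho' rho; first 1 last.
- by case/negP: m'U'; rewrite U'm inE m'm.
- case: hU' => //; last by rewrite U'm eqr.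
  rewrite -(HUwd (c' := c') hc) -?eqr //; rewrite absBC in mc'.
  by apply: (ultra_le (y := a m)); rewrite ?eqr // -eqr.
have c'c : abs (a c' - a c) <= rho.
  by apply: (ultra_le (y := a m)) => //; rewrite absBC (le_trans mc') // ltW.
apply: (IH c' rho' _ U' hc' _ U'ch); last first.
  by apply: le_lt_trans hr; apply: brad_mono; [case: hc|rewrite !ltW|].
apply: (leq_trans _ (_ : #|cdisc c rho| <= n)%N) => //.
apply: proper_card; apply/properP; split.
  apply/fintype.subsetP => x; rewrite !inE => xc'.
  by apply: ultra_le c'c; apply: le_trans (ltW lt).
exists m' => //; rewrite inE; apply/negP => h.
rewrite absBC in h; have := ultra_le mc' h.
by rewrite mm' leNgt lt.
Qed.

(** An omitted branch is the closed disc of its point minus the chosen branches, and that disc is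
    everything or a branch at a higher branching point; hence the induction on the size of the
    complement. *)
Lemma ind_span (U : {set 'I_d}) :
  U = fullset \/ (exists (c : 'I_d) rho, isbranching c rho /\ U \in branches abs a c rho) ->
  exists cf : {set 'I_d} -> k, forall i, vU k U i = \sum_(V in basis_sets) cf V * vU k V i.
Proof.
have base V : V \in basis_sets ->
    exists cf : {set 'I_d} -> k, forall i, vU k V i = \sum_(W in basis_sets) cf W * vU k W i.
  move=> VB; exists (fun W => (W == V)%:R) => i.
  by rewrite (bigD1 V) //= eqxx mul1r big1 ?addr0 // => W /andP[_ /negPf ->]; rewrite mul0r.
have [n] := ubnP (#|~: U|); elim: n U => // n IH U le_n [->|[c [rho [hc UU]]]].
  by apply: base; rewrite inE set11.
have [UB|UB] := boolP (U \in basis_sets); first exact: base.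
have [U0 [U0b U0n bE]] := missing_branch hc.
have chB V : V \in Uch c rho -> V \in basis_sets.
  by move=> h; rewrite !inE; apply/orP; right; apply/asboolP; exists c, rho.
have UU0 : U = U0.
  by move: UU; rewrite bE inE => /orP[/set1P //|/chB]; rewrite (negPf UB).
have rp : 0 < rho by have [? [? [_ _ []]]] := branching_witness hc.
have [j jc Uj] := branchesP _ _ _ UU.
have [cfD cfDE] : exists cf : {set 'I_d} -> k,
    forall i, vU k (cdisc c rho) i = \sum_(W in basis_sets) cf W * vU k W i.
  apply: IH.
    rewrite ltnS in le_n; apply: leq_trans le_n; apply: proper_card; rewrite finset.properC; apply/properP; split.
      apply/fintype.subsetP => x; rewrite Uj !inE in jc *; move=> /ltW h; exact: ultra_le h jc.
    have [m [m' [mc m'c [mm' _]]]] := branching_witness hc.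
    have [mU|mU] := boolP (m \in U); last by exists m.
    exists m' => //; apply/negP => m'U; move: mU m'U; rewrite Uj !inE => h h'.
    have h2 : abs (a j - a m') < rho by rewrite absBC.
    by have := ultra_lt h h2; rewrite mm' ltxx.
  have [] := cdisc_branch c (_ : inR rho); first by case: hc.
    by left.
  by move=> [rho' h h']; right; exists c, rho'.
exists (fun W => cfD W - (W \in Uch c rho)%:R) => i.
under eq_bigr => W _ do rewrite mulrBl.
rewrite sumrB -cfDE; apply/eqP; rewrite eq_sym subr_eq; apply/eqP.
have -> : \sum_(W in basis_sets) (W \in Uch c rho)%:R * vU k W i = \sum_(W in Uch c rho) vU k W i.
  rewrite (bigID (mem (Uch c rho))) /= [X in _ + X]big1 ?addr0 => [|W /andP[_ /negPf ->]]; last by rewrite mul0r.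
  rewrite big_mkcond [RHS]big_mkcond /=; apply: eq_bigr => W _.
  by case: (boolP (W \in Uch c rho)) => [h|]; rewrite ?andbF // chB // mul1r.
transitivity (\sum_(W in branches abs a c rho) vU k W i); last first.
  by rewrite bE big_setU1 //= UU0.
rewrite {1}/vU; case: ifP => ic.
  rewrite (bigD1 (odisc i rho)) /=; last by apply/branchesP; exists i.
  rewrite big1 ?addr0 => [|W /andP[/branchesP [l lc ->] ne]].
    by rewrite /vU inE subrr abs0 rp.
  rewrite /vU; case: ifP => // il; case/eqP: ne.
  by rewrite (odisc_eq il).
rewrite big1 // => W /branchesP [l lc ->]; rewrite /vU; case: ifP => // il.
case/negP: (negbT ic); move: lc il; rewrite !inE => h /ltW h'; exact: ultra_le h' h.
Qed.

(** A single fibre point is a closed disc of radius 0, so its indicator is reached by [cdisc_branch]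
    and [ind_span]. *)
Lemma basis_span (v : 'I_d -> k) :
  exists cf : {set 'I_d} -> k, forall i, v i = \sum_(V in basis_sets) cf V * vU k V i.
Proof.
have sp i : exists cf : {set 'I_d} -> k, forall l,
    (l == i)%:R = \sum_(V in basis_sets) cf V * vU k V l.
  have [cf cfE] : exists cf : {set 'I_d} -> k,
      forall l, vU k (cdisc i 0) l = \sum_(V in basis_sets) cf V * vU k V l.
    apply: ind_span; have [] := cdisc_branch i range0; first by left.
    by move=> [rho' h h']; right; exists i, rho'.
  exists cf => l; rewrite -cfE /vU inE -abs0 [abs 0]abs0.
  have -> : (abs (a l - a i) <= 0) = (l == i).
    by rewrite -[RHS](inj_eq Ha_inj) -subr_eq0 -abs_eq0 eq_le abs_ge0 andbT.
  by case: eqP.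
pose cf i := sval (cid (sp i)).
have cfE i l : (l == i)%:R = \sum_(V in basis_sets) cf i V * vU k V l.
  by rewrite /cf; case: cid.
exists (fun V => \sum_i v i * cf i V) => l.
under eq_bigr => V _ do rewrite mulr_suml.
rewrite exchange_big /= (bigD1 l) //= [X in _ + X]big1 ?addr0 => [|i il].
  under eq_bigr => V _ do rewrite -mulrA.
  by rewrite -mulr_sumr -cfE eqxx mulr1.
under eq_bigr => V _ do rewrite -mulrA.
by rewrite -mulr_sumr -cfE eq_sym (negPf il) mulr0.
Qed.
Lemma basis_indep (cf : {set 'I_d} -> k) :
  (forall i, \sum_(V in basis_sets) cf V * vU k V i = 0) -> forall V, V \in basis_sets -> cf V = 0.
Proof.
move=> cf0; have ch U : chosen U -> cf U = 0.
  move=> [c [rho [hc UU]]].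
  (* The bound 2 exceeds every branching radius, so no branch is left out. *)
  apply: (@coef_eq0 cf (fun=> 0) 2 _ _ c rho U hc _ UU) => //.
  by apply: (le_lt_trans (brad_le1 c _)); [case: hc|rewrite ltr1n].
move=> V; have [i0 _] : exists i : 'I_d, true by exists (Ordinal d_gt0).
rewrite !inE => /orP[/eqP ->|/asboolP]; last exact: ch.
have := cf0 i0; rewrite (bigD1 fullset) ?inE ?eqxx //= big1 ?addr0 => [|W /andP[]].
  by rewrite /vU inE mulr1.
by rewrite !inE => /orP[/eqP ->|/asboolP /ch -> _]; rewrite ?eqxx // mul0r.
Qed.
(** Counting by rank: the matrix of the [v_U] is both row free and row full. *)
Lemma card_basis : #|basis_sets| = d.
Proof.
pose X : 'M[k]_(#|basis_sets|, d) := \matrix_(l, i) vU k (enum_val l) i.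
have free : row_free X.
  apply: inj_row_free => z zX; apply/rowP => l; rewrite mxE.
  pose cf (V : {set 'I_d}) := \sum_(m | enum_val m == V) z 0 m.
  have cfl m : cf (enum_val m) = z 0 m.
    by rewrite /cf (big_pred1 m) // => m'; rewrite (inj_eq enum_val_inj).
  rewrite -cfl; apply: basis_indep; last exact: enum_valP.
  move=> i; have := congr1 (fun r : 'rV_d => r 0 i) zX; rewrite !mxE => e; rewrite -[RHS]e.
  rewrite big_enum_val; apply: eq_bigr => m _; by rewrite cfl mxE.
have full : row_full X.
  rewrite -sub1mx; apply/row_subP => i.
  have [cf cfE] := basis_span (fun l => (i == l)%:R).
  apply/submxP; exists (\row_m cf (enum_val m)); apply/rowP => l.
  by rewrite !mxE cfE big_enum_val; apply: eq_bigr => m _; rewrite !mxE.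
exact: etrans (esym (eqP free)) (eqP full).
Qed.

(** * Radii and the optimal basis *)

Lemma rad_ps_ub c r : 0 <= r < 1 -> conv_open abs c r -> r <= rad_ps abs c.
Proof.
move=> r01 hc; apply: ub_le_sup; last by [].
by exists 1 => x [/andP[_ /ltW]].
Qed.
Lemma rad_vec_le1 (w : vec k d) : rad_vec abs w <= 1.
Proof. by rewrite /rad_vec; elim/big_rec: _ => // i x _ h; rewrite ge_min h orbT. Qed.
Lemma rad_vec_ge (w : vec k d) r : 0 <= r <= 1 -> (forall j, conv_open abs (w j) r) ->
  r <= rad_vec abs w.
Proof.
move=> /andP[r0 r1] hw; apply: (big_ind (fun x => r <= x)) => // [x y h h'|j _].
  by rewrite le_min h.
rewrite leNgt; apply/negP => lt; set q := rad_ps abs (w j) in lt.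
have q0 : 0 <= q.
  apply: rad_ps_ub; first by rewrite lexx ltr01.
  by move=> rho /andP[h /lt_geF]; rewrite h.
(* [rad_ps] only ranges over radii below 1, and the midpoint is below 1 even when [r = 1]. *)
have [m1 m2] : q < (q + r) / 2 /\ (q + r) / 2 < r by split; lra.
have mw : conv_open abs (w j) ((q + r) / 2).
  by move=> rho /andP[h0 h1]; apply: hw; rewrite h0 (lt_trans h1).
have m01 : 0 <= (q + r) / 2 < 1 by rewrite (le_trans q0 (ltW m1)) (lt_le_trans m2 r1).
by have := rad_ps_ub m01 mw; rewrite leNgt m1.
Qed.
Lemma cvs_rad_vec (w : vec k d) rho j : 0 <= rho < rad_vec abs w -> cvs rho (w j).
Proof.
move=> /andP[r0 lt]; have {}lt : rho < rad_ps abs (w j).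
  by apply: lt_le_trans lt _; rewrite /rad_vec (bigD1 j) //= ge_min lexx.
have [|r [_ hr] rr] := sup_gt _ lt.
  exists 0; split; first by rewrite lexx ltr01.
  by move=> x /andP[h /lt_geF]; rewrite h.
by apply: ((conv_openP _ _).1 hr); rewrite r0.
Qed.
Lemma conv_rad_vec (w : vec k d) r j : r <= rad_vec abs w -> conv_open abs (w j) r.
Proof.
move=> h; apply/conv_openP => rho /andP[r0 rr]; apply: cvs_rad_vec.
by rewrite r0 (lt_le_trans rr).
Qed.

Lemma E1_vsol : Vsol u (fun=> 1) (@E1 k d).
Proof.
apply/VsolP => i; rewrite /vdm (bigD1 (Ordinal d_gt0)) //= expr0 mul1r big1 ?addr0 // => j j0.
rewrite /E1 ifN ?psC0 ?mulr0 //; apply: contra j0 => /eqP j0; exact/eqP/val_inj.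
Qed.
Lemma E1_rad : rad_vec abs (@E1 k d) = 1.
Proof.
apply/eqP; rewrite eq_le rad_vec_le1 rad_vec_ge ?ler01 ?lexx // => j.
apply/conv_openP => rho _; rewrite /E1; case: ifP => _; exact: cvsC.
Qed.
Lemma branch_rad (c : 'I_d) rho U w : isbranching c rho -> U \in Uch c rho -> Vsol u (vU k U) w ->
  horizontal abs b G w /\ rad_vec abs w = brad abs b a f c rho.
Proof.
move=> hc UU hw; have [rR _] := hc.
have /branchesP [j jc Uj] := fintype.subsetP (HUsub hc) U UU.
have [j1 [j2 [j1c j2c [j12 rp]]]] := branching_witness hc.
have conv l : conv_open abs (w l) (brad abs b a f c rho).
  apply: (@conv_lower c j rho _ rp _ (brad_le1 _ rR) (brad_le_prod _ rR) w).
    by move: jc; rewrite inE.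
  by move: hw; rewrite Uj.
split.
  exists (brad abs b a f c rho); split; first exact: brad_gt0.
  by split=> //; apply/Ds_kerP; exists (vU k U).
apply/eqP; rewrite eq_le rad_vec_ge ?brad_le1 ?andbT ?(ltW (brad_gt0 _ _ _)) //.
rewrite leNgt; apply/negP => lt.
have y0 : a j1 - a j2 != 0 by rewrite -abs_gt0 j12.
(* The omitted branch supplies a point of the closed disc at which [v_U] is 0, so [v_U] is not
   constant there. *)
have [U0 [/branchesP [j0 j0c U0j] U0n _]] := missing_branch hc.
have := @const_on_disc (vU k U) w _ c (a j1 - a j2) (brad abs b a f c rho) hw
  (fun l => conv_rad_vec l (lexx _)) y0.
rewrite j12 => /(_ rR (fun x => brad_ub rR) lt j j0).
move: (jc) (j0c); rewrite !inE => jc' j0c' /(_ jc' j0c').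
have jU : j \in U by rewrite Uj inE subrr abs0.
have j0U : j0 \notin U.
  apply: contra U0n => j0U; rewrite U0j.
  by rewrite (odisc_eq (i := j0) (j := j) (rho := rho)) -?Uj.
by rewrite /vU jU (negPf j0U) => /eqP; rewrite oner_eq0.
Qed.

Lemma Vsol_comb q (c : 'I_q -> k) (v : 'I_q -> 'I_d -> k) (w : 'I_q -> vec k d) :
  (forall l, Vsol u (v l) (w l)) ->
  (forall j n, \sum_(l < q) c l * w l j n = 0) <-> (forall i, \sum_(l < q) c l * v l i = 0).
Proof.
move=> hw; have /VsolP hs := Vsol_lin c hw; split=> [h0 i|h0 j n].
  have := congr1 (fun e : ps k => e 0%N) (hs i).
  rewrite /psconst /= => <-; rewrite /vdm ps_sum big1 // => j _.
  by rewrite psM big1 // => m _; rewrite h0 mulr0.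
have h1 : Vsol u (fun i => \sum_l c l * v l i) (fun j n => \sum_l c l * w l j n) by apply/VsolP.
have h2 : Vsol u (fun i => \sum_l c l * v l i) (fun _ _ => 0).
  apply/VsolP => i; rewrite h0 psC0 /vdm big1 // => l _.
  by rewrite (_ : (fun=> 0) = 0) ?mulr0.
by have := congr1 (fun e : vec k d => e j n) (Vsol_uniq h1 h2).
Qed.

Definition sol (U : {set 'I_d}) : vec k d := sval (cid (Vsol_exists (vU k U))).
Lemma solP U : Vsol u (vU k U) (sol U). Proof. by rewrite /sol; case: cid. Qed.
Lemma sol_full : sol fullset = @E1 k d.
Proof.
apply: Vsol_uniq (solP _) _; have := E1_vsol; congr Vsol.
by apply/funext => i; rewrite /vU inE.
Qed.
Lemma sol_horizontal U : U \in basis_sets ->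
  horizontal abs b G (sol U) /\ 0 < rad_vec abs (sol U).
Proof.
rewrite !inE => /orP[/eqP ->|/asboolP [c [rho [hc UU]]]]; last first.
  have [h ->] := branch_rad hc UU (solP U); split=> //; apply: brad_gt0; first by case: hc.
  by have [? [? [_ _ []]]] := branching_witness hc.
rewrite sol_full E1_rad ltr01; split=> //; exists 1; split; first exact: ltr01.
split=> [j|]; last by apply/Ds_kerP; exists (fun=> 1); exact: E1_vsol.
by apply: conv_rad_vec; rewrite E1_rad.
Qed.

Definition rad_le (U V : {set 'I_d}) := rad_vec abs (sol U) <= rad_vec abs (sol V).
(** Increasing radii match the order of the multiradius, whose index [m] asks for [d - m]
    solutions. *)
Definition basis_seq := sort rad_le (enum basis_sets).
Definition basis_nth (l : 'I_d) := nth fullset basis_seq l.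
Lemma size_basis_seq : size basis_seq = d.
Proof. by rewrite size_sort -cardE card_basis. Qed.
Lemma mem_basis_seq U : (U \in basis_seq) = (U \in basis_sets).
Proof. by rewrite mem_sort mem_enum. Qed.
Lemma basis_nth_in l : basis_nth l \in basis_sets.
Proof. by rewrite -mem_basis_seq mem_nth // size_basis_seq. Qed.
Lemma basis_nth_inj : injective basis_nth.
Proof.
move=> l l' /eqP; rewrite nth_uniq ?size_basis_seq ?sort_uniq ?enum_uniq //.
by move=> /eqP /val_inj.
Qed.
Lemma basis_nth_surj U : U \in basis_sets -> exists l, U = basis_nth l.
Proof.
rewrite -mem_basis_seq => UB; have lt : (index U basis_seq < d)%N.
  by rewrite -[d in X in (_ < X)%N]size_basis_seq index_mem.
by exists (Ordinal lt); rewrite /basis_nth nth_index.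
Qed.
Lemma basis_nth_mono (l l' : 'I_d) : (l <= l')%N ->
  rad_vec abs (sol (basis_nth l)) <= rad_vec abs (sol (basis_nth l')).
Proof.
move=> ll; have tot : total rad_le by move=> U V; exact: le_total.
have tr : transitive rad_le by move=> V U W; exact: le_trans.
have := sorted_leq_nth tr (fun U => lexx _) fullset (sort_sorted tot (enum basis_sets)).
by apply=> //; rewrite inE size_basis_seq.
Qed.
Lemma sum_basis_nth (F : {set 'I_d} -> k) : \sum_(U in basis_sets) F U = \sum_l F (basis_nth l).
Proof.
have := perm_sort rad_le (enum basis_sets) => /permPl /(perm_big _) => e.
rewrite -big_enum -[LHS]e (big_nth fullset) -/basis_seq size_basis_seq big_mkord.
by [].
Qed.
Definition hbasis (l : 'I_d) : vec k d := sol (basis_nth l).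

Lemma hbasis_span h : horizontal abs b G h -> exists v (cf : 'I_d -> k), [/\ Vsol u v h,
  (forall i, v i = \sum_l cf l * vU k (basis_nth l) i) &
  forall j n, h j n = \sum_(l < d) cf l * hbasis l j n].
Proof.
move=> [r [_ [_ /Ds_kerP [v hv]]]]; have [cf cfE] := basis_span v.
have vE i : v i = \sum_l cf (basis_nth l) * vU k (basis_nth l) i by rewrite cfE sum_basis_nth.
exists v, (fun l => cf (basis_nth l)); split=> // j n.
have h1 := Vsol_lin (fun l => cf (basis_nth l)) (fun l => solP (basis_nth l)).
have e : v = fun i => \sum_l cf (basis_nth l) * vU k (basis_nth l) i by apply/funext.
by rewrite -e in h1; rewrite (Vsol_uniq hv h1).
Qed.
Lemma hbasis_indep : lin_indep hbasis.
Proof.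
move=> c /(Vsol_comb c (fun l => solP (basis_nth l))) c0 l.
pose cf (U : {set 'I_d}) := \sum_(m | basis_nth m == U) c m.
have cfE m : cf (basis_nth m) = c m.
  by rewrite /cf (big_pred1 m) // => m'; rewrite (inj_eq basis_nth_inj).
rewrite -cfE; apply: basis_indep; last exact: basis_nth_in.
by move=> i; rewrite sum_basis_nth -[RHS](c0 i); apply: eq_bigr => m _; rewrite cfE.
Qed.

(** Convergence up to [r] makes [v] constant on all discs of smaller branching radius, so [coef_eq0]
    removes the basis elements of smaller radius. This is where optimality comes from. *)
Lemma hbasis_filter v h (cf : 'I_d -> k) r : r <= 1 -> Vsol u v h ->
  (forall j, conv_open abs (h j) r) -> (forall i, v i = \sum_l cf l * vU k (basis_nth l) i) ->
  forall l, rad_vec abs (hbasis l) < r -> cf l = 0.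
Proof.
move=> r1 hv hr vE l lr.
pose cf' (U : {set 'I_d}) := \sum_(m | basis_nth m == U) cf m.
have cfE m : cf' (basis_nth m) = cf m.
  by rewrite /cf' (big_pred1 m) // => m'; rewrite (inj_eq basis_nth_inj).
have := basis_nth_in l; rewrite !inE => /orP[/eqP e|/asboolP [c [rho [hc UU]]]].
  by move: lr; rewrite /hbasis e sol_full E1_rad ltNge r1.
have [_ radE] := branch_rad hc UU (solP (basis_nth l)).
rewrite -cfE; apply: (@coef_eq0 cf' v r _ _ c rho _ hc _ UU); last by rewrite -radE.
  by move=> i; rewrite sum_basis_nth vE; apply: eq_bigr => m _; rewrite cfE.
move=> c1 rho1 hc1 br i j; rewrite !inE => ic jc.
have [j1 [j2 [_ _ [j12 rp]]]] := branching_witness hc1; have [rR _] := hc1.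
have y0 : a j1 - a j2 != 0 by rewrite -abs_gt0 j12.
have := @const_on_disc v h r c1 (a j1 - a j2) (brad abs b a f c1 rho1) hv hr y0.
by rewrite j12 => /(_ rR (fun x => brad_ub rR) br i j ic jc).
Qed.

Lemma hbasis_multirad l : rad_vec abs (hbasis l) = multirad abs b G l.
Proof.
set r0 := rad_vec _ _; have [_ r0_gt0] := sol_horizontal (basis_nth_in l).
(* The sorted basis elements from position [l] on are [d - l] solutions of radius at least [r0]. *)
have mem_r0 : [set r : R | 0 < r <= 1 /\ exists e : 'I_(d - l) -> vec k d,
    (forall m, horizontal_on abs b G r (e m)) /\ lin_indep e] r0.
  split; first by rewrite r0_gt0 rad_vec_le1.
  have lt (m : 'I_(d - l)) : (l + m < d)%N by have := ltn_ord m; rewrite ltn_subRL.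
  exists (fun m => hbasis (Ordinal (lt m))); split=> [m|c c0 m].
    split=> [j|]; first by apply: conv_rad_vec; apply: basis_nth_mono; rewrite leq_addr.
    by apply/Ds_kerP; exists (vU k (basis_nth (Ordinal (lt m)))); exact: solP.
  pose c' (t : 'I_d) := \sum_(m | Ordinal (lt m) == t) c m.
  have c'E m' : c' (Ordinal (lt m')) = c m'.
    rewrite /c' (big_pred1 m') // => m''; rewrite -(inj_eq val_inj) /= eqn_add2l.
    by rewrite (inj_eq val_inj).
  rewrite -c'E; apply: hbasis_indep => j n; rewrite -[RHS](c0 j n).
  under eq_bigr => t _ do rewrite /c' mulr_suml.
  rewrite (exchange_big_dep xpredT) //=; apply: eq_bigr => m' _.
  rewrite (big_pred1 (Ordinal (lt m'))) // => t; exact: eq_sym.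
apply/eqP; rewrite eq_le; apply/andP; split.
  apply: ub_le_sup => //; by exists 1 => x [/andP[_ ?] _].
apply: ge_sup; first by exists r0.
(* For [r > r0] the coordinates of the [e m] at positions up to [l] vanish by [hbasis_filter], which
   would leave [d - l] independent vectors in dimension [d - l - 1]. *)
move=> r [/andP[rp r1] [e [he ie]]]; rewrite leNgt; apply/negP => lt.
have he' m : exists v (cf : 'I_d -> k), [/\ Vsol u v (e m),
    (forall i, v i = \sum_l cf l * vU k (basis_nth l) i) &
    forall j n, e m j n = \sum_(l < d) cf l * hbasis l j n].
  by apply: hbasis_span; exists r; split=> //; exact: he.
pose v m := sval (cid (he' m)); pose cf m := sval (cid (svalP (cid (he' m)))).
have hv m : [/\ Vsol u (v m) (e m),
    (forall i, v m i = \sum_l cf m l * vU k (basis_nth l) i) &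
    forall j n, e m j n = \sum_(l < d) cf m l * hbasis l j n].
  exact: svalP (cid (svalP (cid (he' m)))).
have cf0 m (t : 'I_d) : (t <= l)%N -> cf m t = 0.
  move=> tl; have [h1 h2 _] := hv m; have [hm _] := he m.
  apply: (hbasis_filter r1 h1 hm h2); apply: le_lt_trans lt; exact: basis_nth_mono.
have lt' (t : 'I_(d - l.+1)) : (l.+1 + t < d)%N by have := ltn_ord t; rewrite ltn_subRL.
pose X : 'M[k]_(d - l, d - l.+1) := \matrix_(m, t) cf m (Ordinal (lt' t)).
have : row_free X.
  apply: inj_row_free => z zX; apply/rowP => m; rewrite mxE.
  apply: (ie (fun m => z 0 m)) => j n.
  have eE m' : e m' j n = \sum_(t < d) cf m' t * hbasis t j n by have [_ _] := hv m'.
  under eq_bigr => m' _ do rewrite eE mulr_sumr.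
  rewrite exchange_big /= big1 // => t _.
  under eq_bigr => m' _ do rewrite mulrA.
  rewrite -mulr_suml; case: (leqP t l) => tl.
    by rewrite big1 ?mul0r // => m' _; rewrite cf0 ?mulr0.
  have tlt : (t - l.+1 < d - l.+1)%N by rewrite ltn_sub2r // (leq_ltn_trans tl).
  have := congr1 (fun r : 'rV_(d - l.+1) => r 0 (Ordinal tlt)) zX; rewrite !mxE => e0.
  rewrite (_ : \sum_i _ = 0) ?mul0r // -[RHS]e0; apply: eq_bigr => m' _; rewrite mxE.
  by congr (_ * cf _ _); apply: val_inj; rewrite /= subnKC.
rewrite /row_free => /eqP rk; have := rank_leq_col X; rewrite rk leqNgt.
by case/negP; rewrite ltn_sub2l.
Qed.

Lemma hbasis_optimal : optimal_basis abs b G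
  ([set w | exists (c : 'I_d) rho U, [/\ isbranching c rho, U \in Uch c rho & Vsol u (vU k U) w]]
   `|` [set @E1 k d]).
Proof.
exists hbasis; split.
- move=> l l' e; apply: basis_nth_inj; apply/finset.setP => i.
  have /VsolP/(_ i) h := solP (basis_nth l); have /VsolP/(_ i) h' := solP (basis_nth l').
  have e' : sol (basis_nth l) = sol (basis_nth l') := e.
  have := congr1 (fun q : ps k => q 0%N) (etrans (esym h) (etrans (congr1 (vdm^~ i) e') h')).
  rewrite /psconst /= /vU; case: (i \in basis_nth l); case: (i \in basis_nth l') => // /eqP.
    by rewrite oner_eq0.
  by rewrite eq_sym oner_eq0.
- apply/seteqP; split=> w /=.
    case=> [[c [rho [U [hc UU hw]]]]|->].
      have UB : U \in basis_sets by rewrite !inE; apply/orP; right; apply/asboolP; exists c, rho.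
      have [l e] := basis_nth_surj UB; exists l => //; rewrite /hbasis -e.
      exact: Vsol_uniq (solP U) hw.
    have TB : fullset \in basis_sets by rewrite !inE eqxx.
    have [l e] := basis_nth_surj TB; exists l => //; by rewrite /hbasis -e sol_full.
  case=> l _ <-; have := basis_nth_in l; rewrite !inE => /orP[/eqP e|/asboolP [c [rho [hc UU]]]].
    by right; rewrite /hbasis e sol_full.
  by left; exists c, rho, (basis_nth l); split=> //; exact: solP.
- by move=> l; have [] := sol_horizontal (basis_nth_in l).
- split; first exact: hbasis_indep.
  by move=> h /hbasis_span [_ [cf [_ _ hE]]]; exists cf.
- exact: hbasis_multirad.
Qed.
End Choice.
End Horizontal.
End Cover.
End Disc.
End NonArchimedean.

Unset Implicit Arguments.
Theorem theorem4p4 (R : realType) (k : closedFieldType) (abs : k -> R) (p : nat)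
  (Habs : is_nonarch_pabs abs p)
  (cl : bool) (d : nat) (f : ps k)
  (* phi : D_t^{+-} -> D_s^{+-}, s = f(t), finite etale of degree d *)
  (Hf : inO abs cl f)
  (Hfmap : forall x, indisc abs cl x -> indisc abs cl (peval abs f x))
  (Hetale : forall x, indisc abs cl x -> peval abs (psderiv f) x != 0)
  (Hfree : forall h, inO abs cl h ->
     exists! g : 'I_d -> ps k, (forall j, inO abs cl (g j)) /\
       forall x, indisc abs cl x ->
         peval abs h x = \sum_(j < d) peval abs (g j) (peval abs f x) * x ^+ j)
  (* P(s,X) = sum_j P j X^j : monic of degree d over O_s^{+-}, P(f(t),t) = 0 *)
  (P : 'I_d.+1 -> ps k)
  (HPO : forall j, inO abs cl (P j)) (HPmonic : P ord_max = psconst 1)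
  (HPf : forall x, indisc abs cl x ->
     \sum_(j < d.+1) peval abs (P j) (peval abs f x) * x ^+ j = 0)
  (* the fibre phi^{-1}(b) = {a_1,...,a_d} *)
  (b : k) (Hb : indisc abs cl b) (a : 'I_d -> k) (Ha_inj : injective a)
  (Hfib : forall x, indisc abs cl x -> (peval abs f x = b <-> exists i, x = a i))
  (* u_{a_i}(s) in k[[s-b]] : root of P(s,X) with constant term a_i *)
  (u : 'I_d -> ps k) (Hu0 : forall i, u i 0%N = a i)
  (HuP : forall i n,
     \sum_(j < d.+1) psmul (recenter abs (P j) b) (pspow (u i) j) n = 0)
  (* matrix of D_s = (1/f'(t)) d/dt on the basis t^j e of T_phi *)
  (G : 'I_d -> 'I_d -> ps k) (HGO : forall i j, inO abs cl (G i j))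
  (HG : forall (j : 'I_d) x, indisc abs cl x ->
     j%:R * x ^+ j.-1 =
     peval abs (psderiv f) x * \sum_(i < d) peval abs (G i j) (peval abs f x) * x ^+ i)
  (* 0 < r_1 < ... < r_n <= 1 : the branching radii *)
  (n : nat) (r : 'I_n -> R) (Hr_incr : forall i j : 'I_n, (i < j)%N -> r i < r j)
  (Hr : forall x : R, (exists i, r i = x) <->
        exists c rho, branching abs a cl c rho /\ brad abs b a f c rho = x)
  (* choice of delta(eta) - 1 branches at every branching point eta *)
  (Uch : 'I_d -> R -> {set {set 'I_d}})
  (HUsub : forall c rho, branching abs a cl c rho -> Uch c rho \subset branches abs a c rho)
  (HUcard : forall c rho, branching abs a cl c rho -> #|Uch c rho| = (delta abs a c rho).-1)
  (HUwd : forall c c' rho, branching abs a cl c rho -> abs (a c' - a c) <= rho ->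
          Uch c' rho = Uch c rho) :
  let Pi (i : 'I_n) : set (vec k d) :=
    [set w | exists c rho U, [/\ branching abs a cl c rho, brad abs b a f c rho = r i,
                               U \in Uch c rho & Vsol u (vU k U) w]] in
  [/\ (forall i w, Pi i w -> horizontal abs b G w /\ rad_vec abs w = r i),
      Vsol u (fun _ => 1) (@E1 k d) &
      optimal_basis abs b G (\bigcup_(i in setT) Pi i `|` [set @E1 k d])].
Proof.
have branch := branch_rad Habs Hf Hfmap Hfree HPO HPmonic HPf Hetale HGO HG Hb Ha_inj Hu0 HuP HUsub HUcard.
have optimal := hbasis_optimal Habs Hf Hfmap Hfree HPO HPmonic HPf Hetale HGO HG Hb Ha_inj Hu0 HuP HUsub HUcard HUwd.
have ones := E1_vsol Habs Hfree u.
move=> Pi; split=> //.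
  by move=> i w [c [rho [U [hc <- UU hw]]]]; apply: branch hc UU hw.
(* By [Hr] every branching radius is some [r i], so the union over [i] removes the condition on the
   radius. *)
suff -> : \bigcup_(i in setT) Pi i = [set w | exists c rho U,
    [/\ branching abs a cl c rho, U \in Uch c rho & Vsol u (vU k U) w]] by [].
apply/seteqP; split=> w /=; first by move=> [i _ [c [rho [U [hc _ UU hw]]]]]; exists c, rho, U.
move=> [c [rho [U [hc UU hw]]]].
have [i ri] : exists i, r i = brad abs b a f c rho by apply/Hr; exists c, rho.
by exists i => //; exists c, rho, U.
Qed.
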